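(* Let $u_0\in H^1(\mathbb S)$ with $h:=\int_{\mathbb S}u_{0x}^2\,dx\neq1$. If $u$ is a global admissible conservative weak solution, in the sense defined below, of the problem $$u_t-u^2u_x=\partial_x^{-1}(u-uu_x^2)-f(t),\qquad u(0,x)=u_0(x),\qquad u(t,x+1)=u(t,x),$$ then $u$ is unique. That is, any two such solutions with the same initial datum $u_0$ coincide for a.e. $t\ge0$ and a.e. $x$.
   Context: $\mathbb S=\mathbb R/\mathbb Z$; functions on $\mathbb S$ are identified with 1-periodic functions on $\mathbb R$. For $w$ on $\mathbb S$ write - $\overline w=\int_{\mathbb S}w\,dx$; - $\mathbb Pw=w-\overline w$; - $\partial_x^{-1}w(x)=\int_0^x\mathbb Pw(y)\,dy$. Test functions $\psi\in C_0^\infty(\mathbb R^+;\mathcal D(\mathbb S))$ are smooth, 1-periodic in $x$, and compactly supported in $t\in[0,\infty)$. Also $$f(t)=\frac{1}{1-h}\int_{\mathbb S}(1-u_x^2)\,\partial_x^{-1}(u-uu_x^2)(y)\,dy.$$ A function $u\in L^\infty(\mathbb R^+;H^1(\mathbb S))$ is a global admissible conservative weak solution if all of the following hold. (i) For all test functions $\psi$, $$\int_{\mathbb R^+}\!\int_{\mathbb S}(u\psi_{tx}+u^2u_x\psi_x)\,dx\,dt=\int_{\mathbb R^+}\!\int_{\mathbb S}\big(u-uu_x^2-\overline{u-uu_x^2}\big)\psi\,dx\,dt+\int_{\mathbb S}u_{0x}\psi(0,x)\,dx.$$ (ii) For all test functions $\psi$, $$\int_{\mathbb R^+}\!\int_{\mathbb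 S}(u\psi_t-\tfrac13u^3\psi_x)\,dx\,dt=-\int_{\mathbb R^+}\!\int_{\mathbb S}\big(\partial_x^{-1}(u-uu_x^2)-f(t)\big)\psi\,dx\,dt-\int_{\mathbb S}u_0\psi(0,x)\,dx.$$ (iii) $\int_{\mathbb S}u_x^2\,dx$ and $\int_{\mathbb S}(u-uu_x^2)\,dx$ are constant in time. (iv) For all test functions $\psi$, $$\int_{\mathbb R^+}\!\int_{\mathbb S}(u_x^2\psi_t-u^2u_x^2\psi_x)\,dz\,dt=-\int_{\mathbb R^+}\!\int_{\mathbb S}\big((u^2)_x-2u_x\overline{u-uu_x^2}\big)\psi\,dz\,dt-\int_{\mathbb S}u_{0x}^2\psi(0,z)\,dz.$$ *)

(* Defs.v *)
From HB Require Import structures.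
From mathcomp Require Import all_boot all_order all_algebra.
From mathcomp Require Import all_classical all_reals all_analysis.
Set Implicit Arguments. Unset Strict Implicit. Unset Printing Implicit Defensive.
Import Order.TTheory GRing.Theory Num.Theory.
Import numFieldNormedType.Exports.
Local Open Scope classical_set_scope.
Local Open Scope ring_scope.

Section Defs.
Variable R : realType.
Local Notation mu := (@lebesgue_measure R).

(** Integral over the circle S = R/Z, realized as the integral over [0,1]
    of a 1-periodic function. *)
Definition integS (g : R -> R) : R := \int[mu]_(x in `[0%R, 1%R]) g x.

Definition meanS (g : R -> R) : R := integS g.

Definition PS (g : R -> R) : R -> R := fun x => g x - meanS g.

(** partial_x^{-1} w (x) = int_0^x P w(y) dy  (used for x in [0,1]) *)
Definition dinv (g : R -> R) (x : R) : R := \int[mu]_(y in `[0%R, x]) PS g y.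

Definition integRS (g : R -> R -> R) : R :=
  \int[mu]_(t in `[0%R, +oo[) integS (g t).

Definition dt (psi : R -> R -> R) : R -> R -> R :=
  fun t x => derive1 (fun s => psi s x) t.
Definition dx (psi : R -> R -> R) : R -> R -> R :=
  fun t x => derive1 (fun y => psi t y) x.

Fixpoint pdiff (w : seq bool) (psi : R -> R -> R) : R -> R -> R :=
  match w with
  | [::] => psi
  | b :: w' => (if b then dt else dx) (pdiff w' psi)
  end.

Definition smooth2 (psi : R -> R -> R) : Prop :=
  forall w : seq bool,
    (forall t x, derivable (fun s => pdiff w psi s x) t 1 /\
                 derivable (fun y => pdiff w psi t y) x 1) /\
    continuous (fun p : R * R => pdiff w psi p.1 p.2).

Definition test_fun (psi : R -> R -> R) : Prop :=
  [/\ smooth2 psi,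
      (forall t x, psi t (x + 1) = psi t x) &
      exists T : R, forall t x, T <= t -> psi t x = 0].

Definition test_funS (phi : R -> R) : Prop :=
  (forall n x, derivable (derive1n n phi) x 1) /\
  (forall x, phi (x + 1) = phi x).

Definition H1S (g gx : R -> R) : Prop :=
  [/\ (forall x, g (x + 1) = g x) /\ (forall x, gx (x + 1) = gx x),
      measurable_fun setT g, measurable_fun setT gx,
      (\int[mu]_(x in `[0%R, 1%R]) ((g x) ^+ 2 + (gx x) ^+ 2)%:E < +oo)%E &
      forall phi, test_funS phi ->
        integS (fun x => g x * derive1 phi x) = - integS (fun x => gx x * phi x)].

Definition LinfH1 (u ux : R -> R -> R) : Prop :=
  [/\ measurable_fun setT (fun p : R * R => u p.1 p.2),
      measurable_fun setT (fun p : R * R => ux p.1 p.2),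
      (forall t x, u t (x + 1) = u t x) /\ (forall t x, ux t (x + 1) = ux t x),
      (exists M : R, {ae mu, forall t, 0 <= t ->
          (\int[mu]_(x in `[0%R, 1%R]) ((u t x) ^+ 2 + (ux t x) ^+ 2)%:E
             <= M%:E)%E}) &
      {ae mu, forall t, 0 <= t -> forall phi, test_funS phi ->
        integS (fun x => u t x * derive1 phi x) = - integS (fun x => ux t x * phi x)}].

Definition wfun (u ux : R -> R -> R) (t : R) : R -> R :=
  fun x => u t x - u t x * (ux t x) ^+ 2.

Definition fterm (h : R) (u ux : R -> R -> R) (t : R) : R :=
  (1 - h)^-1 * integS (fun y => (1 - (ux t y) ^+ 2) * dinv (wfun u ux t) y).

Definition admissible_sol (u0 u0x : R -> R) (u ux : R -> R -> R) : Prop :=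
  let h := integS (fun x => (u0x x) ^+ 2) in
  [/\ LinfH1 u ux,
    (forall psi, test_fun psi ->
      integRS (fun t x => u t x * dt (dx psi) t x
                        + (u t x) ^+ 2 * ux t x * dx psi t x)
      = integRS (fun t x => (wfun u ux t x - meanS (wfun u ux t)) * psi t x)
        + integS (fun x => u0x x * psi 0 x)),
    (forall psi, test_fun psi ->
      integRS (fun t x => u t x * dt psi t x - 3^-1 * (u t x) ^+ 3 * dx psi t x)
      = - integRS (fun t x => (dinv (wfun u ux t) x - fterm h u ux t) * psi t x)
        - integS (fun x => u0 x * psi 0 x)),
    (exists C1 C2 : R, {ae mu, forall t, 0 <= t ->
        integS (fun x => (ux t x) ^+ 2) = C1 /\ integS (wfun u ux t) = C2}) &
    (* (iv) ; (u^2)_x = 2 u u_x *)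
    (forall psi, test_fun psi ->
      integRS (fun t x => (ux t x) ^+ 2 * dt psi t x
                        - (u t x) ^+ 2 * (ux t x) ^+ 2 * dx psi t x)
      = - integRS (fun t x => (2 * u t x * ux t x
                             - 2 * ux t x * meanS (wfun u ux t)) * psi t x)
        - integS (fun x => (u0x x) ^+ 2 * psi 0 x))].

End Defs.

(* Main.v *)
(** The equation is solved along its characteristics [xi' = - u(t, xi)^2], which are
    labelled by the energy variable [Y(t, x) = x + int_0^x u_x^2 + c(t)]: by (iv),
    with [wb] the mean of [u - u u_x^2], the function [Y] satisfies
    [Y_t = u^2 (1 + u_x^2) - 2 wb u], so the label of a characteristic obeys
    [y' = - 2 wb u(t, X(t, y))], where [X(t, .)] inverts [Y(t, .)]. In the variable [y]
    both [X] and [u(t, X(t, y))] are Lipschitz, so these curves exist by Picard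
    iteration; they are characteristics by a barrier argument, and (ii) makes
    [u(t, xi(t))] absolutely continuous with derivative the source
    [H = dinv (u - u u_x^2) - f(t)].

    For two solutions with the same data, let [m] bound the distance of positions, of
    values of [u] and of labels over one period of labels. The source is an integral
    against [(u - u u_x^2) dx = u (2 dx - dY)], hence after an integration by parts on
    one side the difference of the two sources is at most [C m]; here [h <> 1] enters
    because [f] is determined by [int (1 - u_x^2) H = 0]. Over a time step of length
    at most [1 / (2 C)] this gives [m <= m / 2], so [m = 0].

    The pointwise-in-time information comes from testing with products
    [theta(t) k(x)]: [k] runs over a countable family of smooth periodic kernels that
    approximate indicators of intervals with rational end points, and [theta]
    approximates [(T - t)_+]. Testing (iv) with [k = 1] gives [int u_x^2 = h]. *)

Require Import Defs.
From HB Require Import structures.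
From mathcomp Require Import all_boot all_order all_algebra.
From mathcomp Require Import all_classical all_reals all_analysis.
From mathcomp Require Import measurable_realfun.
From mathcomp Require Import ring lra.
Set Implicit Arguments. Unset Strict Implicit. Unset Printing Implicit Defensive.
Import Order.TTheory GRing.Theory Num.Theory.
Import numFieldNormedType.Exports.
Local Open Scope classical_set_scope.
Local Open Scope ring_scope.

(** * Integrals on bounded intervals *)

Section Integrals.
Context {R : realType}.
Local Notation mu := (@lebesgue_measure R).

(** In [x] the function [u] is only Hölder continuous of exponent [1 / 2], so [xi' = - u^2] alone
    need not determine its solutions. In the label everything is Lipschitz because [dY >= dx] and
    [2 |u_x| <= 1 + u_x^2]. Two obstacles shape the estimates. The equations hold at almost every
    time only, so every increment in time is taken between good times, and local estimates are
    summed over subdivisions with good division points. Moreover [u_x^2] is a mere integrable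
    density without a modulus uniform in time, and it cannot be evaluated on a curve: [u] and [Y]
    are averaged over short windows, the chain rule is applied to the averages along a moving
    window, and the width tends to [0] at the end. For the barriers the density enters only through
    [(u^2 - c) (1 + u_x^2)], whose sign depends on the speed [c] alone. The inequality [m <= m / 2]
    is used in iterated form, starting from a crude finite bound valid for all labels at once. *)

Lemma ae_imp (P Q : R -> Prop) : (forall x, P x -> Q x) ->
  {ae mu, forall x, P x} -> {ae mu, forall x, Q x}.
Proof.
by move=> PQ; apply: filterS => //; exact: (ae_filter_ringOfSetsType mu).
Qed.

Lemma ae_imp2 (P Q S : R -> Prop) : (forall x, P x -> Q x -> S x) ->
  {ae mu, forall x, P x} -> {ae mu, forall x, Q x} -> {ae mu, forall x, S x}.
Proof.
by move=> PQ; apply: filterS2 => //; exact: (ae_filter_ringOfSetsType mu).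
Qed.

Lemma ae_all (P : R -> Prop) : (forall x, P x) -> {ae mu, forall x, P x}.
Proof. by move=> PQ; apply: aeW. Qed.

(** Measurability is required on the whole line, so that products, shifts and parameter integrals
    stay free of restricted domains. *)
Definition ib (a b : R) (f : R -> R) : Prop :=
  measurable_fun setT f /\ mu.-integrable `[a, b] (EFin \o f).

(** Not an oriented integral: the value is [0] when [b <= a]. *)
Definition rint (a b : R) (f : R -> R) : R := \int[mu]_(x in `[a, b]) f x.

Lemma lebesgue_itvcc_lty (a b : R) : (mu `[a, b] < +oo)%E.
Proof. by rewrite lebesgue_measure_itv; case: ifP => // _; rewrite -EFinB ltry. Qed.

Lemma ib_le (a b : R) (f g : R -> R) : measurable_fun setT f -> ib a b g ->
  (forall x, a <= x <= b -> `|f x| <= g x) -> ib a b f.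
Proof.
move=> mf [mg ig] fg; split=> //.
apply: le_integrable ig => //.
  by apply/measurable_EFinP; exact: measurable_funTS.
move=> x /=; rewrite in_itv/= => xab; rewrite lee_fin.
by rewrite (le_trans (fg _ xab))// ler_norm.
Qed.

Lemma ib_ae (a b : R) (f g : R -> R) : measurable_fun setT f -> ib a b g ->
  {ae mu, forall x, a <= x <= b -> f x = g x} -> ib a b f.
Proof.
move=> mf [mg ig] fg; split=> //.
apply/integrableP; split; first by apply/measurable_EFinP; exact: measurable_funTS.
move/integrableP: ig => [mg' ig].
rewrite (_ : (\int[mu]_(x in _) _)%E = (\int[mu]_(x in `[a, b]) `|(EFin \o g) x|)%E)//.
apply: ae_eq_integral => //.
- by apply/measurableT_comp => //; apply/measurable_EFinP; exact: measurable_funTS.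
- by apply/measurableT_comp => //; apply/measurable_EFinP; exact: measurable_funTS.
- near=> x => /=; rewrite in_itv/= => xab; congr (`|_|%:E).
  by move: (xab); near: x; exact: fg.
Unshelve. all: by end_near. Qed.

Lemma ib_cst (a b c : R) : ib a b (fun=> c).
Proof.
split; first exact: measurable_cst.
apply: measurable_bounded_integrable => //; first exact: lebesgue_itvcc_lty.
exact: bounded_cst.
Qed.

(** Truncation at the levels [C] and [- C] gives a function that is bounded everywhere and equals
    [f] almost everywhere on the interval. *)
Lemma ib_bounded (a b C : R) (f : R -> R) : measurable_fun setT f ->
  {ae mu, forall x, a <= x <= b -> `|f x| <= C} -> ib a b f.
Proof.
move=> mf fC.
have h : ib a b (fun x => Num.max (- C) (Num.min C (f x))).
  apply: (@ib_le _ _ _ (fun=> `|C|)); last 2 first.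
  - exact: ib_cst.
  - move=> x _; rewrite ler_norml; apply/andP; split.
      by rewrite le_max (lerN2 `|C|) ler_norm.
    rewrite ge_max -{1}normrN ler_norm /= ge_min.
    by rewrite ler_norm.
  apply: measurable_maxr; first exact: measurable_cst.
  by apply: measurable_minr => //; exact: measurable_cst.
apply: ib_ae h _ => //; move: fC; apply: ae_imp => x /[apply].
rewrite ler_norml => /andP[h1 h2].
by rewrite (min_idPr h2) (max_idPr h1).
Qed.

Lemma ibD (a b : R) (f g : R -> R) : ib a b f -> ib a b g ->
  ib a b (fun x => f x + g x).
Proof.
move=> [mf fi] [mg gi]; split; first exact: measurable_funD.
exact: (integrableD _ fi gi).
Qed.

Lemma ibZ (a b c : R) (f : R -> R) : ib a b f -> ib a b (fun x => c * f x).
Proof.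
move=> [mf fi]; split; first exact: measurable_funM.
exact: (integrableZl _ c fi).
Qed.

Lemma ibN (a b : R) (f : R -> R) : ib a b f -> ib a b (fun x => - f x).
Proof.
move=> /(ibZ (-1)); congr ib.
by apply/funext => x; rewrite mulN1r.
Qed.

Lemma ibB (a b : R) (f g : R -> R) : ib a b f -> ib a b g ->
  ib a b (fun x => f x - g x).
Proof. by move=> fi gi; apply: ibD => //; exact: ibN. Qed.

Lemma ib_norm (a b : R) (f : R -> R) : ib a b f -> ib a b (fun x => `|f x|).
Proof.
move=> [mf fi]; split; first exact: measurableT_comp.
exact: (integrable_norm fi).
Qed.

Lemma ibS (a b c d : R) (f : R -> R) : a <= c -> d <= b ->
  ib a b f -> ib c d f.
Proof.
move=> ac db [mf fi]; split=> //; apply: integrableS fi => //.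
move=> x /=; rewrite !in_itv/= => /andP[cx xd].
by rewrite (le_trans ac cx) (le_trans xd db).
Qed.

Lemma ibM (a b C : R) (f g : R -> R) : ib a b f -> measurable_fun setT g ->
  {ae mu, forall x, a <= x <= b -> `|g x| <= C} -> ib a b (fun x => f x * g x).
Proof.
move=> fi mg gC.
have mf := fi.1.
have h : ib a b (fun x => f x * Num.max (- C) (Num.min C (g x))).
  apply: (@ib_le _ _ _ (fun x => `|C| * `|f x|)); last 2 first.
  - by apply: ibZ; exact: ib_norm.
  - move=> x _; rewrite normrM mulrC ler_wpM2r// ler_norml; apply/andP; split.
      by rewrite le_max (lerN2 `|C|) ler_norm.
    rewrite ge_max -{1}normrN ler_norm /= ge_min.
    by rewrite ler_norm.
  apply: measurable_funM => //.
  apply: measurable_maxr; first exact: measurable_cst.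
  by apply: measurable_minr => //; exact: measurable_cst.
apply: ib_ae h _; first exact: measurable_funM.
move: gC; apply: ae_imp => x /[apply].
rewrite ler_norml => /andP[h1 h2].
by rewrite (min_idPr h2) (max_idPr h1).
Qed.

Lemma ib_cat (a b c : R) (f : R -> R) : a <= b -> b <= c ->
  ib a b f -> ib b c f -> ib a c f.
Proof.
move=> ab bc [mf i1] [_ i2]; split=> //.
have -> : `[a, c]%classic = `[a, b]%classic `|` `]b, c]%classic :> set R.
  by rewrite -itv_bndbnd_setU// bnd_simp.
have mT : measurable_fun setT (abse \o (EFin \o f)).
  by apply: measurableT_comp => //; apply/measurable_EFinP.
apply/integrableP; split.
  by apply/measurable_EFinP; exact: measurable_funTS.
have {}i2 : mu.-integrable `]b, c] (EFin \o f).
  apply: integrableS i2 => // x /=; rewrite !in_itv/= => /andP[/ltW -> ->//].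
move/integrableP: i1 => [_ i1]; move/integrableP: i2 => [_ i2].
rewrite ge0_integral_setU//=; first exact: lte_add_pinfty.
- exact: measurable_funTS.
- apply/disj_setPS => y [/=]; rewrite !in_itv/= => /andP[_ yb] /andP[].
  by rewrite ltNge yb.
Qed.


Lemma rintD (a b : R) (f g : R -> R) : ib a b f -> ib a b g ->
  rint a b (fun x => f x + g x) = rint a b f + rint a b g.
Proof. by move=> [_ fi] [_ gi]; exact: RintegralD. Qed.

Lemma rintB (a b : R) (f g : R -> R) : ib a b f -> ib a b g ->
  rint a b (fun x => f x - g x) = rint a b f - rint a b g.
Proof. by move=> [_ fi] [_ gi]; exact: RintegralB. Qed.

Lemma rintZ (a b c : R) (f : R -> R) : ib a b f ->
  rint a b (fun x => c * f x) = c * rint a b f.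
Proof. by move=> [_ fi]; exact: RintegralZl. Qed.

Lemma rintN (a b : R) (f : R -> R) : ib a b f ->
  rint a b (fun x => - f x) = - rint a b f.
Proof.
move=> fi; rewrite -mulN1r -rintZ//; congr rint.
by apply/funext => x; rewrite mulN1r.
Qed.

Lemma rint_cst (a b c : R) : a <= b -> rint a b (fun=> c) = c * (b - a).
Proof.
move=> ab; rewrite /rint Rintegral_cst//= lebesgue_measure_itv /= lte_fin.
by move: ab; rewrite le_eqVlt => /predU1P[->|->//]; rewrite ltxx subrr.
Qed.

Lemma eq_rint (a b : R) (f g : R -> R) :
  (forall x, a <= x <= b -> f x = g x) -> rint a b f = rint a b g.
Proof.
move=> fg; apply: eq_Rintegral => x; rewrite inE/= in_itv/=; exact: fg.
Qed.

Lemma eq_rint_ae (a b : R) (f g : R -> R) : measurable_fun setT f ->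
  measurable_fun setT g -> {ae mu, forall x, a <= x <= b -> f x = g x} ->
  rint a b f = rint a b g.
Proof.
move=> mf mg fg; congr fine; apply: ae_eq_integral => //.
- by apply/measurable_EFinP; exact: measurable_funTS.
- by apply/measurable_EFinP; exact: measurable_funTS.
- by move: fg; apply: ae_imp => x; rewrite /= in_itv/= => /[apply] ->.
Qed.

Lemma le_rint_ae (a b : R) (f g : R -> R) : ib a b f -> ib a b g ->
  {ae mu, forall x, a <= x <= b -> f x <= g x} -> rint a b f <= rint a b g.
Proof.
move=> fi gi fg.
have [mf _] := fi; have [mg _] := gi.
(* The minimum lies below [g] everywhere and equals [f] almost everywhere. *)
pose f' x := Num.min (f x) (g x).
have mf' : measurable_fun setT f' by exact: measurable_minr.
have ff' : {ae mu, forall x, a <= x <= b -> f' x = f x}.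
  by move: fg; apply: ae_imp => x /[apply] xab; exact: min_idPl.
have f'i : ib a b f' by exact: ib_ae ff'.
rewrite (@eq_rint_ae a b f f')//; last first.
  by move: ff'; apply: ae_imp => x /[apply] ->.
by apply: le_Rintegral => //; [case: f'i|case: gi|move=> x _; rewrite ge_min lexx orbT].
Qed.

Lemma le_rint (a b : R) (f g : R -> R) : ib a b f -> ib a b g ->
  (forall x, a <= x <= b -> f x <= g x) -> rint a b f <= rint a b g.
Proof. by move=> fi gi fg; apply: le_rint_ae => //; exact: ae_all. Qed.

Lemma rint_ge0 (a b : R) (f : R -> R) :
  (forall x, a <= x <= b -> 0 <= f x) -> 0 <= rint a b f.
Proof.
by move=> f0; apply: Rintegral_ge0 => x /=; rewrite in_itv/=; exact: f0.
Qed.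

Lemma rint_norm (a b : R) (f : R -> R) : ib a b f ->
  `|rint a b f| <= rint a b (fun x => `|f x|).
Proof. by move=> [_ fi]; exact: le_normr_Rintegral. Qed.

Lemma rint_norm_le_ae (a b : R) (f g : R -> R) :
  ib a b f -> ib a b g ->
  {ae mu, forall x, a <= x <= b -> `|f x| <= g x} ->
  `|rint a b f| <= rint a b g.
Proof.
move=> fi gi fg; apply: (le_trans (rint_norm fi)).
by apply: le_rint_ae => //; exact: ib_norm.
Qed.

Lemma rint_norm_le (a b : R) (f g : R -> R) :
  measurable_fun setT f -> ib a b g ->
  (forall x, a <= x <= b -> `|f x| <= g x) ->
  `|rint a b f| <= rint a b g.
Proof.
move=> mf gi fg; apply: rint_norm_le_ae => //; first exact: ib_le fg.
exact: ae_all.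
Qed.

Lemma rint_bound_ae (a b C : R) (f : R -> R) : a <= b ->
  measurable_fun setT f -> {ae mu, forall x, a <= x <= b -> `|f x| <= C} ->
  `|rint a b f| <= C * (b - a).
Proof.
move=> ab mf fC; rewrite -rint_cst//; apply: rint_norm_le_ae => //.
  exact: ib_bounded fC.
exact: ib_cst.
Qed.

Lemma rint_bound (a b C : R) (f : R -> R) : a <= b ->
  measurable_fun setT f -> (forall x, a <= x <= b -> `|f x| <= C) ->
  `|rint a b f| <= C * (b - a).
Proof. by move=> ab mf fC; apply: rint_bound_ae => //; exact: ae_all. Qed.

Lemma rint_cat (a b c : R) (f : R -> R) : a <= b -> b <= c -> ib a c f ->
  rint a c f = rint a b f + rint b c f.
Proof.
move=> ab bc [mf fi].
have := @Rintegral_itvB _ f (BLeft a) (BRight c) b fi.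
rewrite !bnd_simp => /(_ ab bc) h.
apply/eqP; rewrite addrC -subr_eq; apply/eqP; rewrite h.
rewrite Rintegral_itv_obnd_cbnd//.
apply: integrableS fi => // x /=; rewrite !in_itv/= => /andP[/ltW + ->].
by move=> /(le_trans ab) ->.
Qed.

Lemma rint_pt (a b : R) (f : R -> R) : b <= a -> rint a b f = 0.
Proof.
rewrite le_eqVlt => /predU1P[->|ba].
  by rewrite /rint set_itv1 Rintegral_set1.
by rewrite /rint set_itv_ge ?Rintegral_set0// bnd_simp -ltNge.
Qed.

Lemma rint_dct (a b : R) (f : nat -> R -> R) (g h : R -> R) :
  (forall n, measurable_fun setT (f n)) -> measurable_fun setT g -> ib a b h ->
  {ae mu, forall x, a <= x <= b -> f ^~ x @ \oo --> g x} ->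
  {ae mu, forall x, a <= x <= b -> forall n, `|f n x| <= h x} ->
  (fun n => rint a b (f n)) @ \oo --> rint a b g.
Proof.
move=> mf mg [mh hi] fg fh.
have [] := @dominated_convergence _ _ _ mu `[a, b] _ (fun n => EFin \o f n)
  (EFin \o g) (EFin \o h).
- exact: measurable_itv.
- by move=> n; apply/measurable_EFinP; exact: measurable_funTS (mf n).
- by apply/measurable_EFinP; exact: measurable_funTS.
- move: fg; apply: ae_imp => x /= fg; rewrite in_itv/= => xab.
  have fgx := fg xab; apply/cvg_EFin; first exact: nearW.
  exact: fgx.
- exact: hi.
- by move: fh; apply: ae_imp => x /= + n; rewrite in_itv/= => /[apply]; rewrite lee_fin.
move=> gi _ h1; apply: (@fine_cvg _ _ _ _ _ (rint a b g)).
rewrite /rint /Rintegral fineK//.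
exact: integrable_fin_num.
Qed.

End Integrals.

(** * Summation of local estimates, Cauchy-Schwarz, Fubini *)

Section Slices.
Context {R : realType}.
Local Notation mu := (@lebesgue_measure R).

(** Increments of [Lam] add up over a subdivision and those of [Psi] obey the triangle inequality;
    density of [D] supplies division points in [D]. In the applications [D] is the set of times at
    which the evolution equations hold. *)
Lemma local_to_global (D : R -> Prop) (a b eta : R) (Psi Lam : R -> R) :
  0 < eta -> (forall s t, a <= s -> s < t -> t <= b -> exists2 r, D r & s < r < t) ->
  (forall s t, D s -> D t -> a <= s -> s < t -> t <= b -> t - s < eta ->
     `|Psi t - Psi s| <= Lam t - Lam s) ->
  forall s t, D s -> D t -> a <= s -> s <= t -> t <= b ->
     `|Psi t - Psi s| <= Lam t - Lam s.
Proof.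
move=> eta0 dD loc s t Ds Dt as_ st tb.
suff H : forall (n : nat) t', D t' -> s <= t' -> t' <= b ->
    t' - s <= n%:R * (eta / 2) -> `|Psi t' - Psi s| <= Lam t' - Lam s.
  have [n hn] : exists n : nat, (t - s) / (eta / 2) <= n%:R.
    exists (Num.truncn ((t - s) / (eta / 2))).+1.
    by apply/ltW; rewrite truncnS_gt.
  by apply: (H n) => //; rewrite -ler_pdivrMr// divr_gt0.
elim=> [|n IH] t' Dt' st' t'b h.
  have -> : t' = s by apply/eqP; rewrite eq_le st' andbT; lra.
  by rewrite !subrr normr0.
have [lt_|ge_] := ltP (t' - s) eta.
  move: st'; rewrite le_eqVlt => /predU1P[<-|st'].
    by rewrite !subrr normr0.
  exact: loc.
(* At distance between [eta / 2] and [eta] from [t']: close enough for the local estimate, far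
   enough to use up one of the [n] half steps. *)
have [r Dr /andP[r1 r2]] : exists2 r, D r & t' - eta < r < t' - eta / 2.
  by apply: dD; lra.
have h1 : `|Psi r - Psi s| <= Lam r - Lam s.
  apply: IH => //; [lra|lra|].
  by move: h; rewrite -natr1 mulrDl mul1r; lra.
have h2 : `|Psi t' - Psi r| <= Lam t' - Lam r.
  by apply: loc => //; lra.
have := ler_normD (Psi t' - Psi r) (Psi r - Psi s).
by rewrite addrA subrK; lra.
Qed.

Lemma rint_cauchy_schwarz (a b : R) (f : R -> R) : a <= b -> ib a b f ->
  ib a b (fun x => f x ^+ 2) ->
  (rint a b (fun x => `|f x|)) ^+ 2 <= (b - a) * rint a b (fun x => f x ^+ 2).
Proof.
rewrite le_eqVlt => /predU1P[<-|ab] fi f2i.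
  by rewrite !rint_pt// expr0n/= mulr0.
set B := rint a b (fun x => `|f x|); set E := rint a b _.
(* The mean of [|f|]; the inequality is the nonnegativity of the integral of [(c - |f|)^2]. *)
pose c := B / (b - a).
have h : 0 <= rint a b (fun x => (c ^+ 2 - 2 * c * `|f x|) + f x ^+ 2).
  apply: rint_ge0 => x _.
  rewrite -[f x ^+ 2]ger0_norm ?sqr_ge0// normrX.
  have -> : c ^+ 2 - 2 * c * `|f x| + `|f x| ^+ 2 = (c - `|f x|) ^+ 2 by ring.
  exact: sqr_ge0.
have nfi := ib_norm fi.
rewrite rintD// in h; last first.
  by apply: ibB; [exact: ib_cst|exact: ibZ].
rewrite rintB// ?rint_cst ?(ltW ab)// ?rintZ// in h; last 2 first.
- exact: ib_cst.
- exact: ibZ.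
rewrite -/B -/E in h.
have ba : 0 < b - a by rewrite subr_gt0.
have cE : c * (b - a) = B by rewrite /c divfK// gt_eqF.
have : 0 <= (b - a) * (c ^+ 2 * (b - a) - 2 * c * B + E) by rewrite mulr_ge0// ltW.
rewrite -cE; have -> : (b - a) * (c ^+ 2 * (b - a) - 2 * c * (c * (b - a)) + E) =
  (b - a) * E - (c * (b - a)) ^+ 2 by ring.
by rewrite subr_ge0.
Qed.

Lemma mfun_sec1 (f : R -> R -> R) (t : R) :
  measurable_fun setT (fun p : R * R => f p.1 p.2) -> measurable_fun setT (f t).
Proof.
move=> mf; have := measurableT_comp mf (@measurable_pair1 _ _ R R t).
by [].
Qed.

Lemma mfun_sec2 (f : R -> R -> R) (x : R) :
  measurable_fun setT (fun p : R * R => f p.1 p.2) -> measurable_fun setT (f^~ x).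
Proof.
move=> mf; have := measurableT_comp mf (@measurable_pair2 _ _ R R x).
by [].
Qed.

Lemma mfun_comp2 d (T : measurableType d) (f : R -> R -> R) (g h : T -> R) :
  measurable_fun setT (fun p : R * R => f p.1 p.2) ->
  measurable_fun setT g -> measurable_fun setT h ->
  measurable_fun setT (fun z => f (g z) (h z)).
Proof.
move=> mf mg mh.
exact: (measurableT_comp mf (measurable_fun_pair mg mh)).
Qed.

(** Extended by [0] outside the moving interval, the integrand is jointly measurable, and Tonelli
    applies to its positive and negative parts separately. *)
Lemma measurable_rint_param d (T : measurableType d) (f : T -> R -> R) (g h : T -> R) :
  measurable_fun setT (fun p : T * R => f p.1 p.2) ->
  measurable_fun setT g -> measurable_fun setT h ->
  measurable_fun setT (fun z => rint (g z) (h z) (f z)).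
Proof.
move=> mf mg mh; rewrite /rint /Rintegral.
apply: measurableT_comp => //.
pose F (p : T * R) : \bar R := if (g p.1 <= p.2) && (p.2 <= h p.1) then (f p.1 p.2)%:E else 0%E.
have mF : measurable_fun setT F.
  apply: measurable_fun_ifT.
  - apply: measurable_and.
      by apply: measurable_fun_ler => //; exact: measurableT_comp.
    by apply: measurable_fun_ler => //; exact: measurableT_comp.
  - exact/measurable_EFinP.
  - exact: measurable_cst.
rewrite (_ : (fun z => _) = (fun z => \int[mu]_y F^\+ (z, y) - \int[mu]_y F^\- (z, y))%E); last first.
  apply/funext => z; rewrite integral_mkcond.
  transitivity (\int[mu]_x F (z, x))%E.
    apply: eq_integral => y _; rewrite /F patchE /=.
    rewrite (_ : (y \in _) = (g z <= y <= h z))//.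
    by apply/idP/idP; rewrite inE/= in_itv.
  by rewrite integralE; congr (_ - _)%E; apply: eq_integral => y _;
    rewrite ?funeposE ?funenegE.
apply: emeasurable_funB.
  have h1 : measurable_fun setT (F^\+)%E by exact: measurable_funepos.
  exact: (@measurable_fun_fubini_tonelli_F _ _ T (measurableTypeR R) R mu (F^\+)%E h1).
have h1 : measurable_fun setT (F^\-)%E by exact: measurable_funeneg.
exact: (@measurable_fun_fubini_tonelli_F _ _ T (measurableTypeR R) R mu (F^\-)%E h1).
Qed.

Let box (a b c d : R) (f : R -> R -> R) (p : measurableTypeR R * measurableTypeR R) : \bar R :=
  if (a <= p.1 <= b) && (c <= p.2 <= d) then (f p.1 p.2)%:E else 0%E.

Let boxE1 (a b c d : R) (f : R -> R -> R) (t : R) :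
  (\int[mu]_x box a b c d f (t, x) =
   if (a <= t <= b)%R then \int[mu]_(x in `[c, d]) (f t x)%:E else 0)%E.
Proof.
rewrite /box /=; case: ifP => tab /=; last by rewrite integral0.
rewrite [RHS]integral_mkcond; apply: eq_integral => x _; rewrite patchE.
rewrite (_ : (x \in _) = (c <= x <= d))//.
by apply/idP/idP; rewrite inE/= in_itv.
Qed.

Let boxE2 (a b c d : R) (f : R -> R -> R) (x : R) :
  (\int[mu]_t box a b c d f (t, x) =
   if (c <= x <= d)%R then \int[mu]_(t in `[a, b]) (f t x)%:E else 0)%E.
Proof.
rewrite /box /=; case: ifP => xcd /=; last first.
  by under eq_integral do rewrite andbF; rewrite integral0.
rewrite [RHS]integral_mkcond; apply: eq_integral => t _; rewrite patchE andbT.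
rewrite (_ : (t \in _) = (a <= t <= b))//.
by apply/idP/idP; rewrite inE/= in_itv.
Qed.

(** The bound [C] on almost all slice norms makes the extension of [f] by [0] outside the box
    integrable on the plane, by Tonelli. The slices in the other variable are then integrable almost
    everywhere only. *)
Lemma rint_fubini (a b c d C : R) (f : R -> R -> R) :
  measurable_fun setT (fun p : R * R => f p.1 p.2) ->
  {ae mu, forall t, a <= t <= b ->
     ib c d (f t) /\ rint c d (fun x => `|f t x|) <= C} ->
  [/\ rint a b (fun t => rint c d (f t)) = rint c d (fun x => rint a b (f^~ x)),
      {ae mu, forall x, c <= x <= d -> ib a b (f^~ x)} &
      ib c d (fun x => rint a b (f^~ x))].
Proof.
move=> mf fC.
pose F := box a b c d f.
have mbox (g : R -> R -> R) : measurable_fun setT (fun p : R * R => g p.1 p.2) ->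
    measurable_fun setT (box a b c d g).
  move=> mg; apply: measurable_fun_ifT.
  - apply: measurable_and; apply: measurable_and; apply: measurable_fun_ler => //.
  - exact/measurable_EFinP.
  - exact: measurable_cst.
have mF : measurable_fun setT F by exact: mbox.
have mnf : measurable_fun setT (fun p : R * R => `|f p.1 p.2|) by exact: measurableT_comp.
pose nf t x := `|f t x|.
have box_ge0 p : (0 <= box a b c d nf p)%E.
  by rewrite /box; case: ifP => // _; rewrite lee_fin normr_ge0.
have inf : (mu \x mu)%E.-integrable setT F.
  apply/(integrable12ltyP mu mu mF).
  rewrite (_ : (\int[mu]_x _)%E = (\int[mu]_x \int[mu]_y box a b c d nf (x, y))%E); last first.
    apply: eq_integral => t _; apply: eq_integral => x _; rewrite /F /box /=.
    by case: ifP => //; rewrite abse0.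
  apply: (@le_lt_trans _ _ (\int[mu]_(t in `[a, b]) (`|C|%:E))%E); last first.
    rewrite integral_cst//=.
    apply: lte_mul_pinfty => //.
    exact: lebesgue_itvcc_lty.
  rewrite [X in (_ <= X)%E]integral_mkcond.
  apply: ae_ge0_le_integral => //.
  - by move=> t _; exact: integral_ge0.
  - exact: (@measurable_fun_fubini_tonelli_F _ _ (measurableTypeR R) (measurableTypeR R) R mu _ (mbox nf mnf) box_ge0).
  - by move=> t _; rewrite patchE; case: ifP.
  - by apply/measurable_restrict.
  - move: fC; apply: ae_imp => t /= ft _.
    rewrite boxE1 patchE (_ : (t \in _) = (a <= t <= b)); last first.
      by apply/idP/idP; rewrite inE/= in_itv.
    case: ifP => // /ft[fi fle].
    have [_ nfi] := ib_norm fi.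
    rewrite -(fineK (integrable_fin_num _ nfi))// lee_fin.
    exact: le_trans (ler_norm C).
have ae2 : {ae mu, forall x, c <= x <= d -> ib a b (f^~ x)}.
  have := ae_integrable2 inf; apply: ae_imp => x iF xcd.
  split; first exact: mfun_sec2.
  have : mu.-integrable `[a, b] (fun t => F (t, x)) by apply: integrableS iF.
  apply: eq_integrable => //= t; rewrite inE/= in_itv/= => tab.
  by rewrite /F /box /= tab xcd.
have mrd : measurable_fun setT (fun x => rint a b (f^~ x)).
  apply: (@measurable_rint_param _ _ (fun x t => f t x) (fun=> a) (fun=> b)) => //.
  exact: (measurableT_comp mf (@measurable_swap _ _ _ _)).
have mrt : measurable_fun setT (fun t => rint c d (f t)).
  exact: (@measurable_rint_param _ _ f (fun=> c) (fun=> d)).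
have E1 : (\int[mu]_t \int[mu]_x F (t, x))%E =
    (\int[mu]_(t in `[a, b]) (rint c d (f t))%:E)%E.
  rewrite [RHS]integral_mkcond.
  apply: ae_eq_integral => //.
  - exact: (measurable_fubini_F inf).
  - by apply/measurable_restrict => //; apply: measurable_funTS; exact/measurable_EFinP.
  - move: fC; apply: ae_imp => t /= ft _.
    rewrite boxE1 patchE (_ : (t \in _) = (a <= t <= b)); last first.
      by apply/idP/idP; rewrite inE/= in_itv.
    case: ifP => // /ft[[_ fi] _].
    by rewrite /rint /Rintegral fineK//; exact: integrable_fin_num.
have ae3 : ae_eq mu setT (fun x => \int[mu]_t F (t, x))%E
     ((fun x => (rint a b (f^~ x))%:E) \_ `[c, d]).
  move: ae2; apply: ae_imp => x /= fx _.
  rewrite boxE2 patchE (_ : (x \in _) = (c <= x <= d)); last first.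
    by apply/idP/idP; rewrite inE/= in_itv.
  case: ifP => // /fx[_ fi].
  by rewrite /rint /Rintegral fineK//; exact: integrable_fin_num.
have mr3 : measurable_fun setT ((fun x => (rint a b (f^~ x))%:E) \_ `[c, d]).
  by apply/measurable_restrict => //; apply: measurable_funTS; exact/measurable_EFinP.
have E2 : (\int[mu]_x \int[mu]_t F (t, x))%E =
    (\int[mu]_(x in `[c, d]) (rint a b (f^~ x))%:E)%E.
  rewrite [RHS]integral_mkcond.
  apply: ae_eq_integral => //.
  exact: (measurable_fubini_G inf).
split; [|exact: ae2|].
- by rewrite /rint /Rintegral; congr fine; rewrite -E1 -E2; exact: Fubini.
- split=> //.
  apply/(integrable_mkcond _ _).2 => //=.
  apply/integrableP; split=> //.
  have h : (\int[mu]_y `|\int[mu]_x F (x, y)| < +oo)%E.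
    apply: le_lt_trans ((integrable21ltyP mu mu mF).1 inf).
    apply: ge0_le_integral => //.
    - by apply: measurableT_comp => //; exact: (measurable_fubini_G inf).
    - apply: (@measurable_fun_fubini_tonelli_G _ _ (measurableTypeR R) (measurableTypeR R)
        R mu (fun p => `|F p|%E)) => //.
      exact: measurableT_comp.
    - move=> y _; apply: le_abse_integral => //.
      exact: (measurableT_comp mF (@measurable_pair2 _ _ _ _ y)).
  rewrite (_ : (\int[mu]_x _)%E = (\int[mu]_y `|\int[mu]_x F (x, y)|)%E)//.
  apply: ae_eq_integral => //.
  + exact: measurableT_comp.
  + by apply: measurableT_comp => //; exact: (measurable_fubini_G inf).
  + by move: ae3; apply: ae_imp => x /(_ I) ->.
Qed.

End Slices.

(** * Translations, periodic functions, primitives *)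

Section Shift.
Context {R : realType}.
Local Notation mu := (@lebesgue_measure R).

Definition shiftm (c : R) : measurableTypeR R -> measurableTypeR R := fun x => x + c.

Lemma measurable_shiftm c : measurable_fun setT (shiftm c).
Proof. exact: measurable_funD. Qed.

Lemma lebesgue_shift (c : R) (A : set (measurableTypeR R)) : measurable A ->
  mu A = mu (shiftm c @^-1` A).
Proof.
move=> mA; have mc := measurable_shiftm c.
apply: (@lebesgue_measure_unique R (pushforward mu (shiftm c))) => // X.
move=> -[[a b] _ <-]; rewrite /pushforward /=.
transitivity (mu `]a - c, b - c]); last first.
  congr (lebesgue_measure _).
  by apply/seteqP; split=> x /=; rewrite /shiftm !in_itv/= ltrBlDr lerBrDr.
rewrite !lebesgue_measure_itv/= !lte_fin.
rewrite (_ : (a - c < b - c) = (a < b)); last by rewrite ltrD2r.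
by case: ifP => //; rewrite -!EFinB => _; congr EFin; ring.
Qed.

Lemma measurable_shift (c : R) (f : R -> R) : measurable_fun setT f ->
  measurable_fun setT (fun x : R => f (x + c)).
Proof. by move=> mf; exact: (measurableT_comp mf (measurable_shiftm c)). Qed.

Let preitv (a b c : R) : (shiftm c @^-1` `[a + c, b + c]) = `[a, b]%classic.
Proof. by apply/seteqP; split=> x /=; rewrite /shiftm !in_itv/= !lerD2r. Qed.

Lemma ib_shift (a b c : R) (f : R -> R) : ib (a + c) (b + c) f ->
  ib a b (fun x => f (x + c)).
Proof.
move=> [mf fi]; have mfc := measurable_shift c mf; split=> //.
have mc := measurable_shiftm c.
move/integrableP: fi => [_ fi]; apply/integrableP; split.
  by apply/measurable_EFinP; exact: measurable_funTS.
apply: le_lt_trans fi.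
rewrite [leRHS](eq_measure_integral (pushforward mu (shiftm c))); last first.
  by move=> A mA _; exact: lebesgue_shift.
rewrite ge0_integral_pushforward//.
- by rewrite preitv.
- by apply: measurableT_comp => //; apply/measurable_EFinP; exact: measurable_funTS.
Qed.

Lemma ib_shiftV (a b c : R) (f : R -> R) : measurable_fun setT f ->
  ib a b (fun x => f (x + c)) -> ib (a + c) (b + c) f.
Proof.
move=> mf; have {1}-> : a = (a + c) + - c by ring.
have {1}-> : b = (b + c) + - c by ring.
move=> /ib_shift; congr ib; apply/funext => x; congr f; ring.
Qed.

Lemma rint_shift (a b c : R) (f : R -> R) : ib (a + c) (b + c) f ->
  rint (a + c) (b + c) f = rint a b (fun x => f (x + c)).
Proof.
move=> fi; have [mf' fi'] := ib_shift fi; have [mf _] := fi.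
have mc := measurable_shiftm c.
rewrite /rint /Rintegral; congr fine.
rewrite [LHS](eq_measure_integral (pushforward mu (shiftm c))); last first.
  by move=> A mA _; exact: lebesgue_shift.
rewrite (integral_pushforward mc).
- by rewrite preitv.
- exact/measurable_EFinP.
- by rewrite preitv.
- exact: measurable_itv.
Qed.

Lemma ae_shift (c : R) (P : R -> Prop) :
  {ae mu, forall x, P x} -> {ae mu, forall x, P (x + c)}.
Proof.
move=> [A [mA A0 PA]]; exists (shiftm c @^-1` A); split.
- have := measurable_shiftm c measurableT mA; rewrite setTI; exact.
- by rewrite -lebesgue_shift.
- by move=> x /= nP; apply: PA => /= Px; apply: nP.
Qed.

Definition loci (f : R -> R) := forall a b, ib a b f.

Lemma periodic_int (f : R -> R) : (forall x, f (x + 1) = f x) ->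
  forall (n : nat) x, f (x + n%:R) = f x /\ f (x - n%:R) = f x.
Proof.
move=> f1; elim=> [|n IH] x; first by rewrite subr0 addr0.
have [h1 h2] := IH x; split.
  by rewrite -natr1 addrA f1.
by rewrite -natr1 opprD addrA -(f1 (_ - 1)) subrK.
Qed.

Lemma loci_periodic (f : R -> R) : (forall x, f (x + 1) = f x) ->
  ib 0 1 f -> loci f.
Proof.
move=> f1 fi; have [mf _] := fi.
have h1 (n : nat) : ib n%:R (n%:R + 1) f.
  rewrite addrC -{1}[n%:R]add0r; apply: ib_shiftV => //.
  suff -> : (fun x => f (x + n%:R)) = f by [].
  by apply/funext => x; have [] := periodic_int f1 n x.
have h2 (n : nat) : ib (- n%:R) (1 - n%:R) f.
  rewrite -{1}[- n%:R]add0r; apply: ib_shiftV => //.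
  suff -> : (fun x => f (x - n%:R)) = f by [].
  by apply/funext => x; have [] := periodic_int f1 n x.
have h (n : nat) : ib (- n%:R) n%:R f.
  elim: n => [|n IH]; first by apply: ibS fi; rewrite ?oppr0.
  have n0 : 0 <= n%:R :> R by [].
  rewrite -natr1; apply: (@ib_cat _ _ n%:R); [lra|lra| |exact: h1].
  apply: (@ib_cat _ _ (- n%:R)); [lra|lra| |exact: IH].
  by have := h2 n.+1; rewrite -natr1 opprD addrCA addrN addr0.
move=> a b.
pose n := (Num.truncn (Num.max `|a| `|b|)).+1.
have : Num.max `|a| `|b| < n%:R by rewrite truncnS_gt.
rewrite gt_max => /andP[an bn].
apply: ibS (h n).
  by move/ltW : an; rewrite ler_norml => /andP[].
by move/ltW : bn; rewrite ler_norml => /andP[].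
Qed.

Lemma rint_periodic (f : R -> R) (x : R) : (forall x, f (x + 1) = f x) ->
  ib 0 1 f -> rint x (x + 1) f = rint 0 1 f.
Proof.
move=> f1 fi; have lf := loci_periodic f1 fi.
have step y : rint (y + 1) (y + 1 + 1) f = rint y (y + 1) f.
  by rewrite rint_shift; [apply: eq_rint|exact: lf].
have base y : 0 <= y <= 1 -> rint y (y + 1) f = rint 0 1 f.
  move=> /andP[y0 y1].
  rewrite (@rint_cat _ y 1); [|lra|lra|exact: lf].
  rewrite [in RHS](@rint_cat _ 0 y); [|lra|lra|exact: lf].
  rewrite addrC; congr (_ + _).
  rewrite -{1}[1]add0r rint_shift; last exact: lf.
  exact: eq_rint.
suff H (n : nat) y : - n.+1%:R <= y <= n.+1%:R -> rint y (y + 1) f = rint 0 1 f.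
  apply: (H (Num.truncn `|x|)); rewrite -ler_norml; apply: ltW.
  by rewrite truncnS_gt.
elim: n y => [|n IH] y /andP[y1 y2].
  case: (leP 0 y) => y0; first by apply: base; rewrite y0.
  by rewrite -step base//; apply/andP; split; lra.
rewrite -natr1 in y1 y2.
have n0 : 1 <= n.+1%:R :> R by rewrite ler1n.
case: (leP 0 y) => y0.
  have {1 2}-> : y = (y - 1) + 1 by ring.
  by rewrite step; apply: IH; lra.
by rewrite -step; apply: IH; lra.
Qed.

(** The oriented integral from [0] to [x]: at least one of the two terms vanishes, according to the
    sign of [x]. *)
Definition prim (f : R -> R) (x : R) : R := rint 0 x f - rint x 0 f.

Lemma prim0 (f : R -> R) : prim f 0 = 0.
Proof. by rewrite /prim subrr. Qed.

Lemma prim_ge0E (f : R -> R) (x : R) : 0 <= x -> prim f x = rint 0 x f.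
Proof. by move=> x0; rewrite /prim [X in _ - X]rint_pt// subr0. Qed.

Lemma primB (f : R -> R) (a b : R) : loci f -> a <= b ->
  prim f b - prim f a = rint a b f.
Proof.
move=> lf ab; rewrite /prim.
case: (leP 0 a) => a0.
  rewrite !(@rint_pt _ _ 0) ?(le_trans a0)//.
  by rewrite (rint_cat a0 ab (lf _ _)); ring.
rewrite (@rint_pt _ 0 a) ?(ltW a0)//.
case: (leP 0 b) => b0.
  by rewrite (@rint_pt _ b 0)// (rint_cat (ltW a0) b0 (lf _ _)); ring.
rewrite (@rint_pt _ 0 b) ?(ltW b0)//.
by rewrite (rint_cat ab (ltW b0) (lf _ _)); ring.
Qed.

Lemma measurable_prim d (T : measurableType d) (f : T -> R -> R) (g : T -> R) :
  measurable_fun setT (fun p : T * R => f p.1 p.2) ->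
  measurable_fun setT g ->
  measurable_fun setT (fun z => prim (f z) (g z)).
Proof.
move=> mf mg; apply: measurable_funB.
  exact: (@measurable_rint_param _ _ _ _ (fun=> 0)).
exact: (@measurable_rint_param _ _ _ _ _ (fun=> 0)).
Qed.

End Shift.

(** * Absolute continuity *)

Section AbsCont.
Context {R : realType}.
Local Notation mu := (@lebesgue_measure R).

(** The part of [|f|] above a high level [N] has small integral by dominated convergence; the part
    below contributes at most [N * (b - a)]. *)
Lemma ib_modulus (A B : R) (f : R -> R) : ib A B f -> forall e, 0 < e ->
  exists2 eta, 0 < eta & forall a b, A <= a -> a <= b -> b <= B -> b - a < eta ->
    rint a b (fun x => `|f x|) <= e.
Proof.
move=> fi e e0; have [mf _] := fi.
pose fn (n : nat) x := if n%:R < `|f x| then `|f x| else 0.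
have mn : measurable_fun setT (fun x => `|f x|) by exact: measurableT_comp.
have mfn n : measurable_fun setT (fn n).
  apply: measurable_fun_ifT => //.
  by apply: measurable_fun_ltr.
have nfi := ib_norm fi.
have fnle n x : `|fn n x| <= `|f x|.
  by rewrite /fn; case: ifP => _; rewrite ?normr_id// normr0.
have : (fun n => rint A B (fn n)) @ \oo --> rint A B (fun=> 0).
  apply: (rint_dct _ _ nfi) => //.
  - apply: ae_all => x _; apply: cvg_near_cst; near=> n.
    rewrite /fn ifF//; apply/negbTE; rewrite -leNgt.
    by near: n; exact: nbhs_infty_ger.
  - exact: ae_all.
move/cvgrPdist_lt => /(_ (e / 2)); rewrite divr_gt0// => /(_ isT) [N _ /(_ N (leqnn N))].
have -> : rint A B (fun=> 0 : R) = 0.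
  by case: (leP A B) => AB; [rewrite rint_cst// mul0r|rewrite rint_pt// ltW].
rewrite sub0r normrN => h.
exists (e / 2 / (N.+1%:R)); first by rewrite !divr_gt0.
move=> a b Aa ab bB bae.
have fni n : ib A B (fn n) by apply: (ib_le _ nfi).
apply: (@le_trans _ _ (rint a b (fun x => N%:R + fn N x))).
  apply: le_rint.
  - exact: ibS nfi.
  - by apply: ibD; [exact: ib_cst|exact: ibS (fni N)].
  - move=> x _; rewrite /fn; case: ltP => //; last by rewrite addr0.
    by rewrite lerDr.
rewrite rintD; [|exact: ib_cst|exact: ibS (fni N)].
rewrite rint_cst//.
have h1 : rint a b (fn N) <= rint A B (fn N).
  have fn0 x : 0 <= fn N x by rewrite /fn; case: ifP.
  rewrite (rint_cat Aa (le_trans ab bB) (fni N)).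
  rewrite (rint_cat ab bB); last by apply: ibS (fni N).
  have : 0 <= rint A a (fn N) by apply: rint_ge0.
  have : 0 <= rint b B (fn N) by apply: rint_ge0.
  by lra.
have h2 : rint A B (fn N) < e / 2 by apply: le_lt_trans h; exact: ler_norm.
have h3 : N%:R * (b - a) <= e / 2.
  apply: (@le_trans _ _ (N.+1%:R * (b - a))).
    by rewrite ler_wpM2r// ?subr_ge0// ler_nat.
  by move/ltW: bae; rewrite ler_pdivlMr// mulrC.
by lra.
Unshelve. all: by end_near. Qed.

(** The product rule for absolutely continuous functions, obtained without differentiating them: on
    a short interval the factors [u1], [u2] move by at most [e], so the defect [Psi] moves by at
    most [e] times the integral of [|q1| + |q2|]. These local errors are summed and [e] is
    arbitrary. *)
Lemma rint_prod (a b : R) (u1 u2 q1 q2 : R -> R) : a <= b ->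
  ib a b q1 -> ib a b q2 ->
  measurable_fun setT u1 -> measurable_fun setT u2 ->
  (forall x y, a <= x -> x <= y -> y <= b -> u1 y - u1 x = rint x y q1) ->
  (forall x y, a <= x -> x <= y -> y <= b -> u2 y - u2 x = rint x y q2) ->
  ib a b (fun x => q1 x * u2 x + u1 x * q2 x) /\
  u1 b * u2 b - u1 a * u2 a = rint a b (fun x => q1 x * u2 x + u1 x * q2 x).
Proof.
move=> ab i1 i2 m1 m2 h1 h2.
have bnd (u q : R -> R) : ib a b q ->
    (forall x y, a <= x -> x <= y -> y <= b -> u y - u x = rint x y q) ->
    forall x, a <= x <= b -> `|u x| <= `|u a| + rint a b (fun x => `|q x|).
  move=> iq h x /andP[ax xb].
  have iqx : ib a x q by apply: ibS iq.
  have := h _ _ (lexx a) ax xb => E.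
  have -> : u x = u a + rint a x q by rewrite -E; ring.
  apply: (le_trans (ler_normD _ _)); rewrite lerD2l.
  apply: (le_trans (rint_norm iqx)).
  rewrite [leRHS](rint_cat ax xb) ?lerDl; last exact: ib_norm.
  by apply: rint_ge0.
have g1 : ib a b (fun x => q1 x * u2 x).
  by apply: ibM => //; apply: ae_all => x xab; exact: bnd h2 _ xab.
have g2 : ib a b (fun x => u1 x * q2 x).
  rewrite (_ : (fun _ => _) = (fun x => q2 x * u1 x)).
    by apply: ibM => //; apply: ae_all => x xab; exact: bnd h1 _ xab.
  by apply/funext => x; rewrite mulrC.
have g := ibD g1 g2; split=> //.
pose Psi x := u1 x * u2 x - rint a x (fun x => q1 x * u2 x + u1 x * q2 x).
pose S x := rint a x (fun x => `|q1 x| + `|q2 x|).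
have iS : ib a b (fun x => `|q1 x| + `|q2 x|) by apply: ibD; exact: ib_norm.
suff H e : 0 < e -> `|Psi b - Psi a| <= e * S b.
  have : Psi b - Psi a = 0.
    apply/eqP; rewrite -normr_le0 leNgt; apply/negP => p0.
    have S0 : 0 <= S b by apply: rint_ge0 => x _; rewrite addr_ge0.
    pose e := `|Psi b - Psi a| / (2 * (S b + 1)).
    have e0 : 0 < e by apply: divr_gt0 => //; lra.
    have := H _ e0; rewrite /e => h.
    have hE : `|Psi b - Psi a| = 2 * (S b + 1) * e by rewrite /e; field; lra.
    rewrite -/e hE in h.
    have : e * S b < 2 * (S b + 1) * e by nra.
    by lra.
  rewrite /Psi (rint_pt _ (lexx a)); lra.
move=> e0.
have [d1 d10 D1] := ib_modulus i1 e0.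
have [d2 d20 D2] := ib_modulus i2 e0.
have S0 : S a = 0 by rewrite /S rint_pt.
rewrite -[S b]subr0 -S0 mulrBr.
have d0 : 0 < Num.min d1 d2 by rewrite lt_min d10.
apply: (@local_to_global _ (fun=> True) a b _ Psi (fun x => e * S x) d0) => //.
  move=> s t _ st _; exists ((s + t) / 2) => //.
  by apply/andP; split; lra.
move=> s t _ _ as_ st tb; rewrite lt_min => /andP[ts1 ts2].
have st' := ltW st.
have at_ := le_trans as_ st'; have sb := le_trans st' tb.
rewrite /S -mulrBr (rint_cat as_ st'); last by apply: ibS iS.
rewrite [X in e * X]addrC addKr.
rewrite /Psi (rint_cat as_ st'); last by apply: ibS g.
set A := rint a s _; set Y := rint s t _.
have -> : u1 t * u2 t - (A + Y) - (u1 s * u2 s - A) =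
  (u1 t - u1 s) * u2 t + u1 s * (u2 t - u2 s) - Y by ring.
rewrite /Y {A Y}.
rewrite h1// h2//.
have k1 : ib s t q1 by apply: ibS i1.
have k2 : ib s t q2 by apply: ibS i2.
rewrite (mulrC _ (u2 t)) -(rintZ (u2 t) k1) -(rintZ (u1 s) k2).
have j1 : ib s t (fun x => u2 t * q1 x) by apply: ibZ; apply: ibS i1.
have j2 : ib s t (fun x => u1 s * q2 x) by apply: ibZ; apply: ibS i2.
have j3 : ib s t (fun x => q1 x * u2 x + u1 x * q2 x) by apply: ibS g.
rewrite -rintD// -rintB//; last exact: ibD.
rewrite -(@rintZ _ s t e); last by apply: ibS iS.
apply: rint_norm_le.
- by have [] : ib s t (fun x => u2 t * q1 x + u1 s * q2 x - (q1 x * u2 x + u1 x * q2 x)) by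
    apply: ibB => //; exact: ibD.
- by apply: ibZ; apply: ibS iS.
- move=> x /andP[sx xt].
  have ax := le_trans as_ sx; have xb := le_trans xt tb.
  have -> : u2 t * q1 x + u1 s * q2 x - (q1 x * u2 x + u1 x * q2 x) =
    (u2 t - u2 x) * q1 x - (u1 x - u1 s) * q2 x by ring.
  apply: (le_trans (ler_normB _ _)); rewrite !normrM mulrDr.
  apply: lerD; apply: ler_wpM2r => //.
    rewrite h2//; apply: (le_trans (rint_norm _)); first by apply: ibS i2.
    by apply: D2 => //; lra.
  rewrite h1//; apply: (le_trans (rint_norm _)); first by apply: ibS i1.
  by apply: D1 => //; lra.
Qed.

(* [FTC1] and Lebesgue's differentiation theorem. *)
Lemma rint_ae0 (a b : R) (f : R -> R) : ib a b f ->
  (forall x, a <= x <= b -> rint a x f = 0) ->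
  {ae mu, forall x, a <= x <= b -> f x = 0}.
Proof.
move=> [mf fi] f0.
have iT : mu.-integrable setT (EFin \o (f \_ `[a, b])).
  by rewrite -restrict_EFin; apply/(@integrable_mkcond _ _ _ mu `[a, b] (EFin \o f)).
have lf : locally_integrable [set: R] (f \_ `[a, b]).
  exact: integrable_locally_restrict.
have := @FTC1 R (f \_ `[a, b]) (BLeft a) _ lf.
have iy y : mu.-integrable [set` Interval (BLeft a) (BRight y)] (EFin \o (f \_ `[a, b])).
  exact: integrableS iT.
move=> /(_ iy) h.
have na : {ae mu, forall x : R, x != a}.
  exists [set a]; split; [exact: measurable_set1|exact: lebesgue_measure_set1|].
  by move=> x /= /negP; rewrite negbK => /eqP.
move: h na; apply: ae_imp2 => x /= h xa /andP[ax xb].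
have axl : (a%:E < x%:E)%E by rewrite lte_fin lt_neqAle eq_sym xa.
have [_ /esym] := h axl.
rewrite patchE mem_set/= ?in_itv/= ?ax// => ->.
rewrite (_ : (fun y => _) = (fun=> 0)) ?derive1_cst//.
apply/funext => y; case: (leP y b) => yb; last first.
  rewrite -(f0 b); last by rewrite (le_trans ax xb) lexx.
  rewrite Rintegral_mkcond/= /rint [RHS]Rintegral_mkcond; apply: eq_Rintegral => z _.
  rewrite !patchE; case: (boolP (z \in _)) => zay; case: (boolP (z \in _)) => zab //.
  exfalso; move/negP : zay; apply; move: zab; rewrite !inE/= !in_itv/= => /andP[-> zb].
  by rewrite (le_trans zb (ltW yb)).
case: (leP a y) => ay.
  rewrite -(f0 y) ?ay//; apply: eq_rint => z /andP[az zy].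
  by rewrite patchE mem_set//= in_itv/= az (le_trans zy yb).
by rewrite -/(rint _ _ _) rint_pt// ltW.
Qed.

End AbsCont.

(** * Evolution of averages and a chain rule along curves *)

Section Evolution.
Context {R : realType}.
Local Notation mu := (@lebesgue_measure R).

Lemma ae_dense (D : R -> Prop) (a b s t : R) :
  {ae mu, forall r, a <= r <= b -> D r} -> a <= s -> s < t -> t <= b ->
  exists2 r, D r & s < r < t.
Proof.
move=> [A [mA A0 DA]] as_ st tb; apply: contrapT => nD.
have sub : `]s, t[ `<=` A.
  move=> r /=; rewrite in_itv/= => /andP[sr rt]; apply: DA => /= h.
  apply: nD; exists r; last by rewrite sr.
  by apply: h; rewrite (le_trans as_ (ltW sr)) (le_trans (ltW rt) tb).
have : (mu `]s, t[ <= 0)%E.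
  by rewrite -A0; apply: le_measure => //; rewrite inE//; exact: measurable_itv.
by rewrite lebesgue_measure_itv/= lte_fin st -EFinB lee_fin leNgt subr_gt0 st.
Qed.

(** The pointwise equation holds off a null set of [x] that depends on the time. Integration against
    [k] removes it, and Fubini exchanges the two integrals. *)
Lemma rint_evolution (f g : R -> R -> R) (k : R -> R) (a b C K s t : R) :
  a <= b ->
  measurable_fun setT (fun p : R * R => g p.1 p.2) ->
  (forall t, ib a b (f t)) ->
  (forall r, ib a b (g r)) -> (forall r, rint a b (fun x => `|g r x|) <= C) ->
  measurable_fun setT k -> (forall x, `|k x| <= K) ->
  0 <= s -> s <= t ->
  {ae mu, forall x, f s x = f 0 x + rint 0 s (g^~ x)} ->
  {ae mu, forall x, f t x = f 0 x + rint 0 t (g^~ x)} ->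
  rint a b (fun x => f t x * k x) - rint a b (fun x => f s x * k x) =
  rint s t (fun r => rint a b (fun x => g r x * k x)).
Proof.
move=> ab mg fi gi gC mk kK s0 st fs ft.
pose gk r x := g r x * k x.
have K0 : 0 <= K by apply: le_trans (kK 0).
have mgk : measurable_fun setT (fun p : R * R => gk p.1 p.2).
  by apply: measurable_funM => //; exact: measurableT_comp.
have kb : {ae mu, forall x, a <= x <= b -> `|k x| <= K} by apply: ae_all => x _.
have gki r : ib a b (gk r) by exact: ibM kb.
have gkC r : rint a b (fun x => `|gk r x|) <= C * K.
  apply: (@le_trans _ _ (rint a b (fun x => K * `|g r x|))).
    apply: le_rint; [exact: ib_norm|by apply: ibZ; exact: ib_norm|].
    by move=> x _; rewrite normrM mulrC ler_wpM2r.
  rewrite rintZ; last exact: ib_norm.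
  by rewrite mulrC ler_wpM2r.
have mS : measurable_fun setT (fun r => rint a b (gk r)).
  exact: (@measurable_rint_param _ _ _ gk (fun=> a) (fun=> b)).
have iS c d : ib c d (fun r => rint a b (gk r)).
  apply: (@ib_bounded _ _ _ (C * K)) => //; apply: ae_all => r _.
  exact: le_trans (rint_norm (gki r)) (gkC r).
have key t' : 0 <= t' -> {ae mu, forall x, f t' x = f 0 x + rint 0 t' (g^~ x)} ->
    rint a b (fun x => f t' x * k x) =
    rint a b (fun x => f 0 x * k x) + rint 0 t' (fun r => rint a b (gk r)).
  move=> t'0 ft'.
  have [-> _ ib3] := @rint_fubini _ 0 t' a b (C * K) gk mgk
    (ae_all (fun r _ => conj (gki r) (gkC r))).
  have [_ ae2 _] := @rint_fubini _ 0 t' a b C g mg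
    (ae_all (fun r _ => conj (gi r) (gC r))).
  rewrite -rintD//; last exact: ibM kb.
  apply: eq_rint_ae.
  - by have [] := ibM (fi t') mk kb.
  - by have [] := ibD (ibM (fi 0) mk kb) ib3.
  - move: ft' ae2; apply: ae_imp2 => x -> h xab.
    rewrite mulrDl; congr (_ + _); rewrite mulrC -rintZ; last exact: h.
    by apply: eq_rint => r _; rewrite /gk mulrC.
rewrite (key t)//; last exact: le_trans st.
rewrite (key s)// (rint_cat s0 st)//.
by ring.
Qed.

(* [F] is absolutely continuous in time with the space variable frozen, and [C^1] in
   space, uniformly on the good times [D]; [local_to_global] sums the local errors. *)
Lemma chain_rule (D : R -> Prop) (s0 t0 C : R) (F Fa Gf : R -> R -> R)
    (xi sg : R -> R) :
  0 <= C ->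
  {ae mu, forall r, s0 <= r <= t0 -> D r} ->
  (forall s t a, D s -> D t -> s0 <= s -> s <= t -> t <= t0 ->
     F t a - F s a = rint s t (Gf^~ a)) ->
  (forall e, 0 < e -> exists2 d, 0 < d & forall t a b, D t -> s0 <= t <= t0 ->
     `|b - a| < d ->
     `|F t b - F t a - Fa t a * (b - a)| <= e * `|b - a|) ->
  (forall e, 0 < e -> exists2 d, 0 < d & forall s t a b, D s -> D t ->
     s0 <= s <= t0 -> s0 <= t <= t0 ->
     `|b - a| < d -> `|t - s| < d ->
     `|Fa t b - Fa s a| <= e) ->
  (forall e, 0 < e -> exists2 d, 0 < d & forall t a b, D t -> s0 <= t <= t0 ->
     `|b - a| < d ->
     `|Gf t b - Gf t a| <= e) ->
  (forall s t, D s -> D t -> s0 <= s -> s <= t -> t <= t0 ->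
     xi t - xi s = rint s t sg) ->
  (forall r, `|sg r| <= C) -> measurable_fun setT sg ->
  (forall a, measurable_fun setT (Gf^~ a)) ->
  measurable_fun setT (fun r => Gf r (xi r)) ->
  measurable_fun setT (fun r => Fa r (xi r)) ->
  (forall t a, D t -> s0 <= t <= t0 -> `|Gf t a| <= C) ->
  (forall t a, D t -> s0 <= t <= t0 -> `|Fa t a| <= C) ->
  forall s t, D s -> D t -> s0 <= s -> s <= t -> t <= t0 ->
  F t (xi t) - F s (xi s) = rint s t (fun r => Gf r (xi r) + sg r * Fa r (xi r)).
Proof.
move=> C0 aeD H1 H2 H3 H4 dxi sgC msg mG mGxi mFxi GC FC s t Ds Dt s0s st tt0.
pose I r := Gf r (xi r) + sg r * Fa r (xi r).
have aeS s' t' : s0 <= s' -> t' <= t0 -> {ae mu, forall r, s' <= r <= t' -> D r /\ s0 <= r <= t0}.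
  move=> h1 h2; move: aeD; apply: ae_imp => r h /andP[r1 r2].
  have : s0 <= r <= t0 by rewrite (le_trans h1 r1) (le_trans r2 h2).
  by move=> h3; split=> //; exact: h.
have iI s' t' : s0 <= s' -> t' <= t0 -> ib s' t' I.
  move=> h1 h2; apply: (@ib_bounded _ _ _ (C + C * C)).
    by apply: measurable_funD => //; exact: measurable_funM.
  have := aeS _ _ h1 h2; apply: ae_imp => r h /h[Dr rr].
  apply: (le_trans (ler_normD _ _)); apply: lerD; first by exact: GC.
  by rewrite normrM ler_pM//; exact: FC.
pose Psi r := F r (xi r) - rint s0 r I.
suff H e : 0 < e -> `|Psi t - Psi s| <= e * (1 + 2 * C) * t - e * (1 + 2 * C) * s.
  have : Psi t - Psi s = 0.
    apply/eqP; rewrite -normr_le0 leNgt; apply/negP => p0.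
    pose K := (1 + 2 * C) * (t - s) + 1.
    have K0 : 0 < K by rewrite /K ltr_wpDl// mulr_ge0//; lra.
    have e0 : 0 < `|Psi t - Psi s| / (2 * K) by rewrite divr_gt0// mulr_gt0.
    have := H _ e0; rewrite -!mulrBr -mulrA.
    set n := `|_| => h.
    have : n / (2 * K) * ((1 + 2 * C) * (t - s)) <= n / (2 * K) * K.
      by rewrite ler_wpM2l// ?(ltW e0)// /K lerDl.
    have -> : n / (2 * K) * K = n / 2 by field; lra.
    by rewrite -/n in p0; lra.
  rewrite /Psi (rint_cat s0s st); last by apply: iI.
  by rewrite -/I; lra.
move=> e0.
have [d2 d20 D2] := H2 _ e0; have [d3 d30 D3] := H3 _ e0; have [d4 d40 D4] := H4 _ e0.
(* The curve moves by at most [C] times the elapsed time; dividing by [C + 1] keeps both the elapsed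
   time and the displacement within the moduli. *)
pose d := Num.min (Num.min d2 d3) d4 / (C + 1).
have C1 : 0 < C + 1 by lra.
have d0 : 0 < d by rewrite divr_gt0// !lt_min d20 d30.
apply: (@local_to_global _ D s0 t0 d Psi (fun r => e * (1 + 2 * C) * r) d0) => //.
  by move=> s' t'; exact: ae_dense aeD.
move=> s' t' Ds' Dt' s0s' st' tt0' ts'.
have st'' := ltW st'.
have mind x : 0 <= x -> x < d -> [/\ C * x < d2, C * x < d3, C * x < d4 & x < d3].
  move=> x0; rewrite /d ltr_pdivlMr// !lt_min => /andP[/andP[h2 h3] h4].
  have h : C * x <= x * (C + 1) by rewrite mulrDr mulr1 mulrC lerDl.
  have h' : x <= x * (C + 1) by rewrite mulrDr mulr1 lerDr mulr_ge0.
  split; [exact: le_lt_trans h2|exact: le_lt_trans h3|exact: le_lt_trans h4|exact: le_lt_trans h3].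
clearbody d.
have step r : D r -> s' <= r <= t' -> `|xi r - xi s'| <= C * (r - s') /\ `|xi t' - xi r| <= C * (t' - r).
  move=> Dr /andP[r1 r2]; split.
    by rewrite dxi//; [exact: rint_bound|exact: le_trans r2 tt0'].
  by rewrite dxi//; [exact: rint_bound|exact: le_trans s0s' r1].
have ts0 : 0 <= t' - s' by rewrite subr_ge0.
have [m2 m3 m4 m5] := mind (t' - s') ts0 ts'.
have rs' : s0 <= s' <= t0 by rewrite s0s' (le_trans st'' tt0').
have rt' : s0 <= t' <= t0 by rewrite (le_trans s0s' st'').
have sml x : 0 <= x -> x <= t' - s' -> C * x <= C * (t' - s').
  by move=> *; rewrite ler_wpM2l.
have [xs1 _] := step t' Dt' (ltac:(by rewrite st'' lexx)).
rewrite /Psi (rint_cat s0s' st''); last by apply: iI.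
(* The increment is split into a step in space at time [s'] followed by a step in time at the
   position [xi t']. *)
have -> : F t' (xi t') - (rint s0 s' I + rint s' t' I) - (F s' (xi s') - rint s0 s' I) =
  (F t' (xi t') - F s' (xi t')) +
  (F s' (xi t') - F s' (xi s') - Fa s' (xi s') * (xi t' - xi s')) +
  (Fa s' (xi s') * (xi t' - xi s') - rint s' t' I) by ring.
rewrite H1//.
have iGt : ib s' t' (Gf^~ (xi t')).
  apply: (@ib_bounded _ _ _ C) => //.
  have := aeS _ _ s0s' tt0'; apply: ae_imp => r h /h[Dr rr].
  by exact: GC.
have isg c : ib s' t' (fun r => c * sg r).
  by apply: ibZ; apply: (@ib_bounded _ _ _ C) => //; exact: ae_all.
have isg1 : ib s' t' sg by apply: (@ib_bounded _ _ _ C) => //; exact: ae_all.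
have iI' : ib s' t' I by apply: iI.
set W := F s' (xi t') - F s' (xi s') - _.
have HW : `|W| <= e * (C * (t' - s')).
  rewrite /W; apply: (le_trans (D2 _ _ _ _ _ _)) => //; [exact: le_lt_trans xs1 m2|].
  by rewrite ler_wpM2l// ltW.
clearbody W.
rewrite dxi// -(rintZ (Fa s' (xi s')) isg1) addrAC addrA -rintD// -rintB//; last exact: ibD.
apply: (le_trans (ler_normD _ _)).
have -> : e * (1 + 2 * C) * t' - e * (1 + 2 * C) * s' =
  (e + C * e) * (t' - s') + e * (C * (t' - s')) by ring.
apply: lerD => //.
  apply: rint_bound_ae => //.
    by have [] := ibB (ibD iGt (isg (Fa s' (xi s')))) iI'.
  have := aeS _ _ s0s' tt0'; apply: ae_imp => r h rr'; have [Dr rr] := h rr'.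
  have /andP[r1 r2] := rr'.
  rewrite /I.
  have -> : Gf r (xi t') + Fa s' (xi s') * sg r - (Gf r (xi r) + sg r * Fa r (xi r)) =
    (Gf r (xi t') - Gf r (xi r)) - sg r * (Fa r (xi r) - Fa s' (xi s')) by ring.
  have [x1 x2] := step r Dr rr'.
  have y1 : C * (r - s') <= C * (t' - s') by apply: sml; [rewrite subr_ge0|rewrite lerD2r].
  have y2 : C * (t' - r) <= C * (t' - s') by apply: sml; [rewrite subr_ge0|rewrite lerD2l lerN2].
  apply: (le_trans (ler_normB _ _)); apply: lerD.
    by apply: D4 => //; exact: le_lt_trans (le_trans x2 y2) m4.
  rewrite normrM ler_pM//; apply: D3 => //; first exact: le_lt_trans (le_trans x1 y1) m3.
  by rewrite ger0_norm ?subr_ge0//; apply: le_lt_trans m5; rewrite lerD2r.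
Qed.

End Evolution.

(** * Good solutions and the energy variable *)

(* Good representatives of a solution [u] with [q = u_x]: [H] is the source term
    [dinv (u - u q^2) - f], and [Y] is a primitive in [x] of the density [1 + q^2]
    of total mass [P = 1 + h] per period; its time derivative is
    [u^2 (1 + q^2) - 2 wb u], where [wb] is the mean of [u - u q^2]. The last two
    fields are the integrated evolution equations at the good times [G]. *)
Record good_solution (R : realType) (u q H Y : R -> R -> R) (wb P M : R)
    (G : R -> Prop) : Prop := GoodSolution {
  gs_G0 : G 0;
  gs_Gge : forall t, G t -> 0 <= t;
  gs_Gae : {ae (@lebesgue_measure R), forall t, 0 <= t -> G t};
  gs_mu : measurable_fun setT (fun p : R * R => u p.1 p.2);
  gs_mq : measurable_fun setT (fun p : R * R => q p.1 p.2);
  gs_mH : measurable_fun setT (fun p : R * R => H p.1 p.2);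
  gs_mY : measurable_fun setT (fun p : R * R => Y p.1 p.2);
  gs_q2 : forall t, loci (fun x => q t x ^+ 2);
  gs_u : forall t a b, a <= b -> u t b - u t a = rint a b (q t);
  gs_Y : forall t a b, a <= b ->
    Y t b - Y t a = (b - a) + rint a b (fun x => q t x ^+ 2);
  gs_H : forall t, G t -> 0 < t -> forall a b, a <= b ->
    H t b - H t a = rint a b (fun x => u t x - u t x * q t x ^+ 2) - wb * (b - a);
  gs_Yle : forall t x, Y t (x + 1) - Y t x <= P;
  gs_Yper : forall t, G t -> forall x, Y t (x + 1) = Y t x + P;
  gs_uper : forall t, G t -> forall x, u t (x + 1) = u t x;
  gs_w : forall t, G t -> 0 < t -> forall x,
    rint x (x + 1) (fun y => u t y - u t y * q t y ^+ 2) = wb;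
  gs_f : forall t, G t -> 0 < t -> forall x,
    rint x (x + 1) (fun y => (1 - q t y ^+ 2) * H t y) = 0;
  gs_bu : forall t x, `|u t x| <= M;
  gs_bH : forall t x, `|H t x| <= M;
  gs_bw : `|wb| <= M;
  gs_M1 : 1 <= M;
  gs_PM : P <= M;
  gs_P2 : P != 2;
  gs_ut : forall t, G t -> {ae (@lebesgue_measure R), forall x,
    u t x = u 0 x + rint 0 t (fun r => u r x ^+ 2 * q r x + H r x)};
  gs_Yt : forall t, G t -> {ae (@lebesgue_measure R), forall x,
    Y t x = Y 0 x + rint 0 t (fun r => u r x ^+ 2 * (1 + q r x ^+ 2) - 2 * wb * u r x)}
}.

Section GoodSolution.
Context {R : realType} {u q H Y : R -> R -> R} {wb P M : R} {G : R -> Prop}.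
Context (S : good_solution u q H Y wb P M G).
Local Notation mu := (@lebesgue_measure R).

Lemma gs_mus t : measurable_fun setT (u t).
Proof. exact: mfun_sec1 (gs_mu S). Qed.

Lemma gs_mqs t : measurable_fun setT (q t).
Proof. exact: mfun_sec1 (gs_mq S). Qed.

Lemma gs_mHs t : measurable_fun setT (H t).
Proof. exact: mfun_sec1 (gs_mH S). Qed.

Lemma gs_M0 : 0 <= M.
Proof. exact: le_trans ler01 (gs_M1 S). Qed.

Lemma ib_q t a b : ib a b (q t).
Proof.
apply: (@ib_le _ _ _ _ (fun x => 1 + q t x ^+ 2)).
- exact: gs_mqs.
- by apply: ibD; [exact: ib_cst|exact: (gs_q2 S)].
- move=> x _; rewrite ler_norml; apply/andP; split; nra.
Qed.

Lemma ib_u t a b : ib a b (u t).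
Proof.
by apply: (@ib_bounded _ _ _ M); [exact: gs_mus|apply: ae_all => x _; exact: gs_bu S _ _].
Qed.

Lemma ib_H t a b : ib a b (H t).
Proof.
by apply: (@ib_bounded _ _ _ M); [exact: gs_mHs|apply: ae_all => x _; exact: gs_bH S _ _].
Qed.

Lemma dY_ge t a b : a <= b -> b - a <= Y t b - Y t a.
Proof.
move=> ab; rewrite (gs_Y S)// lerDl; apply: rint_ge0 => x _; exact: sqr_ge0.
Qed.

Lemma q2_le t a b : a <= b -> rint a b (fun x => q t x ^+ 2) <= Y t b - Y t a.
Proof. by move=> ab; rewrite (gs_Y S)// lerDr subr_ge0. Qed.

(** From [2 |q| <= 1 + q^2]. This makes [u] Lipschitz with constant [1 / 2] as a function of [Y]. *)
Lemma absq_le t a b : a <= b -> rint a b (fun x => `|q t x|) <= (Y t b - Y t a) / 2.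
Proof.
move=> ab; rewrite (gs_Y S)// -[b - a]mul1r -(rint_cst 1 ab).
rewrite -rintD; [|exact: ib_cst|exact: (gs_q2 S)].
rewrite mulrC -rintZ; last by apply: ibD; [exact: ib_cst|exact: (gs_q2 S)].
apply: le_rint.
- exact/ib_norm/ib_q.
- by apply: ibZ; apply: ibD; [exact: ib_cst|exact: (gs_q2 S)].
- by move=> x _; rewrite -[q t x ^+ 2]ger0_norm ?sqr_ge0// normrX; have := sqr_ge0 (`|q t x| - 1); nra.
Qed.

(** Cauchy-Schwarz. It provides the modulus of continuity of [u] in [x], of exponent [1 / 2] and
    uniform in time. *)
Lemma absq_sqr t a b : a <= b ->
  (rint a b (fun x => `|q t x|)) ^+ 2 <= (b - a) * (Y t b - Y t a).
Proof.
move=> ab; apply: (le_trans (rint_cauchy_schwarz ab (ib_q t a b) (gs_q2 S t a b))).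
by rewrite ler_wpM2l ?subr_ge0// q2_le.
Qed.

Lemma Y_mono t a b : a <= b -> Y t a <= Y t b.
Proof. by move=> ab; have := dY_ge t ab; lra. Qed.

Lemma dY_le1 t a b : b <= a + 1 -> Y t b - Y t a <= M.
Proof.
move=> ba; apply: le_trans (gs_PM S); apply: le_trans (gs_Yle S t a).
by rewrite lerD2r Y_mono.
Qed.

Lemma du_absq t a b : a <= b -> `|u t b - u t a| <= rint a b (fun x => `|q t x|).
Proof. by move=> ab; rewrite (gs_u S)//; exact: rint_norm (ib_q t a b). Qed.

Lemma du_le t a b : a <= b -> `|u t b - u t a| <= (Y t b - Y t a) / 2.
Proof. by move=> ab; exact: le_trans (du_absq t ab) (absq_le t ab). Qed.

Lemma absq_modulus t a b e : 0 <= e -> a <= b -> b - a <= 1 -> (b - a) * M <= e ^+ 2 ->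
  rint a b (fun x => `|q t x|) <= e.
Proof.
move=> e0 ab ba1 h.
rewrite -(@ler_pXn2r _ 2%N)// ?nnegrE//; last by apply: rint_ge0.
apply: (le_trans (absq_sqr t ab)); apply: le_trans h.
by rewrite ler_wpM2l ?subr_ge0// dY_le1//; lra.
Qed.

Lemma u_modulus t a b e : 0 <= e -> `|b - a| <= 1 -> `|b - a| * M <= e ^+ 2 ->
  `|u t b - u t a| <= e.
Proof.
wlog ab : a b / a <= b.
  move=> W e0 h1 h2; case: (leP a b) => [|/ltW] ab; first exact: W.
  by rewrite distrC; apply: W => //; rewrite distrC.
move=> e0; rewrite ger0_norm ?subr_ge0// => h1 h2.
exact: le_trans (du_absq t ab) (absq_modulus t e0 ab h1 h2).
Qed.

Lemma u_space_modulus e : 0 < e -> exists2 d, 0 < d <= 1 &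
  forall t a b, `|b - a| <= d -> `|u t b - u t a| <= e.
Proof.
move=> e0; have M0 : 0 < M by apply: lt_le_trans (gs_M1 S).
exists (Num.min 1 (e ^+ 2 / M)).
  by rewrite lt_min ltr01 divr_gt0 ?exprn_gt0//= ge_min lexx.
move=> t a b; rewrite le_min => /andP[h1 h2].
apply: u_modulus => //; first exact: ltW.
by rewrite -ler_pdivlMr.
Qed.

(** The right-hand side of [u_t = u^2 u_x + H]. *)
Definition fluxu r x := u r x ^+ 2 * q r x + H r x.

Lemma measurable_fluxu : measurable_fun setT (fun p : R * R => fluxu p.1 p.2).
Proof.
apply: measurable_funD; last exact: gs_mH S.
apply: measurable_funM; last exact: gs_mq S.
by apply: measurable_funX; exact: gs_mu S.
Qed.

Lemma u2_le t x : `|u t x ^+ 2| <= M ^+ 2.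
Proof. by rewrite normrX ler_pXn2r ?nnegrE// ?gs_M0// (gs_bu S). Qed.

Lemma ib_fluxu r a b : ib a b (fluxu r).
Proof.
apply: ibD; last exact: ib_H.
rewrite (_ : (fun _ => _) = (fun x => q r x * u r x ^+ 2)); last first.
  by apply/funext => x; rewrite mulrC.
apply: (@ibM _ _ _ (M ^+ 2)); first exact: ib_q.
  by apply: measurable_funX; exact: gs_mus.
by apply: ae_all => x _; exact: u2_le.
Qed.

Lemma fluxu_le r a b : a <= b ->
  rint a b (fun x => `|fluxu r x|) <= M ^+ 2 * rint a b (fun x => `|q r x|) + M * (b - a).
Proof.
move=> ab; rewrite -(rint_cst M ab) -rintZ; last exact/ib_norm/ib_q.
rewrite -rintD; [|by apply: ibZ; exact/ib_norm/ib_q|exact: ib_cst].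
apply: le_rint; first exact/ib_norm/ib_fluxu.
  by apply: ibD; [apply: ibZ; exact/ib_norm/ib_q|exact: ib_cst].
move=> x _; apply: (le_trans (ler_normD _ _)); apply: lerD; last exact: gs_bH S _ _.
by rewrite normrM ler_wpM2r// u2_le.
Qed.

Lemma fluxu_le1 r a b : a <= b -> b <= a + 1 ->
  rint a b (fun x => `|fluxu r x|) <= M ^+ 3 + M.
Proof.
move=> ab ba; apply: (le_trans (fluxu_le r ab)).
have M0 := gs_M0; apply: lerD; last by rewrite -[leRHS]mulr1 ler_wpM2l//; lra.
rewrite [leRHS]exprSr ler_wpM2l// ?exprn_ge0//.
by apply: (le_trans (absq_le r ab)); have := dY_le1 r ba; lra.
Qed.

Lemma window_u s t a b : G s -> G t -> s <= t -> a <= b -> b <= a + 1 ->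
  rint a b (u t) - rint a b (u s) = rint s t (fun r => rint a b (fluxu r)).
Proof.
move=> Gs Gt st ab ba.
have k1 : forall x : R, `|(fun=> 1 : R) x| <= 1 by move=> x; rewrite normr1.
have := @rint_evolution R u fluxu (fun=> 1) a b (M ^+ 3 + M) 1 s t ab
  measurable_fluxu (fun t => ib_u t a b) (fun r => ib_fluxu r a b)
  (fun r => fluxu_le1 r ab ba) (measurable_cst _) k1 (gs_Gge S Gs) st
  (gs_ut S Gs) (gs_ut S Gt).
have E (f : R -> R) : rint a b (fun x => f x * 1) = rint a b f.
  by apply: eq_rint => x _; rewrite mulr1.
by rewrite !E => ->; apply: eq_rint => r _; rewrite E.
Qed.

(** The value at [x] is compared with the average over a window of fixed width. The average changes
    slowly in time because the flux has bounded integrals, and it differs little from the value by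
    the modulus in space. *)
Lemma u_time_modulus e : 0 < e -> exists2 d, 0 < d &
  forall s t x, G s -> G t -> `|t - s| <= d -> `|u t x - u s x| <= e.
Proof.
move=> e0.
have [d /andP[d0 d1] D] := u_space_modulus (divr_gt0 e0 (ltr0Sn R 2)).
have M1 := gs_M1 S; have M0 := gs_M0.
pose K := M ^+ 3 + M.
have K0 : 0 < K by rewrite /K ltr_wpDl// ?exprn_ge0//; lra.
(* Three errors of size [e / 3]: the replacement of the value by the window average at each of the
   two times, and the motion of the average, whose speed is at most [K / d]. *)
exists (e / 3 * d / K); first by rewrite !(divr_gt0, mulr_gt0).
move=> s t x; wlog st : s t / s <= t.
  move=> W Gs Gt h; case: (leP s t) => [|/ltW] st; first exact: W.
  by rewrite distrC; apply: W => //; rewrite distrC.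
move=> Gs Gt; rewrite ger0_norm ?subr_ge0// => h.
have ab : x <= x + d by lra.
have := window_u Gs Gt st ab (ltac:(lra)).
set W := rint s t _ => E.
have hW : `|W| <= K * (t - s).
  apply: rint_bound => //.
    exact: (@measurable_rint_param _ _ _ fluxu (fun=> x) (fun=> x + d) measurable_fluxu).
  move=> r _; apply: (le_trans (rint_norm (ib_fluxu r _ _))).
  by apply: fluxu_le1; lra.
have hW' : `|W| <= e / 3 * d.
  apply: (le_trans hW); rewrite mulrC -ler_pdivlMr//.
have near' r : `|rint x (x + d) (u r) - d * u r x| <= e / 3 * d.
  have -> : d * u r x = rint x (x + d) (fun=> u r x).
    by rewrite rint_cst//; ring.
  rewrite -rintB; [|exact: ib_u|exact: ib_cst].
  have -> : e / 3 * d = e / 3 * (x + d - x) by ring.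
  apply: rint_bound => //.
    by apply: measurable_funB => //; exact: gs_mus.
  move=> y /andP[y1 y2]; apply: D; rewrite ger0_norm; lra.
have h1 := near' s; have h2 := near' t.
rewrite -(ler_pM2l d0) -{1}(ger0_norm (ltW d0)) -normrM.
move: hW' h1 h2; rewrite -E !ler_norml => /andP[? ?] /andP[? ?] /andP[? ?].
by apply/andP; split; lra.
Qed.

End GoodSolution.

(** * Integrals over a moving window *)

Section Windows.
Context {R : realType}.
Local Notation mu := (@lebesgue_measure R).

Lemma rint_window (f : R -> R) (a b d : R) : loci f -> 0 <= d -> a <= b ->
  rint b (b + d) f - rint a (a + d) f = rint (a + d) (b + d) f - rint a b f.
Proof.
move=> lf d0 ab.
have h1 := @rint_cat _ a b (b + d) f ab (ltac:(lra)) (lf _ _).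
have h2 := @rint_cat _ a (a + d) (b + d) f (ltac:(lra)) (ltac:(lra)) (lf _ _).
by lra.
Qed.

(** A window integral is differentiable in its position, with derivative the difference of the end
    values of [f]; the remainder is governed by the modulus of [f]. This yields the
    differentiability in space that [chain_rule] asks for. *)
Lemma rint_window_diff (f : R -> R) (a b d e : R) : loci f -> 0 <= d ->
  (forall x y, `|y - x| <= `|b - a| -> `|f y - f x| <= e) ->
  `|rint b (b + d) f - rint a (a + d) f - (f (a + d) - f a) * (b - a)| <=
  2 * e * `|b - a|.
Proof.
move=> lf d0 fe; have mf : measurable_fun setT f by have [] := lf 0 0.
have main x y p : x <= y -> `|y - x| <= `|b - a| -> x <= p <= y ->
    `|rint x y f - f p * (y - x)| <= e * (y - x).
  move=> xy xyab /andP[xp py].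
  rewrite -(rint_cst _ xy) -rintB//; last exact: ib_cst.
  apply: rint_bound => //; first exact: measurable_funB.
  move=> z /andP[xz zy]; apply: fe.
  apply: le_trans xyab; rewrite (ger0_norm (_ : 0 <= y - x)) ?subr_ge0//.
  by rewrite ler_norml; apply/andP; split; lra.
case: (leP a b) => ab.
  rewrite rint_window//.
  have h1 := main a b a ab (lexx _) (ltac:(lra)).
  have h2 := main (a + d) (b + d) (a + d) (ltac:(lra))
    (ltac:(by rewrite (_ : b + d - (a + d) = b - a); [|ring])) (ltac:(lra)).
  rewrite (ger0_norm (_ : 0 <= b - a)) ?subr_ge0//.
  move: h1 h2; rewrite (_ : b + d - (a + d) = b - a); last by ring.
  by rewrite !ler_norml => /andP[? ?] /andP[? ?]; apply/andP; split; lra.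
have ba := ltW ab.
have := rint_window lf d0 ba => E.
have h1 := main b a a ba (ltac:(by rewrite distrC)) (ltac:(lra)).
have h2 := main (b + d) (a + d) (a + d) (ltac:(lra))
  (ltac:(by rewrite (_ : a + d - (b + d) = a - b); [rewrite distrC|ring])) (ltac:(lra)).
rewrite (distrC b a) (ger0_norm (_ : 0 <= a - b)) ?subr_ge0//.
move: h1 h2; rewrite (_ : a + d - (b + d) = a - b); last by ring.
by rewrite !ler_norml => /andP[? ?] /andP[? ?]; apply/andP; split; lra.
Qed.

Lemma rint_window_lip (f : R -> R) (a b d C : R) : loci f -> 0 <= d ->
  (forall x, 0 <= f (x + d) - f x <= C) ->
  `|rint b (b + d) f - rint a (a + d) f| <= C * `|b - a|.
Proof.
move=> lf d0 fe; have mf : measurable_fun setT f by have [] := lf 0 0.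
wlog ab : a b / a <= b.
  move=> W; case: (leP a b) => [|/ltW] ab; first exact: W.
  by rewrite distrC (distrC b); exact: W.
rewrite rint_window// rint_shift// -rintB//; last first.
  by split; [exact: measurable_shift|exact: (ib_shift (lf _ _)).2].
rewrite (ger0_norm (_ : 0 <= b - a)) ?subr_ge0//.
apply: rint_bound => //; first by apply: measurable_funB => //; exact: measurable_shift.
by move=> x _; have /andP[h1 h2] := fe x; rewrite ger0_norm.
Qed.

Lemma rint_window_bounded (f : R -> R) (a b d C : R) : measurable_fun setT f -> 0 <= d ->
  (forall x, `|f x| <= C) ->
  `|rint b (b + d) f - rint a (a + d) f| <= 2 * C * `|b - a|.
Proof.
move=> mf d0 fe.
have lf : loci f by move=> ? ?; apply: (@ib_bounded _ _ _ C) => //; exact: ae_all.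
wlog ab : a b / a <= b.
  move=> W; case: (leP a b) => [|/ltW] ab; first exact: W.
  by rewrite distrC (distrC b); exact: W.
rewrite rint_window// (ger0_norm (_ : 0 <= b - a)) ?subr_ge0//.
apply: (le_trans (ler_normB _ _)).
have h1 : `|rint (a + d) (b + d) f| <= C * (b + d - (a + d)) by apply: rint_bound => //; lra.
have h2 : `|rint a b f| <= C * (b - a) by exact: rint_bound.
by lra.
Qed.

End Windows.

(** * The energy variable and its inverse *)

Section Barrier.
Context {R : realType} {u q H Y : R -> R -> R} {wb P M : R} {G : R -> Prop}.
Context (S : good_solution u q H Y wb P M G).
Local Notation mu := (@lebesgue_measure R).

Lemma mYs t : measurable_fun setT (Y t).
Proof. exact: mfun_sec1 (gs_mY S). Qed.

Lemma loci_Y t : loci (Y t).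
Proof.
move=> a b; apply: (@ib_bounded _ _ _ (`|Y t a| + `|Y t b|)); first exact: mYs.
apply: ae_all => x /andP[ax xb].
have h1 := Y_mono S t ax; have h2 := Y_mono S t xb.
rewrite ler_norml; apply/andP; split.
  by have := ler_norm (- Y t a); have := normr_ge0 (Y t b); rewrite normrN; lra.
by have := ler_norm (Y t b); have := normr_ge0 (Y t a); lra.
Qed.

(** The modulus depends on [t]: nothing makes the densities [q t x ^+ 2] equi-integrable in time.
    Later limits therefore use it at one time only, or under dominated convergence in time. *)
Lemma Y_modulus t x e : 0 < e -> exists2 d, 0 < d &
  forall a b, x - 1 <= a -> b <= x + 1 -> a <= b -> b - a < d -> Y t b - Y t a <= e.
Proof.
move=> e0.
have i1 : ib (x - 1) (x + 1) (fun y => 1 + q t y ^+ 2).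
  by apply: ibD; [exact: ib_cst|exact: (gs_q2 S)].
have [d d0 D] := ib_modulus i1 e0; exists d => // a b xa bx ab bad.
apply: le_trans (D _ _ xa ab bx bad).
rewrite (gs_Y S)// -[b - a]mul1r -(rint_cst 1 ab).
rewrite -rintD; [|exact: ib_cst|exact: (gs_q2 S)].
rewrite (eq_rint (g := fun y => `|1 + q t y ^+ 2|))// => y _.
by rewrite ger0_norm// addr_ge0// sqr_ge0.
Qed.

Lemma continuous_Y t : continuous (Y t).
Proof.
move=> x; apply/cvgrPdist_le => e e0.
have [d d0 D] := Y_modulus t x e0.
have m0 : 0 < Num.min d 1 by rewrite lt_min d0 ltr01.
near=> y.
have : `|x - y| < Num.min d 1 by near: y; exact: (@nbhsx_ballx R R).
rewrite lt_min !ltr_norml => /andP[/andP[h1 h2] /andP[h3 h4]].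
case: (leP x y) => xy.
  have := D x y (ltac:(lra)) (ltac:(lra)) xy (ltac:(lra)).
  by rewrite distrC ger0_norm// subr_ge0 (Y_mono S).
have yx := ltW xy.
have := D y x (ltac:(lra)) (ltac:(lra)) yx (ltac:(lra)).
by rewrite ger0_norm// subr_ge0 (Y_mono S).
Unshelve. all: by end_near. Qed.

Lemma Y_surj t y : exists x, Y t x = y.
Proof.
(* Since [Y t] grows at least as fast as [x], the value [y] is attained within this distance of
   [0]. *)
pose a := - `|y - Y t 0|; pose b := `|y - Y t 0|.
have a0 : a <= 0 by rewrite oppr_le0 normr_ge0.
have b0 : 0 <= b by exact: normr_ge0.
have h1 := dY_ge S t a0; have h2 := dY_ge S t b0.
have h3 := ler_norm (y - Y t 0); have h4 := ler_norm (- (y - Y t 0)).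
rewrite normrN in h4.
have ab : a <= b by lra.
have Yab := Y_mono S t ab.
have [||x _ <-] := @IVT R (Y t) a b y ab; last by exists x.
  by apply: continuous_subspaceT; exact: continuous_Y.
rewrite (min_idPl Yab) (max_idPr Yab); have aE : a = - `|y - Y t 0| by [].
have bE : b = `|y - Y t 0| by [].
by apply/andP; split; lra.
Qed.

Definition invY t y := projT1 (cid (Y_surj t y)).

Lemma invYK t y : Y t (invY t y) = y.
Proof. by rewrite /invY; case: cid. Qed.

Lemma Y_lt t a b : a < b -> Y t a < Y t b.
Proof. by move=> ab; have := dY_ge S t (ltW ab); lra. Qed.

Lemma Y_le_inv t a b : Y t a <= Y t b -> a <= b.
Proof. by case: (leP a b) => // /Y_lt => /(_ t); rewrite ltNge => /negP. Qed.

Lemma YK t x : invY t (Y t x) = x.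
Proof.
by apply/eqP; rewrite eq_le; apply/andP; split; apply: (@Y_le_inv t); rewrite invYK.
Qed.

Lemma le_invY t y x : (invY t y <= x) = (y <= Y t x).
Proof.
apply/idP/idP => h; first by rewrite -(invYK t y) (Y_mono S).
by apply: (@Y_le_inv t); rewrite invYK.
Qed.

Lemma lt_invY t y x : (x < invY t y) = (Y t x < y).
Proof. by rewrite !ltNge le_invY. Qed.

Lemma invY_le t y x : (x <= invY t y) = (Y t x <= y).
Proof.
apply/idP/idP => h; first by rewrite -(invYK t y) (Y_mono S).
by apply: (@Y_le_inv t); rewrite invYK.
Qed.

Lemma invY_mono t y z : y <= z -> invY t y <= invY t z.
Proof. by move=> yz; rewrite le_invY invYK. Qed.

Lemma invY_lip t y z : y <= z -> invY t z - invY t y <= z - y.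
Proof.
move=> yz; have := dY_ge S t (invY_mono t yz); rewrite !invYK; exact.
Qed.

Lemma invY_per t y : G t -> invY t (y + P) = invY t y + 1.
Proof.
by move=> Gt; rewrite -{1}(invYK t y) -(gs_Yper S)// YK.
Qed.

(** The preimage of a half line is the set where [Y t c < y], so that joint measurability follows
    from that of [Y^~ c], without continuity in time. *)
Lemma measurable_invY : measurable_fun setT (fun p : R * R => invY p.1 p.2).
Proof.
move=> _; apply: (measurability _ (RGenOInfty.measurableE R)) => //.
move=> _ [_ [c ->] <-]; rewrite setTI.
have -> : (fun p : R * R => invY p.1 p.2) @^-1` `]c, +oo[ =
    [set p : R * R | Y p.1 c < p.2].
  by apply/seteqP; split=> p /=; rewrite in_itv/= andbT lt_invY.
have m : measurable_fun setT (fun p : R * R => (Y p.1 c < p.2)%R).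
  apply: measurable_fun_ltr => //.
  exact: (measurableT_comp (mfun_sec2 c (gs_mY S))).
have mt : measurable [set true] by [].
by have := m measurableT _ mt; rewrite setTI.
Qed.

Definition fluxY r x := u r x ^+ 2 * (1 + q r x ^+ 2) - 2 * wb * u r x.

Lemma ib_dens t a b : ib a b (fun x => 1 + q t x ^+ 2).
Proof. by apply: ibD; [exact: ib_cst|exact: (gs_q2 S)]. Qed.

Lemma rint_dens t a b : a <= b -> rint a b (fun x => 1 + q t x ^+ 2) = Y t b - Y t a.
Proof.
move=> ab; rewrite rintD; [|exact: ib_cst|exact: (gs_q2 S)].
by rewrite rint_cst// mul1r (gs_Y S).
Qed.

Lemma measurable_fluxY : measurable_fun setT (fun p : R * R => fluxY p.1 p.2).
Proof.
apply: measurable_funB.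
  apply: measurable_funM; first by apply: measurable_funX; exact: gs_mu S.
  apply: measurable_funD; first exact: measurable_cst.
  by apply: measurable_funX; exact: gs_mq S.
by apply: measurable_funM; [exact: measurable_cst|exact: gs_mu S].
Qed.

Lemma ib_u2dens t a b : ib a b (fun x => u t x ^+ 2 * (1 + q t x ^+ 2)).
Proof.
rewrite (_ : (fun _ => _) = (fun x => (1 + q t x ^+ 2) * u t x ^+ 2)); last first.
  by apply/funext => x; rewrite mulrC.
apply: (@ibM _ _ _ (M ^+ 2)); first exact: ib_dens.
  by apply: measurable_funX; exact: (gs_mus S).
by apply: ae_all => x _; exact: (u2_le S).
Qed.

Lemma ib_fluxY r a b : ib a b (fluxY r).
Proof. by apply: ibB; [exact: ib_u2dens|apply: ibZ; exact: (ib_u S)]. Qed.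

Lemma fluxY_le r a b : a <= b -> b <= a + 1 ->
  rint a b (fun x => `|fluxY r x|) <= M ^+ 3 + 2 * M ^+ 2.
Proof.
move=> ab ba; have M0 := gs_M0 S.
have i1 : ib a b (fun x => M ^+ 2 * (1 + q r x ^+ 2)) by apply: ibZ; exact: ib_dens.
apply: (@le_trans _ _ (rint a b (fun x => M ^+ 2 * (1 + q r x ^+ 2) + 2 * M ^+ 2))).
  apply: le_rint; first exact/ib_norm/ib_fluxY.
    by apply: ibD => //; exact: ib_cst.
  move=> x _; apply: (le_trans (ler_normB _ _)); apply: lerD; rewrite normrM.
    rewrite (ger0_norm (_ : 0 <= 1 + _)) ?addr_ge0 ?sqr_ge0//.
    by rewrite ler_wpM2r ?addr_ge0 ?sqr_ge0// (u2_le S).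
  rewrite normrM ger0_norm// -mulrA ler_pM2l// expr2 ler_pM//.
    exact: gs_bw S.
  exact: gs_bu S _ _.
rewrite rintD//; last exact: ib_cst.
rewrite rintZ; last exact: ib_dens.
rewrite rint_cst// rint_dens//; apply: lerD.
  by rewrite [leRHS]exprSr ler_wpM2l ?exprn_ge0// (dY_le1 S).
by rewrite -[leRHS]mulr1 ler_wpM2l ?mulr_ge0 ?exprn_ge0//; lra.
Qed.

Lemma window_Y s t a b : G s -> G t -> s <= t -> a <= b -> b <= a + 1 ->
  rint a b (Y t) - rint a b (Y s) = rint s t (fun r => rint a b (fluxY r)).
Proof.
move=> Gs Gt st ab ba.
have k1 : forall x : R, `|(fun=> 1 : R) x| <= 1 by move=> x; rewrite normr1.
have := @rint_evolution R Y fluxY (fun=> 1) a b (M ^+ 3 + 2 * M ^+ 2) 1 s t ab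
  measurable_fluxY (fun t => loci_Y t a b) (fun r => ib_fluxY r a b)
  (fun r => fluxY_le r ab ba) (measurable_cst _) k1 (gs_Gge S Gs) st
  (gs_Yt S Gs) (gs_Yt S Gt).
have E (f : R -> R) : rint a b (fun x => f x * 1) = rint a b f.
  by apply: eq_rint => x _; rewrite mulr1.
by rewrite !E => ->; apply: eq_rint => r _; rewrite E.
Qed.

End Barrier.

(** * Barriers for the energy variable along straight lines *)

Section DoubleWindow.
Context {R : realType} {u q H Y : R -> R -> R} {wb P M : R} {G : R -> Prop}.
Context (S : good_solution u q H Y wb P M G).
Context (d : R) (d0 : 0 < d) (d1 : d <= 1).
Local Notation mu := (@lebesgue_measure R).

Ltac lrd := have := d0; have := d1; lra.
Ltac nrd := have := d0; have := d1; nra.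

(** One average is not enough: the derivative of [W] in its position is a difference of values of
    [Y], without a modulus uniform in time. [W] itself is Lipschitz in space and time, so the second
    average [F] has a derivative [Fa] that satisfies the hypotheses of [chain_rule]. *)
Let W t a := rint a (a + d) (Y t).
Let F t a := rint a (a + d) (W t).
Let Fa t a := W t (a + d) - W t a.
Let gW r x := rint x (x + d) (fluxY (u := u) (q := q) (wb := wb) r).
Let Gf r a := rint a (a + d) (gW r).
Let K := M ^+ 3 + 2 * M ^+ 2.

Let K0 : 0 <= K.
Proof. by have := gs_M0 S; rewrite /K => M0; rewrite addr_ge0 ?mulr_ge0 ?exprn_ge0. Qed.

Let mW : measurable_fun setT (fun p : R * R => W p.1 p.2).
Proof.
apply: (@measurable_rint_param _ _ _ (fun (p : R * R) y => Y p.1 y) snd (fun p => p.2 + d)).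
- apply: (mfun_comp2 (gs_mY S)) => //.
  exact: (measurableT_comp (measurable_fst) measurable_fst).
- exact: measurable_snd.
- by apply: measurable_funD => //; exact: measurable_snd.
Qed.

Let mgW : measurable_fun setT (fun p : R * R => gW p.1 p.2).
Proof.
apply: (@measurable_rint_param _ _ _ (fun (p : R * R) y => fluxY (u := u) (q := q) (wb := wb) p.1 y)
  snd (fun p => p.2 + d)).
- apply: (mfun_comp2 (measurable_fluxY S)) => //.
  exact: (measurableT_comp (measurable_fst) measurable_fst).
- exact: measurable_snd.
- by apply: measurable_funD => //; exact: measurable_snd.
Qed.

Let gW_le r x : `|gW r x| <= K.
Proof.
apply: (le_trans (rint_norm (ib_fluxY S r _ _))).
by apply: (fluxY_le S); lrd.
Qed.

Let ib_gW r a b : ib a b (gW r).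
Proof.
apply: (@ib_bounded _ _ _ K); first exact: mfun_sec1 mgW.
by apply: ae_all => x _.
Qed.

Let dYd t x : 0 <= Y t (x + d) - Y t x <= M.
Proof.
apply/andP; split; first by rewrite subr_ge0 (Y_mono S)//; lrd.
by apply: (dY_le1 S); lrd.
Qed.

Let W_lip t a b : `|W t b - W t a| <= M * `|b - a|.
Proof. by apply: rint_window_lip; [exact: loci_Y S t|exact: ltW|exact: dYd]. Qed.

Let W_time s t a : G s -> G t -> `|W t a - W s a| <= K * `|t - s|.
Proof.
wlog st : s t / s <= t.
  move=> h; case: (leP s t) => [|/ltW] st; first exact: h.
  by move=> Gs Gt; rewrite distrC (distrC t); exact: h.
move=> Gs Gt; rewrite /W (window_Y S)//; [|lrd|lrd].
rewrite (ger0_norm (_ : 0 <= t - s)) ?subr_ge0//.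
apply: rint_bound => //; first exact: (mfun_sec2 a mgW).
by move=> r _; exact: gW_le.
Qed.

Let loci_W t : loci (W t).
Proof.
move=> a b; apply: (@ib_bounded _ _ _ (`|W t a| + M * (b - a))).
  exact: mfun_sec1 mW.
apply: ae_all => x /andP[ax xb].
have -> : W t x = W t a + (W t x - W t a) by ring.
apply: (le_trans (ler_normD _ _)); rewrite lerD2l.
apply: (le_trans (W_lip t _ _)); rewrite ler_wpM2l// ?(gs_M0 S)// ger0_norm; lrd.
Qed.

Let F_time s t a : G s -> G t -> s <= t -> F t a - F s a = rint s t (Gf^~ a).
Proof.
move=> Gs Gt st.
have ad : a <= a + d by lrd.
rewrite /F -rintB; [|exact: loci_W|exact: loci_W].
have C r : s <= r <= t -> ib a (a + d) (gW r) /\ rint a (a + d) (fun x => `|gW r x|) <= K * d.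
  move=> _; split; first exact: ib_gW.
  have -> : K * d = K * (a + d - a) by ring.
  rewrite -(rint_cst K ad); apply: le_rint; [exact/ib_norm/ib_gW|exact: ib_cst|].
  by move=> x _; exact: gW_le.
have [E _ _] := rint_fubini mgW (ae_all C).
rewrite [RHS]E {E C}; apply: eq_rint => x _.
by rewrite /W (window_Y S)//; [lrd|lrd].
Qed.

(** The derivative [Y_t - c Y_x] of [Y] along a line of velocity [- c]. *)
Let J c r x := (u r x ^+ 2 - c) * (1 + q r x ^+ 2) - 2 * wb * u r x.

Let ib_J c r a b : ib a b (J c r).
Proof.
rewrite (_ : J c r = (fun x => fluxY (u := u) (q := q) (wb := wb) r x - c * (1 + q r x ^+ 2))).
  by apply: ibB; [exact: ib_fluxY S _ _ _|apply: ibZ; exact: ib_dens S _ _ _].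
by apply/funext => x; rewrite /J /fluxY; ring.
Qed.

Let inner c r x : gW r x - c * (Y r (x + d) - Y r x) = rint x (x + d) (J c r).
Proof.
have xd : x <= x + d by lrd.
rewrite -(rint_dens S r xd) /gW -rintZ; last exact: ib_dens S _ _ _.
rewrite -rintB; [|exact: ib_fluxY S _ _ _|by apply: ibZ; exact: ib_dens S _ _ _].
by apply: eq_rint => y _; rewrite /J /fluxY; ring.
Qed.

Let ib_inner c r a b : ib a b (fun x => rint x (x + d) (J c r)).
Proof.
rewrite (_ : (fun _ => _) = (fun x => gW r x - c * (Y r (x + d) - Y r x))); last first.
  by apply/funext => x; rewrite inner.
apply: ibB; first exact: ib_gW.
apply: ibZ; apply: ibB; last exact: loci_Y S _ _ _.
by apply: ib_shift; exact: loci_Y S _ _ _.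
Qed.

Let integrand c r a : Gf r a + - c * Fa r a = rint a (a + d) (fun x => rint x (x + d) (J c r)).
Proof.
have sY : ib a (a + d) (fun x => Y r (x + d)) by apply: ib_shift; exact: loci_Y S _ _ _.
rewrite (eq_rint (g := fun x => gW r x - c * (Y r (x + d) - Y r x))); last first.
  by move=> x _; rewrite inner.
rewrite rintB; [|exact: ib_gW|]; last first.
  by apply: ibZ; apply: ibB => //; exact: loci_Y S _ _ _.
rewrite rintZ; last by apply: ibB => //; exact: loci_Y S _ _ _.
rewrite rintB//; last exact: loci_Y S _ _ _.
rewrite -(@rint_shift _ a (a + d) d); last exact: loci_Y S _ _ _.
by rewrite -/(W r (a + d)) -/(W r a) -/(Fa r a) -/(Gf r a) mulNr.
Qed.

Let F_chain c s t x0 : G s -> G t -> s <= t ->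
  F t (x0 - c * (t - s)) - F s x0 =
  rint s t (fun r => rint (x0 - c * (r - s)) (x0 - c * (r - s) + d)
    (fun x => rint x (x + d) (J c r))).
Proof.
move=> Gs Gt st; have M0 := gs_M0 S; have M1 := gs_M1 S.
have s0 := gs_Gge S Gs.
pose xi r := x0 - c * (r - s).
have mxi : measurable_fun setT xi.
  by apply: measurable_funB => //; apply: measurable_funM => //; exact: measurable_funB.
have mG : measurable_fun setT (fun p : R * R => Gf p.1 p.2).
  apply: (@measurable_rint_param _ _ _ (fun (p : R * R) y => gW p.1 y) snd (fun p => p.2 + d)).
  - apply: (mfun_comp2 mgW) => //.
    exact: (measurableT_comp (measurable_fst) measurable_fst).
  - exact: measurable_snd.
  - by apply: measurable_funD => //; exact: measurable_snd.
have mFa : measurable_fun setT (fun p : R * R => Fa p.1 p.2).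
  apply: measurable_funB => //.
  apply: (mfun_comp2 mW) => //.
  by apply: measurable_funD => //; exact: measurable_snd.
have Cge0 : 0 <= K + M + `|c| by apply: addr_ge0 => //; exact: addr_ge0.
have xis : xi s = x0 by rewrite /xi subrr mulr0 subr0.
suff key : F t (xi t) - F s (xi s) = rint s t (fun r => Gf r (xi r) + - c * Fa r (xi r)).
  rewrite -[X in _ - F s X]xis; apply: (etrans key).
  by apply: eq_rint => r _; exact: integrand.
have K0' := K0; clearbody K.
apply: (@chain_rule R G s t (K + M + `|c|) F Fa Gf xi (fun=> - c) Cge0).
- by move: (gs_Gae S); apply: ae_imp => r Gr /andP[sr _]; apply: Gr; exact: le_trans sr.
- by move=> s' t' a Gs' Gt' _ s't' _; exact: F_time.
- move=> e e0; exists (e / (2 * M)); first by rewrite divr_gt0//; lrd.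
  move=> r a b _ _ ba.
  apply: (le_trans (@rint_window_diff _ (W r) a b d (M * `|b - a|) (loci_W r) (ltW d0) _)).
    by move=> x y xy; apply: (le_trans (W_lip r _ _)); rewrite ler_wpM2l.
  rewrite ler_wpM2r// mulrA mulrC -ler_pdivlMr; last by lrd.
  exact: ltW.
- move=> e e0; have KM : 0 < 2 * M + 2 * K by lrd.
  exists (e / (2 * M + 2 * K)); first by rewrite divr_gt0.
  move=> s' t' a b Gs' Gt' _ _; rewrite !ltr_pdivlMr// => ab ts.
  have h1 := W_lip t' (a + d) (b + d).
  have h2 := W_lip t' a b.
  have h3 := W_time (a + d) Gs' Gt'; have h4 := W_time a Gs' Gt'.
  rewrite (_ : b + d - (a + d) = b - a) in h1; last by ring.
  have -> : Fa t' b - Fa s' a = (W t' (b + d) - W t' (a + d)) - (W t' b - W t' a) +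
     (W t' (a + d) - W s' (a + d)) - (W t' a - W s' a) by rewrite /Fa; ring.
  apply: (le_trans (ler_normB _ _)).
  have := ler_normD (W t' (b + d) - W t' (a + d) - (W t' b - W t' a)) (W t' (a + d) - W s' (a + d)).
  have := ler_normB (W t' (b + d) - W t' (a + d)) (W t' b - W t' a).
  by nrd.
- move=> e e0; exists (e / (2 * K + 1)); first by rewrite divr_gt0//; lrd.
  move=> r a b _ _ ba.
  apply: (le_trans (@rint_window_bounded _ (gW r) a b d K (mfun_sec1 _ mgW) (ltW d0) (gW_le r))).
  move: ba; rewrite ltr_pdivlMr; last by lrd.
  by have := normr_ge0 (b - a); nrd.
- move=> s' t' _ _ _ s't' _; rewrite rint_cst// /xi; ring.
- by move=> r; rewrite normrN; lrd.
- exact: measurable_cst.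
- by move=> a; exact: mfun_sec2 mG.
- exact: (mfun_comp2 mG).
- exact: (mfun_comp2 mFa).
- move=> r a _ _; have h : `|Gf r a| <= K * (a + d - a).
    apply: rint_bound; [lrd|exact: mfun_sec1 mgW|].
    by move=> x _; exact: gW_le.
  have := normr_ge0 c; nrd.
- move=> r a _ _; have h := W_lip r a (a + d).
  rewrite -/(Fa r a) (_ : a + d - a = d) in h; last by ring.
  rewrite (ger0_norm (ltW d0)) in h; have := normr_ge0 c; nrd.
- exact: Gs.
- exact: Gt.
- exact: lexx.
- exact: st.
- exact: lexx.
Qed.

Let mI c s x0 : measurable_fun setT (fun r : R => rint (x0 - c * (r - s)) (x0 - c * (r - s) + d)
    (fun x => rint x (x + d) (J c r))).
Proof.
have mxi : measurable_fun setT (fun r : R => x0 - c * (r - s)).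
  by apply: measurable_funB => //; apply: measurable_funM => //; exact: measurable_funB.
have mJ : measurable_fun setT (fun p : R * R => J c p.1 p.2).
  rewrite (_ : (fun _ => _) = (fun p : R * R => fluxY (u := u) (q := q) (wb := wb) p.1 p.2 - c * (1 + q p.1 p.2 ^+ 2))); last first.
    by apply/funext => x; rewrite /J /fluxY; ring.
  apply: measurable_funB; first exact: measurable_fluxY S.
  apply: measurable_funM => //; apply: measurable_funD => //; apply: measurable_funX.
  exact: gs_mq S.
apply: (@measurable_rint_param _ _ _ (fun r x => rint x (x + d) (J c r))) => //.
  apply: (@measurable_rint_param _ _ _ (fun (p : R * R) y => J c p.1 y) snd (fun p => p.2 + d)).
  - apply: (mfun_comp2 mJ) => //.
    exact: (measurableT_comp (measurable_fst) measurable_fst).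
  - exact: measurable_snd.
  - by apply: measurable_funD => //; exact: measurable_snd.
by apply: measurable_funD.
Qed.

(** By monotonicity of [Y t] the double average lies between the end values, which brings averages
    back to point values at the price of a shift by [2 * d]. *)
Let F_bounds t a : d ^+ 2 * Y t a <= F t a <= d ^+ 2 * Y t (a + 2 * d).
Proof.
have W_b x : d * Y t x <= W t x <= d * Y t (x + d).
  have xd : x <= x + d by lrd.
  have E c : d * c = rint x (x + d) (fun=> c) by rewrite rint_cst//; ring.
  rewrite !E; apply/andP; split; apply: le_rint; try exact: ib_cst; try exact: loci_Y S _ _ _.
    by move=> y /andP[xy _]; exact: Y_mono S _ _ _ xy.
  by move=> y /andP[_ xy]; exact: Y_mono S _ _ _ xy.
have ad : a <= a + d by lrd.
have E c : d ^+ 2 * c = rint a (a + d) (fun=> d * c) by rewrite rint_cst//; ring.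
rewrite !E; apply/andP; split; apply: le_rint; try exact: ib_cst; try exact: loci_W.
  move=> y /andP[ay _]; have /andP[h _] := W_b y; apply: le_trans h.
  by rewrite ler_pM2l//; exact: Y_mono S _ _ _ ay.
move=> y /andP[_ yd]; have /andP[_ h] := W_b y; apply: (le_trans h).
by rewrite ler_pM2l//; apply: (Y_mono S); lrd.
Qed.

(** Along a line moving left with speed [c >= u^2] the term [(u^2 - c) (1 + q^2)] is nonpositive,
    however large the energy density is; only the source [- 2 wb u <= k] remains. *)
Lemma barrier_upper c k s t x0 : G s -> G t -> s <= t ->
  (forall r x, G r -> s <= r <= t -> 
     x0 - c * (r - s) <= x <= x0 - c * (r - s) + 2 * d ->
     u r x ^+ 2 <= c /\ - (2 * wb * u r x) <= k) ->
  Y t (x0 - c * (t - s)) <= Y s (x0 + 2 * d) + k * (t - s).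
Proof.
move=> Gs Gt st h.
have d2 : 0 < d ^+ 2 by rewrite exprn_gt0.
have /andP[b1 _] := F_bounds t (x0 - c * (t - s)).
have /andP[_ b2] := F_bounds s x0.
have E := F_chain c x0 Gs Gt st.
suff : rint s t (fun r => rint (x0 - c * (r - s)) (x0 - c * (r - s) + d)
    (fun x => rint x (x + d) (J c r))) <= d ^+ 2 * k * (t - s).
  rewrite -E => hE; rewrite -(ler_pM2l d2) [X in _ <= X]mulrDr [X in _ <= _ + X]mulrA.
  apply: (le_trans b1); rewrite -lerBlDr; apply: le_trans b2.
  by rewrite lerBlDr -lerBlDl.
clear E b1 b2; rewrite -(rint_cst _ st); apply: le_rint_ae.
- apply: (@ib_bounded _ _ _ (K * d + `|c| * (M * d))) => //.
  apply: ae_all => r _; rewrite -integrand.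
  apply: (le_trans (ler_normD _ _)); apply: lerD.
    have -> : K * d = K * (x0 - c * (r - s) + d - (x0 - c * (r - s))) by ring.
    apply: rint_bound; [lrd|exact: mfun_sec1 mgW|].
    by move=> x _; exact: gW_le.
  rewrite normrM normrN ler_wpM2l//; apply: (le_trans (W_lip r _ _)).
  by rewrite (_ : _ + d - _ = d) ?(ger0_norm (ltW d0))//; ring.
- exact: ib_cst.
- move: (gs_Gae S); apply: ae_imp => r Gr /andP[sr rt].
  have {}Gr : G r by apply: Gr; apply: le_trans sr; exact: gs_Gge S _ Gs.
  set xi := x0 - c * (r - s).
  have xd : xi <= xi + d by lrd.
  have -> : d ^+ 2 * k = rint xi (xi + d) (fun=> d * k) by rewrite rint_cst//; ring.
  apply: le_rint; [exact: ib_inner|exact: ib_cst|move=> x /andP[x1 x2]].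
  have xd' : x <= x + d by lrd.
  have -> : d * k = rint x (x + d) (fun=> k) by rewrite rint_cst//; ring.
  apply: le_rint; [exact: ib_J|exact: ib_cst|move=> y /andP[y1 y2]].
  have rr : s <= r <= t by rewrite sr.
  have yy : x0 - c * (r - s) <= y <= x0 - c * (r - s) + 2 * d.
    by rewrite -/xi (le_trans x1 y1) (le_trans y2)// (le_trans (lerD x2 (lexx d)))//; lrd.
  have [k1 k2] := h r y Gr rr yy.
  have q0 : 0 <= 1 + q r y ^+ 2 by rewrite addr_ge0 ?sqr_ge0.
  have : (u r y ^+ 2 - c) * (1 + q r y ^+ 2) <= 0 by rewrite mulr_le0_ge0 // subr_le0.
  by rewrite /J; lra.
Qed.

(** The mirror image: with [c <= u^2] the term containing the density is nonnegative. *)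
Lemma barrier_lower c k s t x0 : G s -> G t -> s <= t ->
  (forall r x, G r -> s <= r <= t -> 
     x0 - c * (r - s) <= x <= x0 - c * (r - s) + 2 * d ->
     c <= u r x ^+ 2 /\ k <= - (2 * wb * u r x)) ->
  Y s x0 + k * (t - s) <= Y t (x0 - c * (t - s) + 2 * d).
Proof.
move=> Gs Gt st h.
have d2 : 0 < d ^+ 2 by rewrite exprn_gt0.
have /andP[_ b1] := F_bounds t (x0 - c * (t - s)).
have /andP[b2 _] := F_bounds s x0.
have E := F_chain c x0 Gs Gt st.
suff : d ^+ 2 * k * (t - s) <= rint s t (fun r => rint (x0 - c * (r - s)) (x0 - c * (r - s) + d)
    (fun x => rint x (x + d) (J c r))).
  rewrite -E => hE; rewrite -(ler_pM2l d2) [X in X <= _]mulrDr [X in _ + X <= _]mulrA.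
  apply: le_trans b1; rewrite -lerBrDl; apply: (le_trans hE).
  by rewrite lerD2l lerN2.
clear E b1 b2; rewrite -(rint_cst _ st); apply: le_rint_ae.
- exact: ib_cst.
- apply: (@ib_bounded _ _ _ (K * d + `|c| * (M * d))) => //.
  apply: ae_all => r _; rewrite -integrand.
  apply: (le_trans (ler_normD _ _)); apply: lerD.
    have -> : K * d = K * (x0 - c * (r - s) + d - (x0 - c * (r - s))) by ring.
    apply: rint_bound; [lrd|exact: mfun_sec1 mgW|].
    by move=> x _; exact: gW_le.
  rewrite normrM normrN ler_wpM2l//; apply: (le_trans (W_lip r _ _)).
  by rewrite (_ : _ + d - _ = d) ?(ger0_norm (ltW d0))//; ring.
- move: (gs_Gae S); apply: ae_imp => r Gr /andP[sr rt].
  have {}Gr : G r by apply: Gr; apply: le_trans sr; exact: gs_Gge S _ Gs.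
  set xi := x0 - c * (r - s).
  have xd : xi <= xi + d by lrd.
  have -> : d ^+ 2 * k = rint xi (xi + d) (fun=> d * k) by rewrite rint_cst//; ring.
  apply: le_rint; [exact: ib_cst|exact: ib_inner|move=> x /andP[x1 x2]].
  have xd' : x <= x + d by lrd.
  have -> : d * k = rint x (x + d) (fun=> k) by rewrite rint_cst//; ring.
  apply: le_rint; [exact: ib_cst|exact: ib_J|move=> y /andP[y1 y2]].
  have rr : s <= r <= t by rewrite sr.
  have yy : x0 - c * (r - s) <= y <= x0 - c * (r - s) + 2 * d.
    by rewrite -/xi (le_trans x1 y1) (le_trans y2)// (le_trans (lerD x2 (lexx d)))//; lrd.
  have [k1 k2] := h r y Gr rr yy.
  have q0 : 0 <= 1 + q r y ^+ 2 by rewrite addr_ge0 ?sqr_ge0.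
  have : 0 <= (u r y ^+ 2 - c) * (1 + q r y ^+ 2) by rewrite mulr_ge0 // subr_ge0.
  by rewrite /J; lra.
Qed.

End DoubleWindow.

(** * Characteristics *)

Lemma small_multiple_eq0 (R : realType) (x K : R) :
  (forall e, 0 < e -> e <= 1 -> `|x| <= e * K) -> x = 0.
Proof.
move=> h; apply/eqP; rewrite -normr_le0 leNgt; apply/negP => x0.
have K0 : 0 < K.
  by have := h 1 ltr01 (lexx _); rewrite mul1r => /(lt_le_trans x0).
pose e := Num.min 1 (`|x| / (2 * K)).
have e0 : 0 < e by rewrite lt_min ltr01 divr_gt0// mulr_gt0.
have e1 : e <= 1 by rewrite ge_min lexx.
have e2 : e <= `|x| / (2 * K) by rewrite ge_min lexx orbT.
have := h e e0 e1.
rewrite ler_pdivlMr ?mulr_gt0// in e2.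
by nra.
Qed.

Section Characteristics.
Context {R : realType} {u q H Y : R -> R -> R} {wb P M : R} {G : R -> Prop}.
Context (S : good_solution u q H Y wb P M G).
Local Notation mu := (@lebesgue_measure R).
Local Notation X := (invY S).

(** Both [a + b] and [2 * wb] are at most [2 * M] in absolute value, whence the tolerance
    [e / (2 * M)]. *)
Lemma u2wb_close a b e : 0 <= e -> `|a| <= M -> `|b| <= M -> `|a - b| <= e / (2 * M) ->
  [/\ a ^+ 2 <= b ^+ 2 + e, b ^+ 2 - e <= a ^+ 2,
      - (2 * wb * a) <= - (2 * wb * b) + e & - (2 * wb * b) - e <= - (2 * wb * a)].
Proof.
move=> e0 aM bM ab; have M1 := gs_M1 S; have wM := gs_bw S.
have k z : `|z| <= 2 * M -> `|(a - b) * z| <= e.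
  move=> zM; rewrite normrM.
  apply: (@le_trans _ _ (e / (2 * M) * (2 * M))); first by rewrite ler_pM.
  by rewrite divfK//; lra.
have k1 : `|(a - b) * (a + b)| <= e.
  by apply: k; apply: (le_trans (ler_normD _ _)); lra.
have k2 : `|(a - b) * (2 * wb)| <= e.
  by apply: k; rewrite normrM ger0_norm//; lra.
move: k1 k2; rewrite !ler_norml => /andP[? ?] /andP[? ?]; split; nra.
Qed.

(** For a short time [u] stays within [e / (2 * M)] of its value at the foot [(s, x0)] along the
    nearby lines. So the speeds [u^2 + e] and [u^2 - e] qualify for the upper and lower barriers,
    with the label rates [- 2 wb u + e] and [- 2 wb u - e]. *)
Lemma barrier e : 0 < e -> e <= 1 -> exists2 eta, 0 < eta &
  forall s t x0, G s -> G t -> s <= t -> t - s < eta ->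
  Y t (x0 - (u s x0 ^+ 2 + e) * (t - s)) <= Y s x0 + (- (2 * wb * u s x0) + e) * (t - s) /\
  Y s x0 + (- (2 * wb * u s x0) - e) * (t - s) <= Y t (x0 - (u s x0 ^+ 2 - e) * (t - s)).
Proof.
move=> e0 e1; have M1 := gs_M1 S.
have M2 : 0 <= M ^+ 2 by exact: sqr_ge0.
have e4 : 0 < e / (4 * M) by rewrite divr_gt0//; lra.
have [ds /andP[ds0 ds1] Ds] := u_space_modulus S e4.
have [dt_ dt0 Dt] := u_time_modulus S e4.
(* The speeds are at most [M ^+ 2 + 1], so a line moves by less than [ds / 2]; the window, of width
   [2 * d <= ds / 2], uses the other half. *)
exists (Num.min dt_ (ds / (2 * (M ^+ 2 + 1)))).
  by rewrite lt_min dt0 divr_gt0//; lra.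
move=> s t x0 Gs Gt st; rewrite lt_min ltr_pdivlMr; last by lra.
move=> /andP[ts1 ts2].
have cl c d r x : 0 < d -> 4 * d <= ds -> `|c| <= M ^+ 2 + 1 ->
    G r -> s <= r <= t -> x0 - c * (r - s) <= x <= x0 - c * (r - s) + 2 * d ->
    `|u r x - u s x0| <= e / (2 * M).
  move=> d0 dds cM Gr /andP[sr rt] /andP[x1 x2].
  have h1 : `|u r x - u s x| <= e / (4 * M).
    by apply: Dt => //; rewrite ger0_norm; lra.
  have h2 : `|u s x - u s x0| <= e / (4 * M).
    apply: Ds; move: cM; rewrite !ler_norml => /andP[c1 c2]; apply/andP; split; nra.
  have -> : u r x - u s x0 = (u r x - u s x) + (u s x - u s x0) by ring.
  apply: (le_trans (ler_normD _ _)); apply: (le_trans (lerD h1 h2)).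
  by rewrite (_ : e / (4 * M) + e / (4 * M) = e / (2 * M))//; field; lra.
have aM : u s x0 ^+ 2 <= M ^+ 2 by have := u2_le S s x0; rewrite ger0_norm ?sqr_ge0.
have a0 : 0 <= u s x0 ^+ 2 by exact: sqr_ge0.
have d1 d : 4 * d <= ds -> d <= 1 by lra.
split; apply/ler_addgt0Pr => z z0.
(* The shift by [2 * d] is removed by continuity of [Y] at the single time [s]; in the lower bound
   the shift sits at time [t]. *)
- have [dz dz0 Dz] := Y_modulus S s x0 z0.
  pose d := Num.min (ds / 4) (dz / 4).
  have d0 : 0 < d by rewrite lt_min !divr_gt0.
  have /andP[dd1 dd2] : (d <= ds / 4) && (d <= dz / 4) by rewrite -le_min.
  have h := @barrier_upper _ _ _ _ _ _ _ _ _ S d d0 (d1 d (ltac:(lra)))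
    (u s x0 ^+ 2 + e) (- (2 * wb * u s x0) + e) s t x0 Gs Gt st.
  have := Dz x0 (x0 + 2 * d) (ltac:(lra)) (ltac:(lra)) (ltac:(lra)) (ltac:(lra)).
  move=> hz; apply: (le_trans (h _)); last by lra.
  move=> r x Gr rr xx.
    have c := @cl (u s x0 ^+ 2 + e) d r x d0 (ltac:(lra)) _ Gr rr xx.
    have [] := @u2wb_close (u r x) (u s x0) e (ltW e0) (gs_bu S _ _) (gs_bu S _ _) (c _) => //.
    by rewrite ger0_norm; lra.
- have [dz dz0 Dz] := Y_modulus S t (x0 - (u s x0 ^+ 2 - e) * (t - s)) z0.
  pose d := Num.min (ds / 4) (dz / 4).
  have d0 : 0 < d by rewrite lt_min !divr_gt0.
  have /andP[dd1 dd2] : (d <= ds / 4) && (d <= dz / 4) by rewrite -le_min.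
  have h := @barrier_lower _ _ _ _ _ _ _ _ _ S d d0 (d1 d (ltac:(lra)))
    (u s x0 ^+ 2 - e) (- (2 * wb * u s x0) - e) s t x0 Gs Gt st.
  set l := x0 - _ * (t - s) in h Dz *.
  have := Dz l (l + 2 * d) (ltac:(lra)) (ltac:(lra)) (ltac:(lra)) (ltac:(lra)).
  move=> hz; suff hh : Y s x0 + (- (2 * wb * u s x0) - e) * (t - s) <= Y t (l + 2 * d) by lra.
  apply: h.
  move=> r x Gr rr xx.
    have c := @cl (u s x0 ^+ 2 - e) d r x d0 (ltac:(lra)) _ Gr rr xx.
    have [] := @u2wb_close (u r x) (u s x0) e (ltW e0) (gs_bu S _ _) (gs_bu S _ _) (c _) => //.
    by rewrite ler_norml; apply/andP; split; lra.
Qed.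

End Characteristics.

(** * Label curves are characteristics *)

Section AlongCharacteristics.
Context {R : realType} {u q H Y : R -> R -> R} {wb P M : R} {G : R -> Prop}.
Context (S : good_solution u q H Y wb P M G).
Local Notation mu := (@lebesgue_measure R).
Local Notation X := (invY S).

(** [X t] is 1-Lipschitz: an error [c] in the label costs at most [c] in the position. *)
Lemma le_invYD t x y c : 0 <= c -> Y t x <= y + c -> x <= X t y + c.
Proof.
move=> c0 h; have yc : y <= y + c by lra.
have := invY_lip S t yc; rewrite -(invY_le S) in h; lra.
Qed.

Lemma invY_leD t x y c : 0 <= c -> y <= Y t x + c -> X t y <= x + c.
Proof.
move=> c0 h; have yc : y - c <= y by lra.
have := invY_lip S t yc; rewrite -lerBlDr -(le_invY S) in h; lra.
Qed.

(* The label moves because [1 + u_x^2] is conserved only up to the source [- 2 wb u_x];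
   the curve [invY t (y t)] is then a characteristic of the equation. *)
Definition label_curve (s0 t0 : R) (y : R -> R) : Prop :=
  [/\ 0 <= s0, measurable_fun setT y &
     forall s t, s0 <= s -> s <= t -> t <= t0 ->
       y t - y s = - (2 * wb) * rint s t (fun r => u r (X r (y r)))].

Section Curve.
Context (s0 t0 : R) (y : R -> R) (Hy : label_curve s0 t0 y).
Let xi r := X r (y r).
Let v r := u r (xi r).

Let mxi : measurable_fun setT xi.
Proof. have [_ my _] := Hy; exact: (mfun_comp2 (measurable_invY S)). Qed.

Let mv : measurable_fun setT v.
Proof. exact: (mfun_comp2 (gs_mu S)). Qed.

Let ib_v s t : ib s t v.
Proof. by apply: (@ib_bounded _ _ _ M) => //; apply: ae_all => r _; exact: gs_bu S _ _. Qed.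

Let aeG : {ae mu, forall r, s0 <= r <= t0 -> G r}.
Proof.
have [s00 _ _] := Hy.
by move: (gs_Gae S); apply: ae_imp => r Gr /andP[sr _]; apply: Gr; exact: le_trans sr.
Qed.

Lemma label_lip s t : s0 <= s -> s <= t -> t <= t0 -> `|y t - y s| <= 2 * M ^+ 2 * (t - s).
Proof.
have [s00 _ h] := Hy => s0s st tt0; rewrite h// normrM normrN normrM ger0_norm//.
have M0 := gs_M0 S.
have hv : `|rint s t v| <= M * (t - s).
  by apply: rint_bound => // r _; exact: gs_bu S _ _.
rewrite -mulrA -[leRHS]mulrA ler_pM2l// [M ^+ 2]expr2 -mulrA.
by rewrite ler_pM// (gs_bw S).
Qed.

(** [M^2 + 1] is the barrier speed for [e = 1]. The remaining [4 M^2 + 1] is the label error: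
    [2 M^2] from the motion of the label and [2 M^2 + 1] from the barrier. *)
Let Cxi := 5 * M ^+ 2 + 2.

(** The barriers with [e = 1]. This crude bound keeps the curve where [u] varies little, which the
    sharp estimate in [char_eq] presupposes. *)
Lemma char_lip s t : G s -> G t -> s0 <= s -> s <= t -> t <= t0 ->
  `|xi t - xi s| <= Cxi * (t - s).
Proof.
move=> Gs Gt s0s st tt0; rewrite mulrBr.
have [eta eta0 B] := barrier S ltr01 (lexx 1).
apply: (@local_to_global _ G s0 t0 eta xi (fun r => Cxi * r) eta0) => //.
  by move=> s' t'; exact: ae_dense aeG.
move=> s' t' Gs' Gt' s0s' st' tt0' ts'; have st'' := ltW st'.
rewrite -mulrBr.
have [b1 b2] := B s' t' (xi s') Gs' Gt' st'' ts'.
have L := label_lip s0s' st'' tt0'.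
rewrite invYK in b1 b2.
set a := u s' (xi s') in b1 b2.
have aM : a ^+ 2 <= M ^+ 2 by have := u2_le S s' (xi s'); rewrite ger0_norm ?sqr_ge0.
have a0 : 0 <= a ^+ 2 by exact: sqr_ge0.
have wa : `|2 * wb * a| <= 2 * M ^+ 2.
  rewrite normrM normrM ger0_norm// -mulrA ler_pM2l// expr2 ler_pM// ?(gs_bw S)//.
  exact: gs_bu S _ _.
set D := t' - s' in b1 b2 L *; have D0 : 0 <= D by rewrite subr_ge0.
move: L wa; rewrite !ler_norml => /andP[L1 L2] /andP[w1 w2].
have c0 : 0 <= (4 * M ^+ 2 + 1) * D by rewrite mulr_ge0//; have := sqr_ge0 M; lra.
have M2 := sqr_ge0 M.
have h1 : xi s' - (a ^+ 2 + 1) * D <= xi t' + (4 * M ^+ 2 + 1) * D.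
  apply: le_invYD => //; apply: (le_trans b1); nra.
have h2 : xi t' <= xi s' - (a ^+ 2 - 1) * D + (4 * M ^+ 2 + 1) * D.
  by apply: invY_leD => //; apply: le_trans (lerD b2 (lexx _)); nra.
by rewrite /Cxi; apply/andP; split; nra.
Qed.

(** The label moves by [- 2 wb] times the integral of [v], which agrees to first order with the
    change of [Y] along the barrier lines; both barriers then pin the position to [- v^2] times the
    elapsed time. *)
Lemma char_eq s t : G s -> G t -> s0 <= s -> s <= t -> t <= t0 ->
  xi t - xi s = - rint s t (fun r => v r ^+ 2).
Proof.
move=> Gs Gt s0s st tt0.
have M1 := gs_M1 S; have M2 := sqr_ge0 M; have wM := gs_bw S.
have mv2 : measurable_fun setT (fun r => v r ^+ 2) by exact: measurable_funX.
have iv2 s' t' : ib s' t' (fun r => v r ^+ 2).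
  by apply: (@ib_bounded _ _ _ (M ^+ 2)) => //; apply: ae_all => r _; exact: u2_le S _ _.
pose Psi r := xi r + rint s0 r (fun r => v r ^+ 2).
suff H0 : Psi t - Psi s = 0.
  by move: H0; rewrite /Psi (rint_cat s0s st)//; lra.
(* [3 = 1 + 1 + 1 / 2 + 1 / 2]: the slope and the label rate of the barrier, and the errors [I1] and
   [I2] of freezing [v] in the two integrals. *)
apply: (@small_multiple_eq0 _ _ (3 * (t - s))) => e e0 e1.
have -> : e * (3 * (t - s)) = 3 * e * t - 3 * e * s by ring.
have [eta eta0 B] := barrier S e0 e1.
have e8 : 0 < e / (4 * M) / 2 by rewrite !divr_gt0//; lra.
have [ds /andP[ds0 ds1] Ds] := u_space_modulus S e8.
have [dt_ dt0 Dt] := u_time_modulus S e8.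
have C0 : 0 < Cxi by rewrite /Cxi; lra.
pose d := Num.min eta (Num.min dt_ (ds / Cxi)).
have d0 : 0 < d by rewrite !lt_min eta0 dt0 divr_gt0.
apply: (@local_to_global _ G s0 t0 d Psi (fun r => 3 * e * r) d0) => //.
  by move=> s' t'; exact: ae_dense aeG.
move=> s' t' Gs' Gt' s0s' st' tt0'; rewrite !lt_min ltr_pdivlMr// => /and3P[ts1 ts2 ts3].
have st'' := ltW st'.
have [b1 b2] := B s' t' (xi s') Gs' Gt' st'' ts1.
rewrite invYK in b1 b2.
have close r : G r -> s' <= r <= t' -> `|v r - v s'| <= e / (2 * (2 * M)).
  move=> Gr /andP[r1 r2].
  have rt0 := le_trans r2 tt0'.
  have h1 : `|u r (xi r) - u s' (xi r)| <= e / (4 * M) / 2.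
    by apply: Dt => //; rewrite ger0_norm; lra.
  have h2 : `|u s' (xi r) - u s' (xi s')| <= e / (4 * M) / 2.
    apply: Ds; apply: (le_trans (char_lip Gs' Gr s0s' r1 rt0)); nra.
  have -> : v r - v s' = (u r (xi r) - u s' (xi r)) + (u s' (xi r) - u s' (xi s')).
    by rewrite /v; ring.
  apply: (le_trans (ler_normD _ _)); apply: (le_trans (lerD h1 h2)).
  by rewrite (_ : e / (4 * M) / 2 + e / (4 * M) / 2 = e / (2 * (2 * M)))//; field; lra.
have aeG' : {ae mu, forall r, s' <= r <= t' -> G r}.
  move: aeG; apply: ae_imp => r Gr /andP[r1 r2]; apply: Gr.
  by rewrite (le_trans s0s' r1) (le_trans r2 tt0').
have I1 : `|rint s' t' (fun r => v r ^+ 2 - v s' ^+ 2)| <= e / 2 * (t' - s').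
  apply: rint_bound_ae => //; first by apply: measurable_funB.
  move: aeG'; apply: ae_imp => r Gr rr.
  have c := close r (Gr rr) rr; rewrite invfM mulrA in c.
  have [h1 h2 _ _] := u2wb_close S (ltW (divr_gt0 e0 (ltr0Sn R 1))) (gs_bu S r (xi r)) (gs_bu S s' (xi s')) c.
  by rewrite ler_norml; apply/andP; split; rewrite /v; lra.
have I2 : `|rint s' t' (fun r => 2 * wb * v r - 2 * wb * v s')| <= e / 2 * (t' - s').
  apply: rint_bound_ae => //.
    by apply: measurable_funB; [apply: measurable_funM|].
  move: aeG'; apply: ae_imp => r Gr rr.
  have c := close r (Gr rr) rr; rewrite invfM mulrA in c.
  have [_ _ h1 h2] := u2wb_close S (ltW (divr_gt0 e0 (ltr0Sn R 1))) (gs_bu S r (xi r)) (gs_bu S s' (xi s')) c.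
  by rewrite ler_norml; apply/andP; split; rewrite /v; lra.
rewrite rintB ?rint_cst// in I1; last exact: ib_cst.
rewrite rintB ?rint_cst// ?rintZ// in I2; [|by apply: ibZ|exact: ib_cst].
have [_ _ hy] := Hy.
have L : y t' - y s' = - (2 * wb) * rint s' t' v := hy s' t' s0s' st'' tt0'.
rewrite -/(v s') in b1 b2.
rewrite /Psi (rint_cat s0s' st'')//.
move: L I1 I2 b1 b2.
have -> : 3 * e * t' - 3 * e * s' = 3 * (e * (t' - s')) by ring.
set D := t' - s'; have D0 : 0 <= D by rewrite subr_ge0.
clearbody D; move: (v s') (rint s0 s' _) (rint s' t' (fun r => v r ^+ 2)) (rint s' t' v) => a r0 r1 r2 L I1 I2 b1 b2.
move: I1 I2; rewrite !ler_norml => /andP[i1 i2] /andP[i3 i4].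
have eD : 0 <= e * D by rewrite mulr_ge0// ltW.
have h1 : xi s' - (a ^+ 2 + e) * D <= xi t' + (e * D + e / 2 * D).
  apply: le_invYD; first lra.
  apply: (le_trans b1); lra.
have h2 : xi t' <= xi s' - (a ^+ 2 - e) * D + (e * D + e / 2 * D).
  apply: invY_leD; first lra.
  by apply: le_trans (lerD b2 (lexx _)); lra.
by apply/andP; split; lra.
Qed.

End Curve.
End AlongCharacteristics.

(** * The values of the solution along characteristics *)

Section VelocityAlongCharacteristics.
Context {R : realType} {u q H Y : R -> R -> R} {wb P M : R} {G : R -> Prop}.
Context (S : good_solution u q H Y wb P M G).
Local Notation mu := (@lebesgue_measure R).
Local Notation X := (invY S).

Lemma ib_uq2 t a b : ib a b (fun x => u t x - u t x * q t x ^+ 2).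
Proof.
apply: ibB; first exact: ib_u S _ _ _.
rewrite (_ : (fun _ => _) = (fun x => q t x ^+ 2 * u t x)); last first.
  by apply/funext => x; rewrite mulrC.
apply: (@ibM _ _ _ M); [exact: gs_q2 S _ _ _|exact: gs_mus S _|].
by apply: ae_all => x _; exact: gs_bu S _ _.
Qed.

Lemma rint_uq2_le t a b : a <= b ->
  `|rint a b (fun x => u t x - u t x * q t x ^+ 2)| <= M * (Y t b - Y t a).
Proof.
move=> ab; rewrite -(rint_dens S)// -rintZ; last exact: ib_dens S _ _ _.
apply: rint_norm_le; first by have [] := ib_uq2 t a b.
  by apply: ibZ; exact: ib_dens S _ _ _.
move=> x _; have -> : u t x - u t x * q t x ^+ 2 = u t x * (1 - q t x ^+ 2) by ring.
rewrite normrM ler_pM ?(gs_bu S)// ler_norml; have := sqr_ge0 (q t x) => q0.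
by apply/andP; split; lra.
Qed.

Lemma dH_le t a b : G t -> 0 < t -> a <= b -> `|H t b - H t a| <= 2 * M * (Y t b - Y t a).
Proof.
move=> Gt t0 ab; rewrite (gs_H S)//; have h1 := rint_uq2_le t ab.
have h2 : `|wb * (b - a)| <= M * (Y t b - Y t a).
  rewrite normrM ler_pM ?(gs_bw S)// ger0_norm ?subr_ge0//; exact: dY_ge S _ _ _ ab.
by apply: (le_trans (ler_normB _ _)); lra.
Qed.

(** Uniform in time, in contrast with [Y]: the flux is linear in [q], and integrals of [|q|] are
    controlled by the square root of the length. Hence a single window is enough for [u]. *)
Lemma fluxu_modulus e : 0 < e -> exists2 d, 0 < d & forall r a b, a <= b -> b - a < d ->
  rint a b (fun x => `|fluxu (u := u) (q := q) (H := H) r x|) <= e.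
Proof.
move=> e0; have M1 := gs_M1 S; have M2 := sqr_ge0 M.
have M2' : 0 < M ^+ 2 by rewrite exprn_gt0//; lra.
have Mn0 : M != 0 by rewrite gt_eqF//; lra.
pose e1 := e / (2 * M ^+ 2).
have e10 : 0 < e1 by rewrite divr_gt0// mulr_gt0.
exists (Num.min 1 (Num.min (e1 ^+ 2 / M) (e / (2 * M)))).
  have Mp : 0 < M by lra.
  have e12 : 0 < e1 ^+ 2 by exact: exprn_gt0.
  have M20 : 0 < 2 * M by lra.
  by rewrite !lt_min ltr01 (divr_gt0 e12 Mp) (divr_gt0 e0 M20).
move=> r a b ab; rewrite !lt_min !ltr_pdivlMr; [|lra|lra].
move=> /and3P[h1 h2 h3]; apply: (le_trans (fluxu_le S r ab)).
have := absq_modulus S r (ltW e10) ab (ltW h1) (ltW h2).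
rewrite -(ler_pM2l M2') (_ : M ^+ 2 * e1 = e / 2); last by rewrite /e1; field.
by lra.
Qed.

Section Curve.
Context (s0 t0 : R) (y : R -> R) (Hy : label_curve S s0 t0 y).
Let xi r := X r (y r).
Let v r := u r (xi r).

Let mxi : measurable_fun setT xi.
Proof. have [_ my _] := Hy; exact: (mfun_comp2 (measurable_invY S)). Qed.

Let mv : measurable_fun setT v.
Proof. exact: (mfun_comp2 (gs_mu S)). Qed.

Let aeG : {ae mu, forall r, s0 <= r <= t0 -> G r}.
Proof.
have [s00 _ _] := Hy.
by move: (gs_Gae S); apply: ae_imp => r Gr /andP[sr _]; apply: Gr; exact: le_trans sr.
Qed.

(** The rate of change of the integral of [u] over a window carried by the curve: the velocity
    [- v^2] of the window contributes [- v^2 q]. *)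
Let flux_window d r a :=
  rint a (a + d) (fun x => (u r x ^+ 2 - v r ^+ 2) * q r x + H r x).

Let ib_uvq r a b : ib a b (fun x => (u r x ^+ 2 - v r ^+ 2) * q r x).
Proof.
rewrite (_ : (fun _ => _) = (fun x => q r x * (u r x ^+ 2 - v r ^+ 2))); last first.
  by apply/funext => x; rewrite mulrC.
apply: (@ibM _ _ _ (M ^+ 2 + M ^+ 2)); first exact: ib_q S _ _ _.
  by apply: measurable_funB => //; apply: measurable_funX; exact: gs_mus S _.
apply: ae_all => x _; apply: (le_trans (ler_normB _ _)).
by apply: lerD; exact: u2_le S _ _.
Qed.

Let mfw d : measurable_fun setT (fun r => flux_window d r (xi r)).
Proof.
apply: (@measurable_rint_param _ _ _ (fun r x => (u r x ^+ 2 - v r ^+ 2) * q r x + H r x)) => //.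
  apply: measurable_funD; last exact: gs_mH S.
  apply: measurable_funM; last exact: gs_mq S.
  apply: measurable_funB; first by apply: measurable_funX; exact: gs_mu S.
  by apply: measurable_funX; exact: (measurableT_comp mv measurable_fst).
by apply: measurable_funD.
Qed.

Let window_chain d s t : 0 < d -> d <= 1 -> G s -> G t -> s0 <= s -> s <= t -> t <= t0 ->
  rint (xi t) (xi t + d) (u t) - rint (xi s) (xi s + d) (u s) =
  rint s t (fun r => flux_window d r (xi r)).
Proof.
move=> d0 d1 Gs Gt s0s st tt0.
have M1 := gs_M1 S; have M2 := sqr_ge0 M.
have M3 : 0 <= M ^+ 3 by rewrite exprn_ge0//; lra.
pose Gf r a := rint a (a + d) (fluxu (u := u) (q := q) (H := H) r).
pose Fa r a := u r (a + d) - u r a.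
have mG : measurable_fun setT (fun p : R * R => Gf p.1 p.2).
  apply: (@measurable_rint_param _ _ _ (fun (p : R * R) y => fluxu (u := u) (q := q) (H := H) p.1 y)
    snd (fun p => p.2 + d)).
  - apply: (mfun_comp2 (measurable_fluxu S)) => //.
    exact: (measurableT_comp measurable_fst measurable_fst).
  - exact: measurable_snd.
  - by apply: measurable_funD => //; exact: measurable_snd.
have C0 : 0 <= M ^+ 3 + M ^+ 2 + 2 * M by lra.
have key : rint (xi t) (xi t + d) (u t) - rint (xi s) (xi s + d) (u s) =
    rint s t (fun r => Gf r (xi r) + - v r ^+ 2 * Fa r (xi r)).
  apply: (@chain_rule R G s0 t0 (M ^+ 3 + M ^+ 2 + 2 * M) (fun t a => rint a (a + d) (u t))
    Fa Gf xi (fun r => - v r ^+ 2) C0).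
  - exact: aeG.
  - by move=> s' t' a Gs' Gt' _ st' _; apply: (window_u S) => //; lra.
  - move=> e e0.
    have [ds /andP[ds0 ds1] Ds] := u_space_modulus S (divr_gt0 e0 (ltr0Sn R 1)).
    exists ds => // r a b _ _ ba.
    have -> : e = 2 * (e / 2) by field.
    apply: rint_window_diff; [exact: ib_u S _|exact: ltW|].
    by move=> x z xz; apply: Ds; apply: (le_trans xz); exact: ltW.
  - move=> e e0; have e4 : 0 < e / 4 by rewrite divr_gt0.
    have [ds /andP[ds0 ds1] Ds] := u_space_modulus S e4.
    have [dt_ dt0 Dt] := u_time_modulus S e4.
    exists (Num.min ds dt_); first by rewrite lt_min ds0.
    move=> s' t' a b Gs' Gt' _ _; rewrite !lt_min => /andP[h1 _] /andP[_ h2].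
    have k1 := Ds t' a b (ltW h1).
    have k2 : `|u t' (b + d) - u t' (a + d)| <= e / 4.
      by apply: Ds; rewrite (_ : b + d - (a + d) = b - a); [exact: ltW|ring].
    have k3 := Dt s' t' a Gs' Gt' (ltW h2).
    have k4 := Dt s' t' (a + d) Gs' Gt' (ltW h2).
    move: k1 k2 k3 k4; rewrite /Fa !ler_norml => /andP[? ?] /andP[? ?] /andP[? ?] /andP[? ?].
    by apply/andP; split; lra.
  - move=> e e0; have [dd dd0 D] := fluxu_modulus (divr_gt0 e0 (ltr0Sn R 1)).
    exists dd => // r a b _ _.
    wlog ab : a b / a <= b.
      move=> W; case: (leP a b) => [|/ltW] ab; first exact: W.
      by rewrite distrC (distrC (Gf r b)); exact: W.
    rewrite ger0_norm ?subr_ge0// => ba.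
    rewrite /Gf (rint_window (ib_fluxu S r) (ltW d0) ab).
    apply: (le_trans (ler_normB _ _)).
    have k1 := le_trans (rint_norm (ib_fluxu S r _ _)) (D r a b ab ba).
    have abd : a + d <= b + d by lra.
    have bad : b + d - (a + d) < dd by lra.
    have k2 := le_trans (rint_norm (ib_fluxu S r _ _)) (D r _ _ abd bad).
    by lra.
  - move=> s' t' Gs' Gt' s0s' st' tt0'.
    rewrite (char_eq Hy)//; rewrite rintN//.
    apply: (@ib_bounded _ _ _ (M ^+ 2)); first exact: measurable_funX.
    by apply: ae_all => r _; exact: u2_le S _ _.
  - by move=> r; rewrite normrN; apply: (le_trans (u2_le S _ _)); lra.
  - by apply: measurableT_comp => //; exact: measurable_funX.
  - by move=> a; exact: mfun_sec2 mG.
  - exact: (mfun_comp2 mG).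
  - apply: measurable_funB => //; apply: (mfun_comp2 (gs_mu S)) => //.
    exact: measurable_funD.
  - move=> r a _ _; apply: (le_trans (rint_norm (ib_fluxu S r _ _))).
    by apply: (le_trans (fluxu_le1 S r _ _)); lra.
  - move=> r a _ _; apply: (le_trans (ler_normB _ _)).
    have := gs_bu S r (a + d); have := gs_bu S r a; lra.
  - exact: Gs.
  - exact: Gt.
  - exact: s0s.
  - exact: st.
  - exact: tt0.
rewrite key; apply: eq_rint => r _.
have xd : xi r <= xi r + d by lra.
rewrite /Fa (gs_u S)// -rintZ; last exact: ib_q S _ _ _.
rewrite /Gf -rintD; [|exact: ib_fluxu S _ _ _|by apply: ibZ; exact: ib_q S _ _ _].
by apply: eq_rint => x _; rewrite /fluxu; ring.
Qed.

(** On the window [|u^2 - v^2|] is at most [2 M] times the integral [B] of [|q|], so the defect is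
    at most [2 M B^2]. By Cauchy-Schwarz [B^2] carries a factor [d], and after division by [d] the
    increment of [Y] over the window is left, which tends to [0]. *)
Let defect_le d r : 0 < d -> d <= 1 ->
  `|rint (xi r) (xi r + d) (fun x => (u r x ^+ 2 - v r ^+ 2) * q r x)| <=
  2 * M * d * (Y r (xi r + d) - Y r (xi r)).
Proof.
move=> d0 d1; have M0 := gs_M0 S; have xd : xi r <= xi r + d by lra.
set B := rint (xi r) (xi r + d) (fun x => `|q r x|).
have BB : B ^+ 2 <= d * (Y r (xi r + d) - Y r (xi r)).
  have := absq_sqr S r xd; rewrite -/B (_ : xi r + d - xi r = d)//; ring.
have B0 : 0 <= B by apply: rint_ge0.
apply: (@le_trans _ _ (2 * M * B * B)); last first.
  have -> : 2 * M * B * B = 2 * M * B ^+ 2 by ring.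
  have -> : 2 * M * d * (Y r (xi r + d) - Y r (xi r)) = 2 * M * (d * (Y r (xi r + d) - Y r (xi r))) by ring.
  by rewrite ler_wpM2l// mulr_ge0.
rewrite -[X in _ <= X](rintZ (2 * M * B)); last exact/ib_norm/(ib_q S).
apply: rint_norm_le; first by have [] := ib_uvq r 0 0.
  by apply: ibZ; exact/ib_norm/(ib_q S).
move=> x /andP[x1 x2]; rewrite normrM ler_wpM2r//.
have -> : u r x ^+ 2 - v r ^+ 2 = (u r x + v r) * (u r x - v r) by ring.
rewrite normrM ler_pM//.
  by apply: (le_trans (ler_normD _ _)); have := gs_bu S r x; have := gs_bu S r (xi r); rewrite /v; lra.
apply: (le_trans (du_absq S r x1)).
have iq : ib (xi r) (xi r + d) (fun x => `|q r x|) by exact/ib_norm/(ib_q S).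
rewrite /B (rint_cat x1 x2 iq) lerDl; exact: rint_ge0.
Qed.

(** The window identity is divided by the width [d n], which tends to [0]. On the right the limit is
    first taken at each time separately, because the modulus of [Y] depends on the time, and then
    under the integral by domination. *)
Lemma char_velocity s t : G s -> G t -> s0 <= s -> s <= t -> t <= t0 ->
  v t - v s = rint s t (fun r => H r (xi r)).
Proof.
move=> Gs Gt s0s st tt0; have M0 := gs_M0 S.
have [s00 _ _] := Hy.
pose d (n : nat) : R := n.+1%:R^-1.
have d0 n : 0 < d n by rewrite invr_gt0.
have d1 n : d n <= 1 by rewrite invf_le1 ?ltr0n// ler1n.
have dcvg : d @ \oo --> 0 by exact: cvg_harmonic.
pose In n r := (d n)^-1 * flux_window (d n) r (xi r).
pose Ln n := (d n)^-1 * (rint (xi t) (xi t + d n) (u t) - rint (xi s) (xi s + d n) (u s)).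
have mHx : measurable_fun setT (fun r => H r (xi r)) by exact: (mfun_comp2 (gs_mH S)).
have avg (f : R -> R) x n e : measurable_fun setT f -> (forall z, `|f z| <= M) ->
    (forall z, x <= z <= x + d n -> `|f z - f x| <= e) ->
    `|f x - (d n)^-1 * rint x (x + d n) f| <= e.
  move=> mf fM fe; have xd : x <= x + d n by have := d0 n; lra.
  have dn0 : (d n) != 0 by rewrite gt_eqF.
  have -> : f x = (d n)^-1 * rint x (x + d n) (fun=> f x).
    by rewrite rint_cst// (_ : x + d n - x = d n); [rewrite mulrCA mulVf// mulr1|ring].
  have fi : ib x (x + d n) f by apply: (@ib_bounded _ _ _ M) => //; exact: ae_all.
  rewrite -mulrBr -rintB//; last exact: ib_cst.
  rewrite normrM ger0_norm ?invr_ge0 ?(ltW (d0 n))// mulrC ler_pdivrMr//.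
  have h : `|rint x (x + d n) (fun z => f x - f z)| <= e * (x + d n - x).
    apply: rint_bound => //; first by apply: measurable_funB.
    by move=> z zz; rewrite distrC; exact: fe.
  by rewrite (_ : x + d n - x = d n) in h; [|ring].
have LI n : Ln n = rint s t (In n).
  rewrite /Ln window_chain// /In rintZ//.
  apply: (@ib_bounded _ _ _ (2 * M * d n * M + M * d n)); first exact: mfw.
  apply: ae_all => r _; rewrite /flux_window rintD; [|exact: ib_uvq|exact: ib_H S _ _ _].
  apply: (le_trans (ler_normD _ _)); apply: lerD.
    apply: (le_trans (defect_le r (d0 n) (d1 n))).
    rewrite ler_wpM2l ?mulr_ge0 ?(ltW (d0 n))//; apply: (dY_le1 S); have := d1 n; lra.
  have -> : M * d n = M * (xi r + d n - xi r) by ring.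
  apply: rint_bound; [have := d0 n; lra|exact: gs_mHs S _|].
  by move=> x _; exact: gs_bH S _ _.
have L1 : Ln @ \oo --> v t - v s.
  have one r : (fun n => (d n)^-1 * rint (xi r) (xi r + d n) (u r)) @ \oo --> v r.
    apply/cvgrPdist_le => e e0.
    have [ds /andP[ds0 ds1] Ds] := u_space_modulus S e0.
    have := dcvg; move/cvgrPdist_le => /(_ ds ds0).
    apply: filterS => n; rewrite sub0r normrN ger0_norm ?(ltW (d0 n))// => dn.
    apply: (avg (u r) (xi r) n e); [exact: gs_mus S _|exact: gs_bu S _|].
    by move=> z /andP[z1 z2]; apply: Ds; rewrite ger0_norm; lra.
  rewrite (_ : Ln = (fun n => (d n)^-1 * rint (xi t) (xi t + d n) (u t) -
    (d n)^-1 * rint (xi s) (xi s + d n) (u s))).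
    by apply: cvgB; exact: one.
  by apply/funext => n; rewrite /Ln mulrBr.
have L2 : (fun n => rint s t (In n)) @ \oo --> rint s t (fun r => H r (xi r)).
  apply: (@rint_dct _ _ _ _ _ (fun=> 2 * M * M + M)) => //.
  - by move=> n; apply: measurable_funM => //; exact: mfw.
  - exact: ib_cst.
  (* The increments of [H] are known at positive good times only. *)
  - have na : {ae mu, forall x : R, x != 0}.
      exists [set 0]; split; [exact: measurable_set1|exact: lebesgue_measure_set1|].
      by move=> x /= /negP; rewrite negbK => /eqP.
    move: aeG na; apply: ae_imp2 => r Gr rn0 /andP[r1 r2].
    have rr : s0 <= r <= t0 by rewrite (le_trans s0s r1) (le_trans r2 tt0).
    have {}Gr := Gr rr.
    have r0 : 0 < r by rewrite lt_neqAle eq_sym rn0 (gs_Gge S).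
    apply/cvgrPdist_le => e e0.
    have M4 : 0 < 4 * M + 1 by lra.
    have [dY dY0 DY] := Y_modulus S r (xi r) (divr_gt0 e0 M4).
    have dY1 : 0 < Num.min dY 1 by rewrite lt_min dY0 ltr01.
    have := dcvg; move/cvgrPdist_lt => /(_ _ dY1).
    apply: filterS => n; rewrite sub0r normrN ger0_norm ?(ltW (d0 n))// lt_min => /andP[dn1 dn2].
    have xd : xi r <= xi r + d n by have := d0 n; lra.
    have hY : Y r (xi r + d n) - Y r (xi r) <= e / (4 * M + 1) by apply: DY; lra.
    rewrite /In /flux_window rintD; [|exact: ib_uvq|exact: ib_H S _ _ _].
    have split3 (h i A B : R) : h - i * (A + B) = (h - i * B) - i * A by ring.
    rewrite split3.
    have A1 : `|(d n)^-1 * rint (xi r) (xi r + d n) (fun x => (u r x ^+ 2 - v r ^+ 2) * q r x)| <=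
        2 * M * (e / (4 * M + 1)).
      rewrite normrM ger0_norm ?invr_ge0 ?(ltW (d0 n))// mulrC ler_pdivrMr//.
      apply: (le_trans (defect_le r (d0 n) (d1 n))).
      have -> : 2 * M * (e / (4 * M + 1)) * d n = 2 * M * d n * (e / (4 * M + 1)) by ring.
      by rewrite ler_wpM2l// !mulr_ge0// ltW.
    have A2 : `|H r (xi r) - (d n)^-1 * rint (xi r) (xi r + d n) (H r)| <= 2 * M * (e / (4 * M + 1)).
      apply: (avg (H r) (xi r) n _); [exact: gs_mHs S _|exact: gs_bH S _|].
      move=> z /andP[z1 z2]; apply: (le_trans (dH_le Gr r0 z1)).
      rewrite ler_wpM2l ?mulr_ge0//; apply: le_trans hY.
      by rewrite lerD2r (Y_mono S).
    apply: (@le_trans _ _ (2 * M * (e / (4 * M + 1)) + 2 * M * (e / (4 * M + 1)))).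
      by apply: (le_trans (ler_normB _ _)); exact: lerD.
    have -> : 2 * M * (e / (4 * M + 1)) + 2 * M * (e / (4 * M + 1)) = e * (4 * M / (4 * M + 1)).
      by field; lra.
    by rewrite ler_piMr ?(ltW e0)// ler_pdivrMr; lra.
  - apply: ae_all => r _ n; rewrite /In /flux_window rintD; [|exact: ib_uvq|exact: ib_H S _ _ _].
    rewrite normrM ger0_norm ?invr_ge0 ?(ltW (d0 n))// mulrC ler_pdivrMr//.
    apply: (le_trans (ler_normD _ _)); rewrite mulrDl; apply: lerD.
      apply: (le_trans (defect_le r (d0 n) (d1 n))).
      have -> : 2 * M * M * d n = 2 * M * d n * M by ring.
      rewrite ler_wpM2l ?mulr_ge0 ?(ltW (d0 n))//; apply: (dY_le1 S); have := d1 n; lra.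
    have -> : M * d n = M * (xi r + d n - xi r) by ring.
    apply: rint_bound; [have := d0 n; lra|exact: gs_mHs S _|].
    by move=> x _; exact: gs_bH S _ _.
have EL : Ln = (fun n => rint s t (In n)) by apply/funext.
rewrite -EL in L2.
exact: cvg_unique L1 L2.
Qed.

End Curve.
End VelocityAlongCharacteristics.

(** * Picard iteration for the labels *)

Section LabelFlow.
Context {R : realType} {u q H Y : R -> R -> R} {wb P M : R} {G : R -> Prop}.
Context (S : good_solution u q H Y wb P M G).
Local Notation mu := (@lebesgue_measure R).
Local Notation X := (invY S).
Context (s tau : R) (s0 : 0 <= s) (tau0 : 0 < tau) (Mtau : M * tau <= 1 / 4).

Let U r y := u r (X r y).

Let mU : measurable_fun setT (fun p : R * R => U p.1 p.2).
Proof.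
by apply: (mfun_comp2 (gs_mu S)); [exact: measurable_fst|exact: measurable_invY S].
Qed.

Let U_le r y : `|U r y| <= M.
Proof. exact: gs_bu S _ _. Qed.

Lemma U_lip (r y z : R) : `|u r (X r z) - u r (X r y)| <= `|z - y| / 2.
Proof.
wlog yz : y z / y <= z.
  move=> W; case: (leP y z) => [|/ltW] yz; first exact: W.
  by rewrite distrC (distrC z); exact: W.
rewrite (ger0_norm (_ : 0 <= z - y)) ?subr_ge0//.
by have := du_le S r (invY_mono S r yz); rewrite !invYK.
Qed.

(** Clamping times to [[s, s + tau]] makes the estimates on the iterates valid for every real
    time. *)
Let clamp (r : R) : R := Num.max s (Num.min r (s + tau)).

Let clamp_in r : s <= clamp r <= s + tau.
Proof.
rewrite le_max lexx/= ge_max ge_min lexx orbT andbT.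
by have := tau0; lra.
Qed.

Let clampE r : s <= r <= s + tau -> clamp r = r.
Proof. by move=> /andP[r1 r2]; rewrite /clamp (min_idPl r2) (max_idPr r1). Qed.

Let mclamp : measurable_fun setT clamp.
Proof. by apply: measurable_maxr => //; apply: measurable_minr. Qed.

Let step (b : R) (y : R -> R) (r : R) : R := b - 2 * wb * rint s (clamp r) (fun r' => U r' (y r')).

Fixpoint picard (n : nat) (b : R) : R -> R :=
  if n is m.+1 then step b (picard m b) else fun=> b.

Let mstep b y : measurable_fun setT y -> measurable_fun setT (step b y).
Proof.
move=> my; apply: measurable_funB => //; apply: measurable_funM => //.
apply: (@measurable_rint_param _ _ _ (fun (r r' : R) => U r' (y r')) (fun=> s)) => //.
exact: (measurableT_comp (mfun_comp2 mU (@measurable_id _ _ setT) my) measurable_snd).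
Qed.

Let m_picard n b : measurable_fun setT (picard n b).
Proof. by elim: n => [|n IH] //=; exact: mstep. Qed.

Let mUy y : measurable_fun setT y -> measurable_fun setT (fun r => U r (y r)).
Proof. by move=> my; exact: (mfun_comp2 mU). Qed.

Let ib_Uy y a b : measurable_fun setT y -> ib a b (fun r => U r (y r)).
Proof.
by move=> my; apply: (@ib_bounded _ _ _ M); [exact: mUy|apply: ae_all => r _].
Qed.

(** The contraction factor is [2 M * (1 / 2) * tau = M * tau <= 1 / 4], where [1 / 2] is the
    Lipschitz constant of [u] in the label. *)
Let step_diff (b b' : R) (y z : R -> R) (K r : R) : measurable_fun setT y -> measurable_fun setT z ->
  (forall r, `|z r - y r| <= K) ->
  `|(step b' z r - b') - (step b y r - b)| <= K / 4.
Proof.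
move=> my mz yz; have M0 := gs_M0 S; have /andP[c1 c2] := clamp_in r.
have -> : step b' z r - b' - (step b y r - b) =
  - (2 * wb) * (rint s (clamp r) (fun r' => U r' (z r')) - rint s (clamp r) (fun r' => U r' (y r'))).
  by rewrite /step; ring.
rewrite -rintB; [|exact: ib_Uy|exact: ib_Uy].
have K0 : 0 <= K by apply: le_trans (yz 0).
have h : `|rint s (clamp r) (fun r' => U r' (z r') - U r' (y r'))| <= K / 2 * (clamp r - s).
  apply: rint_bound => //; first by apply: measurable_funB; exact: mUy.
  by move=> r' _; apply: (le_trans (U_lip _ _ _)); have := yz r'; lra.
rewrite normrM normrN normrM ger0_norm//.
apply: (@le_trans _ _ (2 * M * (K / 2 * tau))).
  rewrite ler_pM ?mulr_ge0 ?ler_wpM2l ?(gs_bw S)//.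
  by apply: (le_trans h); rewrite ler_wpM2l//; lra.
by have := Mtau; nra.
Qed.

Let picard_diff n b r : `|picard n.+1 b r - picard n b r| <= M / 2 ^+ n.
Proof.
have M0 := gs_M0 S.
elim: n r => [|n IH] r.
  rewrite expr0 divr1 /= /step addrAC subrr add0r normrN normrM normrM ger0_norm//.
  have /andP[c1 c2] := clamp_in r.
  have h : `|rint s (clamp r) (fun r' => U r' b)| <= M * (clamp r - s).
    by apply: rint_bound => //; exact: mUy.
  apply: (@le_trans _ _ (2 * M * (M * tau))).
    rewrite ler_pM ?mulr_ge0 ?ler_wpM2l ?(gs_bw S)//.
    by apply: (le_trans h); rewrite ler_wpM2l//; lra.
  by have := Mtau; nra.
have := step_diff b b r (m_picard n b) (m_picard n.+1 b) IH.
rewrite opprB addrA subrK => /le_trans; apply.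
have p0 : 0 < 2 ^+ n :> R by rewrite exprn_gt0.
rewrite exprS invfM mulrA -[M / 2 / _]mulrA; set z := _^-1.
have z0 : 0 <= (2 ^+ n)^-1 :> R by rewrite invr_ge0 ltW.
have -> : M / 2 ^+ n / 4 = M * (2 ^+ n)^-1 / 4 by [].
have h : 0 <= M * (2 ^+ n)^-1 by rewrite mulr_ge0.
by rewrite /z; nra.
Qed.

Let geo0 : (fun n => 2 * M / 2 ^+ n : R) @ \oo --> 0.
Proof.
rewrite -[X in _ --> X](mulr0 (2 * M)).
apply: cvgMl_tmp.
rewrite (_ : (fun n => _) = (fun n => (2^-1 : R) ^+ n)); last by apply/funext => n; rewrite exprVn.
by apply: cvg_expr; rewrite ger0_norm ?invf_lt1// ?ltr1n.
Qed.

Let picard_cvg b r : cvgn (fun n => picard n b r).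
Proof.
(* Adding the remaining sum of the geometric bounds [M / 2 ^+ n] turns the iterates into a
   nonincreasing sequence. *)
pose z n := picard n b r + 2 * M / 2 ^+ n.
have M0 := gs_M0 S.
have dz : {homo z : m n / (m <= n)%N >-> n <= m}.
  apply/nonincreasing_seqP => n; rewrite /z.
  have := picard_diff n b r; rewrite ler_norml => /andP[_ h].
  rewrite [2 ^+ n.+1]exprS invfM.
  have -> : 2 * M * (2^-1 * (2 ^+ n)^-1) = M / 2 ^+ n.
    by rewrite mulrA (mulrC 2) mulfK.
  have -> : 2 * M / 2 ^+ n = M / 2 ^+ n + M / 2 ^+ n by ring.
  lra.
have lz : has_lbound (range z).
  exists (b - 2 * M) => _ [n _ <-]; rewrite /z.
  suff : b - 2 * M + 2 * M / 2 ^+ n <= picard n b r.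
    have : 0 <= 2 * M / 2 ^+ n by rewrite divr_ge0 ?mulr_ge0// exprn_ge0.
    lra.
  elim: n => [|n IH]; first by rewrite expr0 divr1 subrK.
  have := picard_diff n b r; rewrite ler_norml => /andP[h _].
  rewrite [2 ^+ n.+1]exprS invfM.
  have -> : 2 * M * (2^-1 * (2 ^+ n)^-1) = M / 2 ^+ n.
    by rewrite mulrA (mulrC 2) mulfK.
  have E : 2 * M / 2 ^+ n = M / 2 ^+ n + M / 2 ^+ n by ring.
  rewrite E in IH; lra.
have zc := nonincreasing_is_cvgn dz lz.
rewrite (_ : (fun n => picard n b r) = (fun n => z n - 2 * M / 2 ^+ n)).
  by apply: is_cvgB => //; apply/cvg_ex; exists 0; exact: geo0.
by apply/funext => n; rewrite /z addrK.
Qed.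

Definition label_flow b r := lim ((fun n => picard n b r) @ \oo).

Let flow_cvg b r : (fun n => picard n b r) @ \oo --> label_flow b r.
Proof. exact: picard_cvg. Qed.

Let mflow b : measurable_fun setT (label_flow b).
Proof.
apply: (measurable_fun_cvg (fun n => m_picard n b)) => r _; exact: flow_cvg.
Qed.

Let flowE b r : label_flow b r = b - 2 * wb * rint s (clamp r) (fun r' => U r' (label_flow b r')).
Proof.
have h1 : (fun n => picard n.+1 b r) @ \oo --> label_flow b r.
  by have := @flow_cvg b r; rewrite -(cvg_shiftS (fun n => picard n b r)).
have h2 : (fun n => rint s (clamp r) (fun r' => U r' (picard n b r'))) @ \oo -->
   rint s (clamp r) (fun r' => U r' (label_flow b r')).
  apply: (@rint_dct _ _ _ _ _ (fun=> M)).
  - by move=> n; exact: mUy.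
  - exact: mUy.
  - exact: ib_cst.
  - apply: ae_all => r' _; apply/cvgrPdist_le => e e0.
    have := @flow_cvg b r'; move/cvgrPdist_le => /(_ e e0); apply: filterS => n h.
    by apply: (le_trans (U_lip _ _ _)); lra.
  - by apply: ae_all => r' _ n.
have h3 : (fun n => picard n.+1 b r) @ \oo -->
    b - 2 * wb * rint s (clamp r) (fun r' => U r' (label_flow b r')).
  by apply: cvgB; [exact: cvg_cst|apply: cvgMl_tmp].
exact: cvg_unique h1 h3.
Qed.

Lemma label_flow_curve b : label_curve S s (s + tau) (label_flow b).
Proof.
split=> // r r' sr rr' r't.
have t1 : s <= r <= s + tau by rewrite sr (le_trans rr').
have t2 : s <= r' <= s + tau by rewrite (le_trans sr).
rewrite (flowE b r) (flowE b r') !clampE//.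
rewrite (rint_cat sr rr'); last exact: ib_Uy.
by rewrite /U; ring.
Qed.

Lemma label_flow_init b : label_flow b s = b.
Proof.
rewrite flowE clampE; last by rewrite lexx/= lerDl ltW.
by rewrite rint_pt// mulr0 subr0.
Qed.

Let cvg_le (f : nat -> R) l c K : f @ \oo --> l -> (forall n, `|f n - c| <= K) -> `|l - c| <= K.
Proof.
move=> fl fK; apply/ler_addgt0Pr => e e0.
move/cvgrPdist_le: fl => /(_ e e0) [n _ /(_ n (leqnn n))] h.
have -> : l - c = (l - f n) + (f n - c) by ring.
by apply: (le_trans (ler_normD _ _)); have := fK n; lra.
Qed.

(** [1 / 3] is the fixed point of [K |-> (1 + K) / 4], with [1 / 4] the contraction factor. The flow
    is thus close to a translation: increasing in the label, onto, and expanding by at most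
    [4 / 3]. *)
Lemma label_flow_lip (b b' r : R) : `|label_flow b' r - label_flow b r - (b' - b)| <= `|b' - b| / 3.
Proof.
apply: (@cvg_le (fun n => picard n b' r - picard n b r)).
  by apply: cvgB; exact: flow_cvg.
move=> n; elim: n r => [|n IH] r; first by rewrite subrr normr0 divr_ge0.
have K r' : `|picard n b' r' - picard n b r'| <= 4 / 3 * `|b' - b|.
  have -> : picard n b' r' - picard n b r' = (picard n b' r' - picard n b r' - (b' - b)) + (b' - b) by ring.
  by apply: (le_trans (ler_normD _ _)); have := IH r'; lra.
have := step_diff b b' r (m_picard n b) (m_picard n b') K.
rewrite (_ : 4 / 3 * `|b' - b| / 4 = `|b' - b| / 3); last by field.
by move=> /=; rewrite (_ : _ - _ - (_ - b) = step b' (picard n b') r - step b (picard n b) r - (b' - b)); [|ring].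
Qed.

Lemma label_flow_per b r : label_flow (b + P) r = label_flow b r + P.
Proof.
suff h n : forall r, picard n (b + P) r = picard n b r + P.
  have h1 : (fun n => picard n b r + P) @ \oo --> label_flow b r + P.
    by apply: cvgD; [exact: flow_cvg|exact: cvg_cst].
  have h2 := @flow_cvg (b + P) r.
  rewrite (_ : (fun n => picard n (b + P) r) = (fun n => picard n b r + P)) in h2.
    exact: cvg_unique h2 h1.
  by apply/funext => n; exact: h.
elim: n => [|n IH] r' //=.
rewrite /step addrAC; congr (_ + _); congr (_ - 2 * wb * _).
apply: eq_rint_ae; [exact: mUy|exact: mUy|].
move: (gs_Gae S); apply: ae_imp => r'' Gr /andP[r1 r2].
have {}Gr : G r'' by apply: Gr; exact: le_trans r1.
by rewrite IH /U (invY_per S)// (gs_uper S).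
Qed.

End LabelFlow.

(** * Comparison of two solutions *)

Section SingleTime.
Context {R : realType} {u q H Y : R -> R -> R} {wb P M : R} {G : R -> Prop}.
Context (S : good_solution u q H Y wb P M G) (t : R).
Local Notation mu := (@lebesgue_measure R).

Lemma ib_1q2 a b : ib a b (fun x => 1 - q t x ^+ 2).
Proof. by apply: ibB; [exact: ib_cst|exact: gs_q2 S _ _ _]. Qed.

Lemma rint_1q2 a b : a <= b ->
  rint a b (fun x => 1 - q t x ^+ 2) = 2 * (b - a) - (Y t b - Y t a).
Proof.
move=> ab; rewrite rintB; [|exact: ib_cst|exact: gs_q2 S _ _ _].
by rewrite rint_cst// (gs_Y S)//; ring.
Qed.

Lemma ib_1q2M (a b B : R) (g : R -> R) : measurable_fun setT g -> (forall x, `|g x| <= B) ->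
  ib a b (fun x => (1 - q t x ^+ 2) * g x).
Proof.
move=> mg gB; apply: (@ibM _ _ _ B) => //; first exact: ib_1q2.
by apply: ae_all => x _.
Qed.

(* [(1 - q^2) dx = 2 dx - dY]. *)
Lemma rint_1q2_approx (a b A B : R) (g : R -> R) : a <= b -> measurable_fun setT g -> (forall x, `|g x| <= B) ->
  (forall a b, a <= b -> `|g b - g a| <= A * (Y t b - Y t a)) -> 0 <= A ->
  `|rint a b (fun x => (1 - q t x ^+ 2) * g x) - g a * (2 * (b - a) - (Y t b - Y t a))| <=
  A * (Y t b - Y t a) * (Y t b - Y t a).
Proof.
move=> ab mg gB gA A0.
have i1 := ib_1q2M a b mg gB.
rewrite -rint_1q2// -(rintZ (g a) (ib_1q2 a b)) -rintB//; last by apply: ibZ; exact: ib_1q2.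
rewrite -[X in _ <= _ * X](rint_dens S)// -rintZ; last exact: ib_dens S _ _ _.
apply: rint_norm_le.
- by have [] : ib a b (fun x => (1 - q t x ^+ 2) * g x - g a * (1 - q t x ^+ 2)) by
    apply: ibB => //; apply: ibZ; exact: ib_1q2.
- by apply: ibZ; exact: ib_dens S _ _ _.
move=> x /andP[ax xb].
have -> : (1 - q t x ^+ 2) * g x - g a * (1 - q t x ^+ 2) = (g x - g a) * (1 - q t x ^+ 2) by ring.
rewrite normrM ler_pM//.
  apply: (le_trans (gA _ _ ax)); rewrite ler_wpM2l// lerD2r.
  exact: Y_mono S _ _ _ xb.
by rewrite ler_norml; have := sqr_ge0 (q t x); move=> q0; apply/andP; split; lra.
Qed.

End SingleTime.

Section Compare.
Context {R : realType}.
Context {u1 q1 H1 Y1 : R -> R -> R} {wb1 : R} {G1 : R -> Prop}.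
Context {u2 q2 H2 Y2 : R -> R -> R} {wb2 : R} {G2 : R -> Prop}.
Context {P M : R}.
Context (S1 : good_solution u1 q1 H1 Y1 wb1 P M G1).
Context (S2 : good_solution u2 q2 H2 Y2 wb2 P M G2).
Local Notation mu := (@lebesgue_measure R).

(* [x1] and [x2] send labels to positions for the two solutions. *)
Definition close_labelling (t b0 m : R) (x1 x2 : R -> R) : Prop :=
  [/\ 0 <= m,
     forall b c, b <= c -> [/\ x1 b <= x1 c, x2 b <= x2 c,
       Y1 t (x1 c) - Y1 t (x1 b) <= 2 * (c - b) & Y2 t (x2 c) - Y2 t (x2 b) <= 2 * (c - b)] &
     forall b, b0 <= b <= b0 + P -> `|x1 b - x2 b| <= m /\ `|Y1 t (x1 b) - Y2 t (x2 b)| <= m].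

(* Abel summation: the difference is integrated by parts on the side of [g2]. *)
Lemma stieltjes_compare (t b0 m n A B : R) (x1 x2 g1 g2 : R -> R) :
  close_labelling t b0 m x1 x2 -> 0 <= A ->
  measurable_fun setT g1 -> measurable_fun setT g2 ->
  (forall x, `|g1 x| <= B) -> (forall x, `|g2 x| <= B) ->
  (forall a b, a <= b -> `|g1 b - g1 a| <= A * (Y1 t b - Y1 t a)) ->
  (forall a b, a <= b -> `|g2 b - g2 a| <= A * (Y2 t b - Y2 t a)) ->
  (forall b, b0 <= b <= b0 + P -> `|g1 (x1 b) - g2 (x2 b)| <= n) ->
  forall b, b0 <= b <= b0 + P ->
  `|rint (x1 b0) (x1 b) (fun x => (1 - q1 t x ^+ 2) * g1 x) -
    rint (x2 b0) (x2 b) (fun x => (1 - q2 t x ^+ 2) * g2 x)| <=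
  2 * P * n + (6 * A * P + 6 * B) * m.
Proof.
move=> [m0 mono cl] A0 mg1 mg2 g1B g2B g1A g2A gn b bb.
have /andP[b0b bP] := bb.
have P0 : 0 <= P by lra.
have n0 : 0 <= n by apply: le_trans (gn b bb).
pose F1 c := rint (x1 b0) (x1 c) (fun x => (1 - q1 t x ^+ 2) * g1 x).
pose F2 c := rint (x2 b0) (x2 c) (fun x => (1 - q2 t x ^+ 2) * g2 x).
(* In terms of labels the integrals are Stieltjes integrals against [A1] and [A2], whose difference
   [D] is at most [2 m + m]. The boundary term of the summation by parts is built into [Psi]. *)
pose A1 c := 2 * x1 c - Y1 t (x1 c).
pose A2 c := 2 * x2 c - Y2 t (x2 c).
pose D c := A1 c - A2 c.
have D3 c : b0 <= c <= b0 + P -> `|D c| <= 3 * m.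
  move=> /cl[]; rewrite /D /A1 /A2 !ler_norml => /andP[? ?] /andP[? ?].
  by apply/andP; split; lra.
pose Psi c := F1 c - F2 c - g2 (x2 c) * D c.
have F10 : F1 b0 = 0 by rewrite /F1 rint_pt.
have F20 : F2 b0 = 0 by rewrite /F2 rint_pt.
suff key : `|Psi b - Psi b0| <= 2 * P * n + 6 * A * P * m.
  have d1 := D3 b bb; have d2 := D3 b0 (ltac:(lra)).
  have k1 : `|g2 (x2 b) * D b| <= B * (3 * m) by rewrite normrM ler_pM.
  have k2 : `|g2 (x2 b0) * D b0| <= B * (3 * m) by rewrite normrM ler_pM.
  rewrite -/(F1 b) -/(F2 b).
  have -> : F1 b - F2 b = (Psi b - Psi b0) + g2 (x2 b) * D b - g2 (x2 b0) * D b0.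
    by rewrite /Psi F10 F20; ring.
  apply: (le_trans (ler_normB _ _)).
  have := ler_normD (Psi b - Psi b0) (g2 (x2 b) * D b).
  by lra.
apply/ler_addgt0Pr => e e0.
have e1 : 0 < e / (P + 1) by rewrite divr_gt0//; lra.
pose e' := e / (P + 1).
(* Replacing each integrand by its left end value costs at most [A * (2 * (d - c)) ^+ 2], which for
   steps below [eta] is at most [e' / 2 * (d - c)]. *)
pose eta := e' / (8 * A + 1).
have eta0 : 0 < eta by rewrite divr_gt0//; lra.
(* The terms dominate, in order, the difference of the integrands, the variation of [g2] multiplied
   by [D], and the local quadrature errors. *)
pose Lam c := n * Y1 t (x1 c) + 3 * A * m * Y2 t (x2 c) + e' * c.
apply: (@le_trans _ _ (Lam b - Lam b0)); last first.
  have [_ _ h1 h2] := mono b0 b b0b.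
  rewrite /Lam.
  have -> : n * Y1 t (x1 b) + 3 * A * m * Y2 t (x2 b) + e' * b -
    (n * Y1 t (x1 b0) + 3 * A * m * Y2 t (x2 b0) + e' * b0) =
    n * (Y1 t (x1 b) - Y1 t (x1 b0)) + 3 * A * m * (Y2 t (x2 b) - Y2 t (x2 b0)) + e' * (b - b0) by ring.
  apply: lerD.
    apply: lerD.
      have -> : 2 * P * n = n * (2 * P) by ring.
      by rewrite ler_wpM2l//; lra.
    have -> : 6 * A * P * m = 3 * A * m * (2 * P) by ring.
    by rewrite ler_wpM2l ?mulr_ge0//; lra.
  apply: (@le_trans _ _ (e' * (P + 1))); first by rewrite ler_wpM2l ?(ltW e1)//; lra.
  by rewrite /e' divfK//; lra.
apply: (@local_to_global _ (fun=> True) b0 (b0 + P) eta Psi Lam eta0) => //.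
  by move=> c d _ cd _; exists ((c + d) / 2) => //; apply/andP; split; lra.
move=> c d _ _ b0c cd dP dc; have cd' := ltW cd.
have [x1cd x2cd Y1cd Y2cd] := mono c d cd'.
have [x10 x20 _ _] := mono b0 c b0c.
have sq x : 0 <= x -> x <= 2 * (d - c) -> A * x * x <= e' / 2 * (d - c).
  move=> x0 xdc.
  apply: (@le_trans _ _ (A * (2 * (d - c)) * (2 * (d - c)))).
    by rewrite -mulrA -[leRHS]mulrA ler_wpM2l// ler_pM.
  have h : (d - c) * (8 * A + 1) < e' by rewrite -ltr_pdivlMr//; lra.
  have -> : A * (2 * (d - c)) * (2 * (d - c)) = 4 * A * (d - c) * (d - c) by ring.
  by rewrite ler_wpM2r//; lra.
have y10 : 0 <= Y1 t (x1 d) - Y1 t (x1 c) by rewrite subr_ge0 (Y_mono S1).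
have y20 : 0 <= Y2 t (x2 d) - Y2 t (x2 c) by rewrite subr_ge0 (Y_mono S2).
have s1 := sq _ y10 Y1cd; have s2 := sq _ y20 Y2cd.
have cc : b0 <= c <= b0 + P by rewrite b0c (le_trans cd').
have dd : b0 <= d <= b0 + P by rewrite (le_trans b0c).
have dY1 := dY_ge S1 t x1cd; have dY2 := dY_ge S2 t x2cd.
have dA1 : `|2 * (x1 d - x1 c) - (Y1 t (x1 d) - Y1 t (x1 c))| <= Y1 t (x1 d) - Y1 t (x1 c).
  by rewrite ler_norml; apply/andP; split; lra.
have ib1 a a' : ib a a' (fun x => (1 - q1 t x ^+ 2) * g1 x) by exact: ib_1q2M S1 t _ _ _ _ mg1 g1B.
have ib2 a a' : ib a a' (fun x => (1 - q2 t x ^+ 2) * g2 x) by exact: ib_1q2M S2 t _ _ _ _ mg2 g2B.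
have E1 : F1 d - F1 c = rint (x1 c) (x1 d) (fun x => (1 - q1 t x ^+ 2) * g1 x).
  by rewrite /F1 (rint_cat x10 x1cd)//; ring.
have E2 : F2 d - F2 c = rint (x2 c) (x2 d) (fun x => (1 - q2 t x ^+ 2) * g2 x).
  by rewrite /F2 (rint_cat x20 x2cd)//; ring.
have a1 := rint_1q2_approx S1 x1cd mg1 g1B g1A A0.
have a2 := rint_1q2_approx S2 x2cd mg2 g2B g2A A0.
rewrite -E1 in a1; rewrite -E2 in a2.
have -> : Psi d - Psi c =
   (F1 d - F1 c - g1 (x1 c) * (2 * (x1 d - x1 c) - (Y1 t (x1 d) - Y1 t (x1 c)))) -
   (F2 d - F2 c - g2 (x2 c) * (2 * (x2 d - x2 c) - (Y2 t (x2 d) - Y2 t (x2 c)))) +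
   (g1 (x1 c) - g2 (x2 c)) * (2 * (x1 d - x1 c) - (Y1 t (x1 d) - Y1 t (x1 c))) -
   (g2 (x2 d) - g2 (x2 c)) * D d.
  by rewrite /Psi /D /A1 /A2; ring.
have z3 : `|(g1 (x1 c) - g2 (x2 c)) * (2 * (x1 d - x1 c) - (Y1 t (x1 d) - Y1 t (x1 c)))| <=
    n * (Y1 t (x1 d) - Y1 t (x1 c)).
  by rewrite normrM ler_pM ?gn.
have z4 : `|(g2 (x2 d) - g2 (x2 c)) * D d| <= A * (Y2 t (x2 d) - Y2 t (x2 c)) * (3 * m).
  by rewrite normrM ler_pM ?g2A ?D3.
have -> : Lam d - Lam c = e' / 2 * (d - c) + e' / 2 * (d - c) +
   n * (Y1 t (x1 d) - Y1 t (x1 c)) + A * (Y2 t (x2 d) - Y2 t (x2 c)) * (3 * m).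
  by rewrite /Lam; field.
apply: (le_trans (ler_normB _ _)); apply: lerD => //.
apply: (le_trans (ler_normD _ _)); apply: lerD => //.
by apply: (le_trans (ler_normB _ _)); apply: lerD; [exact: le_trans a1 s1|exact: le_trans a2 s2].
Qed.

(** The Stieltjes comparison is used twice. With [g = u] it bounds the difference of the means and
    that of the increments of [H] from the base label [b0]. With these increments as integrands it
    reaches the base values themselves: over a period [(1 - q^2) H] has integral [0] and [1 - q^2]
    has integral [2 - P], so the base value is, up to sign, the integral of [1 - q^2] times the
    increment, divided by [2 - P]. *)
Lemma source_compare t b0 m x1 x2 : G1 t -> G2 t -> 0 < t ->
  close_labelling t b0 m x1 x2 ->
  x1 (b0 + P) = x1 b0 + 1 -> x2 (b0 + P) = x2 b0 + 1 ->
  (forall b, b0 <= b <= b0 + P -> `|u1 t (x1 b) - u2 t (x2 b)| <= m) ->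
  `|wb1 - wb2| <= 11 * M * m /\
  `|H1 t (x1 b0) - H2 t (x2 b0)| <= 72 * M ^+ 2 / `|2 - P| * m.
Proof.
move=> g1 g2 t0 cl p1 p2 um.
have [m0 mono clb] := cl; have M1 := gs_M1 S1; have PM := gs_PM S1.
have P1 : 1 <= P.
  have := gs_Yle S1 t 0; have := dY_ge S1 t (_ : (0 : R) <= 0 + 1); rewrite add0r => /(_ ler01).
  by move=> h1 h2; lra.
have b0P : b0 <= b0 + P by lra.
have bb0 : b0 <= b0 <= b0 + P by lra.
have bbP : b0 <= b0 + P <= b0 + P by lra.
have half0 : 0 <= 2^-1 :> R by lra.
have swap (u q : R -> R) a b : rint a b (fun x => u x - u x * q x ^+ 2) = rint a b (fun x => (1 - q x ^+ 2) * u x).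
  by apply: eq_rint => x _; ring.
have c1 := @stieltjes_compare t b0 m m 2^-1 M x1 x2 (u1 t) (u2 t) cl half0
  (gs_mus S1 t) (gs_mus S2 t) (gs_bu S1 t) (gs_bu S2 t)
  (fun a b ab => le_trans (du_le S1 t ab) (ltac:(by rewrite mulrC)))
  (fun a b ab => le_trans (du_le S2 t ab) (ltac:(by rewrite mulrC))) um.
have {}c1 b : b0 <= b <= b0 + P ->
  `|rint (x1 b0) (x1 b) (fun x => u1 t x - u1 t x * q1 t x ^+ 2) -
    rint (x2 b0) (x2 b) (fun x => u2 t x - u2 t x * q2 t x ^+ 2)| <= 11 * M * m.
  move=> bb; rewrite !swap; apply: (le_trans (c1 b bb)).
  have -> : 2 * P * m + (6 * 2^-1 * P + 6 * M) * m = (5 * P + 6 * M) * m by field.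
  by rewrite ler_wpM2r//; lra.
have w12 : `|wb1 - wb2| <= 11 * M * m.
  have := c1 _ bbP; rewrite p1 p2.
  by rewrite (gs_w S1 g1 t0) (gs_w S2 g2 t0).
split=> //.
pose h1 x := H1 t x - H1 t (x1 b0).
pose h2 x := H2 t x - H2 t (x2 b0).
have hb1 x : `|h1 x| <= 2 * M.
  by apply: (le_trans (ler_normB _ _)); have := gs_bH S1 t x; have := gs_bH S1 t (x1 b0); lra.
have hb2 x : `|h2 x| <= 2 * M.
  by apply: (le_trans (ler_normB _ _)); have := gs_bH S2 t x; have := gs_bH S2 t (x2 b0); lra.
have M20 : 0 <= 2 * M by lra.
have mh1 : measurable_fun setT h1 by apply: measurable_funB => //; exact: gs_mHs S1 t.
have mh2 : measurable_fun setT h2 by apply: measurable_funB => //; exact: gs_mHs S2 t.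
have hl1 a b : a <= b -> `|h1 b - h1 a| <= 2 * M * (Y1 t b - Y1 t a).
  by move=> ab; rewrite (_ : h1 b - h1 a = H1 t b - H1 t a); [exact: dH_le S1 _ _ _ _ _ _|rewrite /h1; ring].
have hl2 a b : a <= b -> `|h2 b - h2 a| <= 2 * M * (Y2 t b - Y2 t a).
  by move=> ab; rewrite (_ : h2 b - h2 a = H2 t b - H2 t a); [exact: dH_le S2 _ _ _ _ _ _|rewrite /h2; ring].
(* [24 = 11 + 11 + 2]: the integrals of [u - u q^2], the difference of the means, and the difference
   of the positions at both ends. *)
have hn b : b0 <= b <= b0 + P -> `|h1 (x1 b) - h2 (x2 b)| <= 24 * M * m.
  move=> bb; have /andP[bb1 bb2] := bb.
  have [xa xb _ _] := mono b0 b bb1; have [xc _ _ _] := mono b (b0 + P) bb2.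
  rewrite /h1 /h2 (gs_H S1 g1 t0 xa) (gs_H S2 g2 t0 xb).
  have k1 := c1 b bb.
  have [k2 _] := clb b bb; have [k3 _] := clb b0 bb0.
  have k4 : `|(wb1 - wb2) * (x1 b - x1 b0)| <= 11 * M * m * 1.
    by rewrite normrM ler_pM// ger0_norm; lra.
  have k5 : `|wb2 * (x1 b - x2 b - (x1 b0 - x2 b0))| <= M * (2 * m).
    rewrite normrM ler_pM ?(gs_bw S2)//; apply: (le_trans (ler_normB _ _)); lra.
  move: k1 k4 k5; set r1 := rint _ _ _; set r2 := rint _ _ _ => k1 k4 k5.
  have -> : r1 - wb1 * (x1 b - x1 b0) - (r2 - wb2 * (x2 b - x2 b0)) =
    (r1 - r2) - (wb1 - wb2) * (x1 b - x1 b0) - wb2 * (x1 b - x2 b - (x1 b0 - x2 b0)) by ring.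
  apply: (le_trans (ler_normB _ _)).
  by have := ler_normB (r1 - r2) ((wb1 - wb2) * (x1 b - x1 b0)); lra.
have := @stieltjes_compare t b0 m (24 * M * m) (2 * M) (2 * M) x1 x2 h1 h2 cl M20
  mh1 mh2 hb1 hb2 hl1 hl2 hn _ bbP.
have per (u q H Y : R -> R -> R) wb G (S : good_solution u q H Y wb P M G) x : G t ->
    rint x (x + 1) (fun y => (1 - q t y ^+ 2) * (H t y - H t x)) = - ((2 - P) * H t x).
  move=> Gt; have x1' : x <= x + 1 by lra.
  have E : (fun y => (1 - q t y ^+ 2) * (H t y - H t x)) =
     (fun y => (1 - q t y ^+ 2) * H t y - H t x * (1 - q t y ^+ 2)).
    by apply/funext => y; ring.
  rewrite E rintB; first last.
  - by apply: ibZ; exact: ib_1q2 S _ _ _.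
  - exact: ib_1q2M S t _ _ _ _ (gs_mHs S t) (gs_bH S t).
  rewrite (gs_f S Gt t0) rintZ; last exact: ib_1q2 S _ _ _.
  by rewrite (rint_1q2 S)// (gs_Yper S Gt); ring.
rewrite p1 p2 (per _ _ _ _ _ _ S1 _ g1) (per _ _ _ _ _ _ S2 _ g2).
have -> : - ((2 - P) * H1 t (x1 b0)) - - ((2 - P) * H2 t (x2 b0)) =
  - ((2 - P) * (H1 t (x1 b0) - H2 t (x2 b0))) by ring.
rewrite normrN normrM => h.
have P2 : 0 < `|2 - P| by rewrite normr_gt0 subr_eq0 eq_sym (gs_P2 S1).
rewrite mulrAC ler_pdivlMr// mulrC; apply: (le_trans h).
have -> : 2 * P * (24 * M * m) + (6 * (2 * M) * P + 6 * (2 * M)) * m = (60 * P * M + 12 * M) * m by ring.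
by rewrite ler_wpM2r//; nra.
Qed.

End Compare.

Lemma halving_eq0 (R : realType) (x K : R) : (forall n, `|x| <= K / 2 ^+ n) -> x = 0.
Proof.
move=> h; apply: (@small_multiple_eq0 _ _ `|K|) => e e0 _.
pose n := (Num.truncn e^-1).+1.
have en : e^-1 < 2 ^+ n.
  apply: (@lt_trans _ _ n%:R); first by rewrite truncnS_gt.
  by rewrite -natrX ltr_nat ltn_expl.
apply: (le_trans (h n)); apply: (@le_trans _ _ (`|K| / 2 ^+ n)).
  by rewrite ler_wpM2r ?ler_norm// invr_ge0 exprn_ge0.
rewrite mulrC ler_wpM2r//; apply/ltW.
by rewrite -[ltRHS]invrK ltf_pV2 ?posrE ?invr_gt0// exprn_gt0.
Qed.

Section CrudeBounds.
Context {R : realType} {u q H Y : R -> R -> R} {wb P M : R} {G : R -> Prop}.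
Context (S : good_solution u q H Y wb P M G).

Lemma crude_u2 r x : `|u r x ^+ 2| <= 2 * M ^+ 2 + M.
Proof. by apply: (le_trans (u2_le S r x)); have := gs_M0 S; have := sqr_ge0 M; lra. Qed.

Lemma crude_wu r x : `|2 * wb * u r x| <= 2 * M ^+ 2 + M.
Proof.
rewrite normrM normrM ger0_norm//.
have : `|wb| * `|u r x| <= M * M by rewrite ler_pM ?(gs_bw S) ?(gs_bu S).
by have := gs_M0 S; rewrite -mulrA -expr2; lra.
Qed.

End CrudeBounds.

(** * Contraction on short time steps *)

Section Uniqueness.
Context {R : realType}.
Context {u1 q1 H1 Y1 : R -> R -> R} {wb1 : R} {G1 : R -> Prop}.
Context {u2 q2 H2 Y2 : R -> R -> R} {wb2 : R} {G2 : R -> Prop}.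
Context {P M : R}.
Context (S1 : good_solution u1 q1 H1 Y1 wb1 P M G1).
Context (S2 : good_solution u2 q2 H2 Y2 wb2 P M G2).
Local Notation mu := (@lebesgue_measure R).

(** Dominates the three rates of separation: [2 M] for positions, [2 M + 22 M^2] for labels, and
    [72 M^2 / |2 - P|] for values of [u]. *)
Let L := 2 * M + 24 * M ^+ 2 + 72 * M ^+ 2 / `|2 - P|.

Lemma unique_flow s tau : G1 s -> G2 s -> u1 s = u2 s -> Y1 s = Y2 s ->
  0 < tau -> M * tau <= 1 / 4 -> L * tau <= 1 / 2 ->
  forall t b, G1 t -> G2 t -> s <= t <= s + tau ->
  [/\ invY S1 t (label_flow S1 s tau b t) = invY S2 t (label_flow S2 s tau b t),
      label_flow S1 s tau b t = label_flow S2 s tau b t &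
      u1 t (invY S1 t (label_flow S1 s tau b t)) = u2 t (invY S2 t (label_flow S2 s tau b t))].
Proof.
move=> g1 g2 u12 Y12 tau0 Mtau Ltau.
have s0 := gs_Gge S1 g1; have M0 := gs_M0 S1; have M1 := gs_M1 S1.
pose y1 b := label_flow S1 s tau b; pose y2 b := label_flow S2 s tau b.
pose x1 t b := invY S1 t (y1 b t); pose x2 t b := invY S2 t (y2 b t).
have C1 b : label_curve S1 s (s + tau) (y1 b) by exact: label_flow_curve.
have C2 b : label_curve S2 s (s + tau) (y2 b) by exact: label_flow_curve.
have ss : s <= s + tau by rewrite lerDl ltW.
have i1 b : y1 b s = b by exact: label_flow_init.
have i2 b : y2 b s = b by exact: label_flow_init.
have ix b : x1 s b = x2 s b.
  rewrite /x1 /x2 i1 i2; apply/eqP; rewrite eq_le.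
  by rewrite (le_invY S1) Y12 invYK lexx (le_invY S2) -Y12 invYK lexx.
have L0 : 0 <= L.
  by rewrite /L !addr_ge0 ?mulr_ge0 ?exprn_ge0 ?invr_ge0.
pose close t b K := [/\ `|x1 t b - x2 t b| <= K, `|y1 b t - y2 b t| <= K &
  `|u1 t (x1 t b) - u2 t (x2 t b)| <= K].
have mx1 b : measurable_fun setT (fun r => x1 r b).
  by have [_ my _] := C1 b; exact: (mfun_comp2 (measurable_invY S1)).
have mx2 b : measurable_fun setT (fun r => x2 r b).
  by have [_ my _] := C2 b; exact: (mfun_comp2 (measurable_invY S2)).
have mv1 b : measurable_fun setT (fun r => u1 r (x1 r b)) by exact: (mfun_comp2 (gs_mu S1)).
have mv2 b : measurable_fun setT (fun r => u2 r (x2 r b)) by exact: (mfun_comp2 (gs_mu S2)).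
have mH1 b : measurable_fun setT (fun r => H1 r (x1 r b)) by exact: (mfun_comp2 (gs_mH S1)).
have mH2 b : measurable_fun setT (fun r => H2 r (x2 r b)) by exact: (mfun_comp2 (gs_mH S2)).
have ibM' (f : R -> R) B c d : measurable_fun setT f -> (forall x, `|f x| <= B) -> ib c d f.
  by move=> mf fB; apply: (@ib_bounded _ _ _ B) => //; apply: ae_all.
have X1 b t : G1 t -> s <= t <= s + tau ->
    x1 t b - x1 s b = - rint s t (fun r => u1 r (x1 r b) ^+ 2).
  by move=> Gt /andP[st tt]; exact: (char_eq (C1 b)).
have X2 b t : G2 t -> s <= t <= s + tau ->
    x2 t b - x2 s b = - rint s t (fun r => u2 r (x2 r b) ^+ 2).
  by move=> Gt /andP[st tt]; exact: (char_eq (C2 b)).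
have V1 b t : G1 t -> s <= t <= s + tau ->
    u1 t (x1 t b) - u1 s (x1 s b) = rint s t (fun r => H1 r (x1 r b)).
  by move=> Gt /andP[st tt]; exact: (char_velocity (C1 b)).
have V2 b t : G2 t -> s <= t <= s + tau ->
    u2 t (x2 t b) - u2 s (x2 s b) = rint s t (fun r => H2 r (x2 r b)).
  by move=> Gt /andP[st tt]; exact: (char_velocity (C2 b)).
have W1 b t : s <= t <= s + tau ->
    y1 b t - b = - rint s t (fun r => 2 * wb1 * u1 r (x1 r b)).
  move=> /andP[st tt]; have [_ _ h] := C1 b.
  rewrite -{2}(i1 b) (h s t)// rintZ ?mulNr//.
  exact: ibM' (mv1 b) (fun r => gs_bu S1 _ _).
have W2 b t : s <= t <= s + tau ->
    y2 b t - b = - rint s t (fun r => 2 * wb2 * u2 r (x2 r b)).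
  move=> /andP[st tt]; have [_ _ h] := C2 b.
  rewrite -{2}(i2 b) (h s t)// rintZ ?mulNr//.
  exact: ibM' (mv2 b) (fun r => gs_bu S2 _ _).
have aeG (r0 : R) : {ae mu, forall r, s <= r <= r0 -> [/\ G1 r, G2 r & s < r \/ r = s]}.
  move: (gs_Gae S1) (gs_Gae S2); apply: ae_imp2 => r Gr1 Gr2 /andP[sr _].
  split; [by apply: Gr1; lra|by apply: Gr2; lra|].
  by move: sr; rewrite le_eqVlt => /predU1P[->|]; [right|left].
have na : {ae mu, forall x : R, x != s}.
  exists [set s]; split; [exact: measurable_set1|exact: lebesgue_measure_set1|].
  by move=> x /= /negP; rewrite negbK => /eqP.
(* Bounds on the differences of the three rates at good times in []s, t]] are integrated in time;
   the initial differences vanish. *)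
have diffs t b A B D K : G1 t -> G2 t -> s <= t <= s + tau ->
    (forall r, G1 r -> G2 r -> s < r -> r <= t ->
      [/\ `|u1 r (x1 r b) ^+ 2 - u2 r (x2 r b) ^+ 2| <= A,
          `|2 * wb1 * u1 r (x1 r b) - 2 * wb2 * u2 r (x2 r b)| <= B &
          `|H1 r (x1 r b) - H2 r (x2 r b)| <= D]) ->
    A * tau <= K -> B * tau <= K -> D * tau <= K ->
    0 <= A -> 0 <= B -> 0 <= D -> close t b K.
  move=> Gt1 Gt2 stt h AK BK DK A0 B0 D0.
  have /andP[st tt] := stt.
  have big (f g : R -> R) E : measurable_fun setT f -> measurable_fun setT g ->
      (forall r, `|f r| <= 2 * M ^+ 2 + M) -> (forall r, `|g r| <= 2 * M ^+ 2 + M) -> 0 <= E -> E * tau <= K ->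
      (forall r, G1 r -> G2 r -> s < r -> r <= t -> `|f r - g r| <= E) ->
      `|rint s t f - rint s t g| <= K.
    move=> mf mg fB gB E0 EK fg.
    rewrite -rintB; [|exact: ibM' fB|exact: ibM' gB].
    apply: (le_trans _ EK); apply: (@le_trans _ _ (E * (t - s))); last first.
      by rewrite ler_wpM2l//; lra.
    apply: rint_bound_ae => //; first exact: measurable_funB.
    move: (aeG t) na; apply: ae_imp2 => r Gr rs rr; have /andP[sr rt] := rr.
    have [a1 a2 [sr'|/eqP]] := Gr rr; last by rewrite (negPf rs).
    exact: fg.
  have M2 := sqr_ge0 M.
  split.
  - have -> : x1 t b - x2 t b = (x1 t b - x1 s b) - (x2 t b - x2 s b) by rewrite ix; ring.
    rewrite X1// X2// opprK addrC.
    apply: (big _ _ A) => //; try exact: measurable_funX.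
    + by move=> r; exact: crude_u2 S2 _ _.
    + by move=> r; exact: crude_u2 S1 _ _.
    + by move=> r a1 a2 sr rt; rewrite distrC; have [] := h r a1 a2 sr rt.
  - have -> : y1 b t - y2 b t = (y1 b t - b) - (y2 b t - b) by ring.
    rewrite W1// W2// opprK addrC.
    apply: (big _ _ B) => //; try (by apply: measurable_funM).
    + by move=> r; exact: crude_wu S2 _ _.
    + by move=> r; exact: crude_wu S1 _ _.
    + by move=> r a1 a2 sr rt; rewrite distrC; have [] := h r a1 a2 sr rt.
  - have -> : u1 t (x1 t b) - u2 t (x2 t b) = (u1 t (x1 t b) - u1 s (x1 s b)) - (u2 t (x2 t b) - u2 s (x2 s b)).
      by rewrite ix u12; ring.
    rewrite V1// V2//.
    apply: (big _ _ D) => //.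
    + by move=> r; apply: (le_trans (gs_bH S1 _ _)); lra.
    + by move=> r; apply: (le_trans (gs_bH S2 _ _)); lra.
    + by move=> r a1 a2 sr rt; have [] := h r a1 a2 sr rt.
(* A finite starting bound, uniform in the label and the time, from which the halving can be
   iterated. *)
have crude t b : G1 t -> G2 t -> s <= t <= s + tau -> close t b ((8 * M ^+ 2 + 2 * M) * tau).
  move=> Gt1 Gt2 stt; have M2 := sqr_ge0 M.
  have C8 : 0 <= 8 * M ^+ 2 + 2 * M by lra.
  apply: (diffs t b (8 * M ^+ 2 + 2 * M) (8 * M ^+ 2 + 2 * M) (8 * M ^+ 2 + 2 * M)) => //.
  move=> r _ _ _ _; split; apply: (le_trans (ler_normB _ _)).
  - by have := u2_le S1 r (x1 r b); have := u2_le S2 r (x2 r b); lra.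
  - by have := crude_wu S1 r (x1 r b); have := crude_wu S2 r (x2 r b); nra.
  - by have := gs_bH S1 r (x1 r b); have := gs_bH S2 r (x2 r b); lra.
(* The hypothesis must cover all labels, because comparing the sources at one label involves a whole
   period of labels. *)
have halve K : 0 <= K ->
    (forall t b, G1 t -> G2 t -> s <= t <= s + tau -> close t b K) ->
    (forall t b, G1 t -> G2 t -> s <= t <= s + tau -> close t b (K / 2)).
  move=> K0 cl t b Gt1 Gt2 stt; have /andP[st tt] := stt.
  have LK : L * K * tau <= K / 2.
    rewrite mulrAC mulrC; apply: (@le_trans _ _ (K * (1 / 2))); last by lra.
    by rewrite ler_wpM2l.
  have LK0 : 0 <= L * K by rewrite mulr_ge0.
  apply: (diffs t b (L * K) (L * K) (L * K)) => // r Gr1 Gr2 sr rt.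
  have rr : s <= r <= s + tau by rewrite (ltW sr) (le_trans rt tt).
  have r0 : 0 < r by lra.
  have [c1 c2 c3] := cl r b Gr1 Gr2 rr.
  clear diffs crude X1 X2 V1 V2 W1 W2 ix i1 i2 u12 Y12.
  have lab : @close_labelling R Y1 Y2 P r b K (x1 r) (x2 r).
    split=> //.
    - move=> b' c bc; rewrite /x1 /x2 !invYK.
      have := label_flow_lip S1 s tau0 Mtau b' c r; have := label_flow_lip S2 s tau0 Mtau b' c r.
      rewrite -/(y1 b') -/(y1 c) -/(y2 b') -/(y2 c) (ger0_norm (_ : 0 <= c - b')) ?subr_ge0//.
      rewrite !ler_norml => /andP[k1 k2] /andP[k3 k4].
      by split; [apply: invY_mono; lra|apply: invY_mono; lra|lra|lra].
    - move=> b' _; have [k1 k2 _] := cl r b' Gr1 Gr2 rr.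
      by rewrite {2}/x1 {2}/x2 !invYK.
  have p1 : x1 r (b + P) = x1 r b + 1.
    by rewrite /x1 /y1 (label_flow_per S1 s0 tau0 Mtau) (invY_per S1).
  have p2 : x2 r (b + P) = x2 r b + 1.
    by rewrite /x2 /y2 (label_flow_per S2 s0 tau0 Mtau) (invY_per S2).
  have um b' : b <= b' <= b + P -> `|u1 r (x1 r b') - u2 r (x2 r b')| <= K.
    by move=> _; have [] := cl r b' Gr1 Gr2 rr.
  have [w12 h12] := source_compare S1 S2 Gr1 Gr2 r0 lab p1 p2 um.
  have M2 := sqr_ge0 M.
  have L2 : 0 <= 72 * M ^+ 2 / `|2 - P| by rewrite !mulr_ge0 ?invr_ge0.
  have LE : L * K = 2 * M * K + 24 * M ^+ 2 * K + 72 * M ^+ 2 / `|2 - P| * K by rewrite /L; ring.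
  have t1 : 0 <= 2 * M * K by rewrite !mulr_ge0.
  have t2 : 0 <= M ^+ 2 * K by rewrite mulr_ge0.
  have t3 : 0 <= 72 * M ^+ 2 / `|2 - P| * K by rewrite mulr_ge0.
  rewrite LE; split.
  - rewrite subr_sqr normrM mulrC.
    apply: (@le_trans _ _ (2 * M * K)); last by lra.
    apply: ler_pM => //; apply: (le_trans (ler_normD _ _)).
    by have := gs_bu S1 r (x1 r b); have := gs_bu S2 r (x2 r b); lra.
  - have -> : 2 * wb1 * u1 r (x1 r b) - 2 * wb2 * u2 r (x2 r b) =
       2 * wb1 * (u1 r (x1 r b) - u2 r (x2 r b)) + 2 * u2 r (x2 r b) * (wb1 - wb2) by ring.
    apply: (@le_trans _ _ (2 * M * K + 2 * M * (11 * M * K))); last by lra.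
    apply: (le_trans (ler_normD _ _)); apply: lerD; rewrite !normrM (ger0_norm (_ : 0 <= 2))//.
      by apply: ler_pM => //; rewrite ler_pM2l// (gs_bw S1).
    by apply: ler_pM => //; rewrite ler_pM2l// (gs_bu S2).
  - by apply: (le_trans h12); lra.
have all_n n : forall t b, G1 t -> G2 t -> s <= t <= s + tau ->
    close t b ((8 * M ^+ 2 + 2 * M) * tau / 2 ^+ n).
  elim: n => [|n IH] t b Gt1 Gt2 stt; first by rewrite expr0 divr1; exact: crude.
  rewrite [2 ^+ n.+1]exprS invfM (mulrC 2^-1) [X in close _ _ X]mulrA; apply: halve => //.
  by rewrite !mulr_ge0 ?invr_ge0 ?exprn_ge0 ?addr_ge0 ?mulr_ge0 ?exprn_ge0// ltW.
move=> t b Gt1 Gt2 stt.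
have z (K1 K2 : R) : (forall n, `|K1 - K2| <= (8 * M ^+ 2 + 2 * M) * tau / 2 ^+ n) -> K1 = K2.
  by move=> /halving_eq0 /eqP; rewrite subr_eq0 => /eqP.
by split; apply: z => n; have [] := all_n n t b Gt1 Gt2 stt.
Qed.

(** Equality of positions, labels and values along the flow becomes equality of functions once every
    value [Y1 t x] is known to be a label reached by the flow; the flow is continuous and close to a
    translation, hence onto. *)
Lemma unique_step s tau : G1 s -> G2 s -> u1 s = u2 s -> Y1 s = Y2 s ->
  0 < tau -> M * tau <= 1 / 4 -> L * tau <= 1 / 2 ->
  forall t, G1 t -> G2 t -> s <= t <= s + tau -> u1 t = u2 t /\ Y1 t = Y2 t.
Proof.
move=> g1 g2 u12 Y12 tau0 Mtau Ltau t Gt1 Gt2 stt.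
have key b := unique_flow g1 g2 u12 Y12 tau0 Mtau Ltau b Gt1 Gt2 stt.
suff surj y : exists b, label_flow S1 s tau b t = y.
  have h x : u1 t x = u2 t x /\ Y1 t x = Y2 t x.
    have [b hb] := surj (Y1 t x); have [k1 k2 k3] := key b.
    have x1E : invY S1 t (label_flow S1 s tau b t) = x by rewrite hb YK.
    have x2E : invY S2 t (label_flow S2 s tau b t) = x by rewrite -k1.
    by rewrite x1E x2E in k3; split=> //; rewrite -hb k2 -x2E invYK.
  by split; apply/funext => x; have [] := h x.
pose f (b : R) : R := label_flow S1 s tau b t.
have lip (b c : R) : `|f c - f b - (c - b)| <= `|c - b| / 3.
  have h := label_flow_lip S1 s tau0 Mtau b c t.
  exact h.
(* The flow moves away from [f 0] by at least [2 / 3 * K = 2 * |y - f 0|] on either side, which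
   brackets [y]. *)
have [K KE] : exists K : R, K = 3 * `|y - f 0| by eexists.
have K0 : 0 <= K by rewrite KE mulr_ge0.
have cf : continuous f.
  move=> b; apply/cvgrPdist_le => e e0; near=> c.
  have h : `|b - c| <= e / 2.
    by near: c; have := @cvg_id _ (nbhs b); move/cvgrPdist_le; apply; rewrite divr_gt0.
  have -> : f b - f c = (f b - f c - (b - c)) + (b - c) by ring.
  by apply: (le_trans (ler_normD _ _)); have := lip c b; lra.
have KK : - K <= K by lra.
have nK : `|K| <= K by rewrite ger0_norm.
have nK3 : `|K| / 3 <= K / 3 by rewrite ler_pM2r.
have f1 : `|f K - f 0 - K| <= K / 3.
  by have := lip 0 K; rewrite subr0 => /le_trans; apply; exact nK3.
have f2 : `|f 0 - f (- K) - K| <= K / 3.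
  have := lip (- K) 0; rewrite (_ : 0 - - K = K); last by ring.
  by move=> /le_trans; apply; exact nK3.
rewrite !ler_norml in f1 f2.
move: f1 f2 => /andP[f1 _] /andP[f2 _].
have h1 := ler_norm (y - f 0); have h2 := ler_norm (- (y - f 0)).
rewrite normrN in h2.
have fK : f (- K) <= y <= f K by apply/andP; split; lra.
have [||b _ fb] := @IVT R f (- K) K y KK; last by exists b.
  exact: continuous_subspaceT.
have /andP[fK1 fK2] := fK; have fKK := le_trans fK1 fK2.
by rewrite (min_idPl fKK) (max_idPr fKK).
Unshelve. all: by end_near. Qed.

Lemma good_solution_unique : u1 0 = u2 0 -> Y1 0 = Y2 0 ->
  forall t, G1 t -> G2 t -> u1 t = u2 t.
Proof.
move=> u0 Y0; have M1 := gs_M1 S1; have M2 := sqr_ge0 M.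
have L0 : 0 < L.
  have h : 0 <= 72 * M ^+ 2 / `|2 - P| by apply: divr_ge0 => //; apply: mulr_ge0.
  by rewrite /L; lra.
pose tau := Num.min (1 / 4 / M) (1 / 2 / L).
have tau0 : 0 < tau by rewrite lt_min !divr_gt0//; lra.
have tM : M * tau <= 1 / 4 by rewrite mulrC -ler_pdivlMr ?ge_min ?lexx//; lra.
have tL : L * tau <= 1 / 2 by rewrite mulrC -ler_pdivlMr// ge_min lexx orbT.
suff H (n : nat) t : G1 t -> G2 t -> t <= n%:R * (tau / 2) -> u1 t = u2 t /\ Y1 t = Y2 t.
  move=> t Gt1 Gt2; have [|//] := H (Num.truncn (t / (tau / 2))).+1 t Gt1 Gt2.
  rewrite -ler_pdivrMr ?divr_gt0//; apply: ltW; exact: truncnS_gt.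
elim: n t => [|n IH] t Gt1 Gt2 tn.
  have t0 := gs_Gge S1 Gt1; have -> : t = 0 by apply/eqP; rewrite eq_le t0 andbT; lra.
  by [].
case: (leP t tau) => tt.
  apply: (unique_step (gs_G0 S1) (gs_G0 S2) u0 Y0 tau0 tM tL Gt1 Gt2).
  by rewrite (gs_Gge S1 Gt1) add0r.
have ae12 : {ae mu, forall r, 0 <= r <= t -> G1 r /\ G2 r}.
  move: (gs_Gae S1) (gs_Gae S2); apply: ae_imp2 => r g1 g2 /andP[r0 _].
  by split; [exact: g1|exact: g2].
(* The restart time has to be good for both solutions; advancing by at least [tau / 2] and less than
   [tau] leaves room to choose it. *)
have [r [Gr1 Gr2] /andP[r1 r2]] := @ae_dense R _ 0 t (t - tau) (t - tau / 2) ae12 (ltac:(lra)) (ltac:(lra)) (ltac:(lra)).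
have [ur Yr] := IH r Gr1 Gr2 (ltac:(by move: tn; rewrite -natr1 mulrDl mul1r; lra)).
apply: (unique_step Gr1 Gr2 ur Yr tau0 tM tL Gt1 Gt2).
by apply/andP; split; lra.
Qed.

End Uniqueness.

(** * Smooth test functions *)

Section Smooth.
Context {R : realType}.
Local Notation mu := (@lebesgue_measure R).

Definition dv (f : R -> R) (x l : R) : Prop := is_derive x (1 : R) f l.

Lemma dv_derivable (f : R -> R) (x l : R) : dv f x l -> derivable f x 1.
Proof. by move=> h; have := @ex_derive _ _ _ _ _ _ _ h. Qed.

Lemma dvE (f : R -> R) (x l : R) : dv f x l -> derive1 f x = l.
Proof. by move=> h; rewrite derive1E; exact: derive_val. Qed.

Lemma derivable_dv (f : R -> R) (x : R) : derivable f x 1 -> dv f x ((derive1 f) x).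
Proof. by move=> h; rewrite derive1E; exact: derivableP. Qed.

Lemma dv_continuous (f : R -> R) (x l : R) : dv f x l -> {for x, continuous f}.
Proof.
by move=> /dv_derivable h; apply: differentiable_continuous; exact/derivable1_diffP.
Qed.

Lemma dvD (f g : R -> R) (x a b : R) : dv f x a -> dv g x b ->
  dv (fun y => f y + g y) x (a + b).
Proof. by move=> fa gb; exact: is_deriveD. Qed.

Lemma dvM (f g : R -> R) (x a b : R) : dv f x a -> dv g x b ->
  dv (fun y => f y * g y) x (a * g x + f x * b).
Proof.
move=> fa gb; apply: (is_derive_eq (is_deriveM fa gb)).
by rewrite /GRing.scale/= addrC mulrC.
Qed.

Lemma dv_cst (c x : R) : dv (fun=> c) x 0.
Proof. exact: is_derive_cst. Qed.

Lemma dv_id (x : R) : dv id x 1.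
Proof. exact: is_derive_id. Qed.

Lemma dv_comp (f g : R -> R) (x a b : R) : dv f (g x) a -> dv g x b ->
  dv (fun y => f (g y)) x (a * b).
Proof. by move=> fa gb; exact: is_derive1_comp. Qed.

Record smooth1 (f : R -> R) : Prop :=
  Smooth1 { smooth1P : forall n x, derivable (derive1n n f) x 1 }.
Arguments smooth1P {f} sf n x : rename.

Inductive alg (B : (R -> R) -> Prop) : (R -> R) -> Prop :=
| alg_gen g of B g : alg B g
| alg_cst c : alg B (fun=> c)
| alg_add f g of alg B f & alg B g : alg B (fun x => f x + g x)
| alg_mul f g of alg B f & alg B g : alg B (fun x => f x * g x).

(* An algebra of functions whose generators have derivatives in it is closed under
   differentiation, hence consists of smooth functions. *)
Lemma alg_smooth (B : (R -> R) -> Prop) :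
  (forall g, B g -> (forall x, derivable g x 1) /\ alg B (derive1 g)) ->
  forall f, alg B f -> smooth1 f.
Proof.
move=> HB.
have step f : alg B f -> (forall x, derivable f x 1) /\ alg B (derive1 f).
  elim=> {f} [g /HB//|c|f g _ [df af] _ [dg ag]|f g Af [df af] Ag [dg ag]].
  - split=> [x|]; first exact: dv_derivable (dv_cst c x).
    rewrite (_ : derive1 _ = fun=> (0 : R)); first exact: alg_cst.
    by apply/funext => x; rewrite (dvE (dv_cst c x)).
  - have h x := dvD (derivable_dv (df x)) (derivable_dv (dg x)).
    split=> [x|]; first exact: dv_derivable (h x).
    rewrite (_ : derive1 _ = fun x : R => (derive1 f) x + (derive1 g) x); first exact: alg_add.
    by apply/funext => x; rewrite (dvE (h x)).
  - have h x := dvM (derivable_dv (df x)) (derivable_dv (dg x)).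
    split=> [x|]; first exact: dv_derivable (h x).
    rewrite (_ : derive1 _ = fun x : R => (derive1 f) x * g x + f x * (derive1 g) x).
      by apply: alg_add; exact: alg_mul.
    by apply/funext => x; rewrite (dvE (h x)).
move=> f Af; split=> n; elim: n f Af => [|n IH] f Af x.
  exact: (step f Af).1.
by rewrite derive1Sn; apply: IH; exact: (step f Af).2.
Qed.

Lemma smooth_der (f : R -> R) : smooth1 f -> smooth1 (derive1 f).
Proof. by move=> sf; split=> n x; rewrite -derive1Sn; exact: (smooth1P sf). Qed.

Lemma smooth_dern (f : R -> R) n : smooth1 f -> smooth1 (derive1n n f).
Proof. by move=> sf; elim: n => [|n IH]; [exact: sf|rewrite derive1nS; exact: smooth_der]. Qed.

Lemma smooth_dv (f : R -> R) x : smooth1 f -> dv f x ((derive1 f) x).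
Proof. by move=> sf; apply: derivable_dv; exact: (smooth1P sf 0%N). Qed.

Lemma smooth_continuous (f : R -> R) : smooth1 f -> continuous f.
Proof. by move=> sf x; exact: dv_continuous (smooth_dv x sf). Qed.

Lemma smooth_measurable (f : R -> R) : smooth1 f -> measurable_fun setT f.
Proof. by move=> sf; apply: continuous_measurable_fun; exact: smooth_continuous. Qed.

Lemma smooth_cst c : smooth1 (fun=> c).
Proof. by apply: (@alg_smooth (fun=> False)) => //; exact: alg_cst. Qed.

Lemma smooth_id : smooth1 id.
Proof.
apply: (@alg_smooth (eq id)); last exact: alg_gen.
move=> _ <-; split=> [x|]; first exact: dv_derivable (dv_id x).
rewrite (_ : derive1 _ = fun=> (1 : R)); first exact: alg_cst.
by apply/funext => x; rewrite (dvE (dv_id x)).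
Qed.

Let alg_smooth_self f : alg smooth1 f -> smooth1 f.
Proof.
apply: alg_smooth => g sg; split=> [x|]; first exact: (smooth1P sg 0%N).
by apply: alg_gen; exact: smooth_der.
Qed.

Lemma smoothD (f g : R -> R) : smooth1 f -> smooth1 g -> smooth1 (fun x => f x + g x).
Proof. by move=> sf sg; apply: alg_smooth_self; apply: alg_add; exact: alg_gen. Qed.

Lemma smoothM (f g : R -> R) : smooth1 f -> smooth1 g -> smooth1 (fun x => f x * g x).
Proof. by move=> sf sg; apply: alg_smooth_self; apply: alg_mul; exact: alg_gen. Qed.

(** The algebra generated by the smooth functions and by all [derive1n n f] composed with [g] is
    closed under differentiation, by the chain rule. *)
Lemma smooth_comp (f g : R -> R) : smooth1 f -> smooth1 g -> smooth1 (fun x => f (g x)).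
Proof.
move=> sf sg.
apply: (@alg_smooth (fun h => smooth1 h \/ exists n, h = fun x => derive1n n f (g x))); last first.
  by apply: alg_gen; right; exists 0%N.
move=> h [sh|[n ->] {h}].
  by split=> [x|]; [exact: (smooth1P sh 0%N)|apply: alg_gen; left; exact: smooth_der].
have h x := dv_comp (smooth_dv (g x) (smooth_dern n sf)) (smooth_dv x sg).
split=> [x|]; first exact: dv_derivable (h x).
rewrite (_ : derive1 _ = fun x : R => derive1n n.+1 f (g x) * (derive1 g) x).
  apply: alg_mul; apply: alg_gen; first by right; exists n.+1.
  by left; exact: smooth_der.
by apply/funext => x; rewrite (dvE (h x)) derive1nS.
Qed.

Lemma smooth_cos : smooth1 cos.
Proof.
have dc (x : R) : dv cos x (- sin x) by exact: is_derive_cos.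
have ds (x : R) : dv sin x (cos x) by exact: is_derive_sin.
apply: (@alg_smooth (fun h => h = cos \/ h = sin)); last by apply: alg_gen; left.
move=> _ [->|->]; split=> [x|].
- exact: dv_derivable (dc x).
- rewrite (_ : derive1 _ = fun x : R => (-1) * sin x).
    by apply: alg_mul; [exact: alg_cst|apply: alg_gen; right].
  by apply/funext => x; rewrite (dvE (dc x)) mulN1r.
- exact: dv_derivable (ds x).
- rewrite (_ : derive1 _ = cos); first by apply: alg_gen; left.
  by apply/funext => x; rewrite (dvE (ds x)).
Qed.

End Smooth.
Arguments smooth1P {R f} sf n x : rename.

(** * Smooth primitives, periodicity and tensor products *)

Section Primitives.
Context {R : realType}.
Local Notation mu := (@lebesgue_measure R).

Lemma loci_continuous (f : R -> R) : continuous f -> loci f.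
Proof.
move=> cf a b; split; first exact: continuous_measurable_fun.
apply: continuous_compact_integrable; first exact: segment_compact.
exact: continuous_subspaceT.
Qed.

Lemma dv_prim (f : R -> R) (x : R) : continuous f -> dv (prim f) x (f x).
Proof.
(* A base point to the left of both [0] and [x], so that near [x] the oriented primitive is an
   ordinary integral up to a constant. *)
move=> cf; pose A : R := - `|x| - 1.
have Ax : A < x by rewrite /A; have := ler_norm (- x); rewrite normrN; lra.
have A0 : A <= 0 by rewrite /A; have := normr_ge0 x; lra.
have lf := loci_continuous cf.
have /(_ _ (cf x))[|d dE] := @continuous_FTC1 R f (BLeft A) x (x + 1) (ltac:(lra)) (lf A (x + 1)).2; first exact: Ax.
change (derive1 (fun y : R => rint A y f) x = f x) in dE.
change (derivable (fun y : R => rint A y f) x 1) in d.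
apply: (near_eq_is_derive (f := fun y => rint A y f - rint A 0 f)).
  near=> y; have Ay : A <= y by apply: ltW; near: y; exact: lt_nbhsr.
  have pA := primB lf A0; have py := primB lf Ay.
  by move: pA py; rewrite prim0 => pA py; lra.
have hd : dv (fun y => rint A y f) x (f x) by rewrite -dE; exact: derivable_dv.
by have := dvD hd (dv_cst (- rint A 0 f) x); rewrite addr0.
Unshelve. all: by end_near.
Qed.

Lemma smooth_prim (f : R -> R) : smooth1 f -> smooth1 (prim f).
Proof.
move=> sf; have h x := dv_prim x (smooth_continuous sf).
split=> -[|n] x; first exact: dv_derivable (h x).
rewrite derive1Sn (_ : derive1 (prim f) = f); first exact: (smooth1P sf).
by apply/funext => y; rewrite (dvE (h y)).
Qed.

Lemma smooth_ftc (f : R -> R) (a b : R) : smooth1 f -> a <= b ->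
  f b - f a = rint a b (derive1 f).
Proof.
move=> sf ab; have cf := smooth_continuous (smooth_der sf).
rewrite -primB//; last exact: loci_continuous.
have cst0 (x : R) : dv (fun x => f x + (-1) * prim (derive1 f) x) x 0.
  have := dvD (smooth_dv x sf) (dvM (dv_cst (-1) x) (dv_prim x cf)).
  by rewrite /dv mul0r add0r mulN1r subrr.
by have := is_derive_0_is_cst b a cst0; lra.
Qed.

Lemma derive1_periodic (f : R -> R) : smooth1 f -> (forall x, f (x + 1) = f x) ->
  forall x, derive1 f (x + 1) = derive1 f x.
Proof.
move=> sf pf x.
have := dvE (dv_comp (g := fun y : R => y + 1) (smooth_dv (x + 1) sf) (dvD (dv_id x) (dv_cst 1 x))).
rewrite addr0 mulr1 => <-; congr (derive1 _ x).
by apply/funext => y; rewrite pf.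
Qed.

Lemma periodic_reduce (f : R -> R) : (forall x, f (x + 1) = f x) ->
  forall x, exists2 y, 0 <= y <= 1 & f x = f y.
Proof.
move=> pf x; pose n := Num.truncn `|x|.
have [n1 n2] : n%:R <= `|x| /\ `|x| < n.+1%:R.
  by have /andP[] := Num.Theory.truncn_itv (normr_ge0 x).
rewrite -natr1 in n2.
case: (leP 0 x) => x0.
  exists (x - n%:R); last by rewrite (periodic_int pf n x).2.
  by move: n1 n2; rewrite ger0_norm// => n1 n2; apply/andP; split; lra.
exists (x + n%:R + 1); last by rewrite pf (periodic_int pf n x).1.
by move: n1 n2; rewrite ltr0_norm// => n1 n2; apply/andP; split; lra.
Qed.

Lemma continuous_periodic_bounded (f : R -> R) : continuous f ->
  (forall x, f (x + 1) = f x) -> exists C, forall x, `|f x| <= C.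
Proof.
move=> cf pf.
have [|c c01 hc] := @EVT_max R (fun x => `|f x|) 0 1 ler01.
  apply: continuous_subspaceT => x; apply: continuous_comp; first exact: cf.
  exact: norm_continuous.
exists `|f c| => x; have [y y01 ->] := periodic_reduce pf x.
by apply: hc; rewrite in_itv.
Qed.

Lemma prim_mean_periodic (f : R -> R) : (forall x, f (x + 1) = f x) -> loci f ->
  rint 0 1 f = 0 -> forall x, prim f (x + 1) = prim f x.
Proof.
move=> pf lf f0 x; apply/eqP; rewrite -subr_eq0 primB//; last by lra.
by rewrite rint_periodic// f0.
Qed.

Let dtM (th k : R -> R) : smooth1 th ->
  dt (fun t x => th t * k x) = fun t x => derive1 th t * k x.
Proof.
move=> sth; apply/funext => t; apply/funext => x; rewrite /dt.
by rewrite (dvE (dvM (smooth_dv t sth) (dv_cst (k x) t))) mulr0 addr0.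
Qed.

Let dxM (th k : R -> R) : smooth1 k ->
  dx (fun t x => th t * k x) = fun t x => th t * derive1 k x.
Proof.
move=> sk; apply/funext => t; apply/funext => x; rewrite /dx.
by rewrite (dvE (dvM (dv_cst (th t) x) (smooth_dv x sk))) mul0r add0r.
Qed.

Lemma dt_tensor (th k : R -> R) t x : smooth1 th ->
  dt (fun t x => th t * k x) t x = derive1 th t * k x.
Proof. by move=> sth; rewrite dtM. Qed.

Lemma dx_tensor (th k : R -> R) t x : smooth1 k ->
  dx (fun t x => th t * k x) t x = th t * derive1 k x.
Proof. by move=> sk; rewrite dxM. Qed.

(** Every iterated partial derivative of a tensor product is again a tensor product of smooth
    functions, by induction on the word of derivatives. *)
Lemma test_fun_tensor (th k : R -> R) (T : R) :
  smooth1 th -> smooth1 k -> (forall t, T <= t -> th t = 0) ->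
  (forall x, k (x + 1) = k x) -> test_fun (fun t x => th t * k x).
Proof.
move=> sth sk thT pk; split; last first.
- by exists T => t x tT; rewrite thT// mul0r.
- by move=> t x; rewrite pk.
move=> w.
have [th' [k' [sth' sk' ->]]] : exists th' k', [/\ smooth1 th', smooth1 k' &
    pdiff w (fun t x => th t * k x) = fun t x => th' t * k' x].
  elim: w => [|b w [th' [k' [sth' sk' IH]]]] /=; first by exists th, k.
  rewrite IH; case: b.
    exists (derive1 th'), k'; split; [exact: smooth_der|exact: sk'|exact: dtM].
  exists th', (derive1 k'); split; [exact: sth'|exact: smooth_der|exact: dxM].
split=> [t x|p].
  split; apply: dv_derivable.
    exact: (dvM (smooth_dv t sth') (dv_cst (k' x) t)).
  exact: (dvM (dv_cst (th' t) x) (smooth_dv x sk')).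
apply: cvgM; apply: continuous_comp.
- exact: cvg_fst.
- exact: smooth_continuous.
- exact: cvg_snd.
- exact: smooth_continuous.
Qed.

End Primitives.

(** * Smooth kernels, and equations tested in time *)

Section Bump.
Context {R : realType}.
Local Notation mu := (@lebesgue_measure R).

(* [bump n y = y^-n exp (- 1/y)] for [y > 0]: the derivative of [bump n] is
   [bump n.+2 - n bump n.+1], and all of these vanish to second order at [0]. *)
Definition bump (n : nat) (y : R) : R :=
  if 0 < y then y^-1 ^+ n * expR (- y^-1) else 0.

Lemma bump_ge0 n y : 0 <= bump n y.
Proof.
rewrite /bump; case: ifP => // y0; apply: mulr_ge0; last exact: expR_ge0.
by apply: exprn_ge0; rewrite invr_ge0 ltW.
Qed.

Lemma bump_npos n y : y <= 0 -> bump n y = 0.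
Proof. by rewrite /bump ltNge => ->. Qed.

Lemma expR_monomial (s : R) n : 0 <= s -> s ^+ n * expR (- s) <= n`!%:R.
Proof.
move=> s0; rewrite expRN ler_pdivrMr ?expR_gt0//.
case: n => [|n].
  by rewrite expr0 fact0 mul1r -expR0 ler_expR.
have := expR_ge1Dxn n s0.
set F : R := (n.+1)`!%:R => h.
have F0 : 0 < F by rewrite /F ltr0n fact_gt0.
by rewrite mulrC -ler_pdivrMr//; lra.
Qed.

Lemma bump_le n y : bump n y <= n`!%:R.
Proof.
rewrite /bump; case: ifP => [y0|_]; last exact: ler0n.
by apply: expR_monomial; rewrite invr_ge0 ltW.
Qed.

Lemma bump_quadratic n y : `|bump n y| <= (n.+2)`!%:R * y ^+ 2.
Proof.
rewrite ger0_norm ?bump_ge0// /bump; case: ifP => [y0|_]; last first.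
  by apply: mulr_ge0; [exact: ler0n|exact: sqr_ge0].
rewrite -ler_pdivrMr ?exprn_gt0// mulrAC -exprVn -exprD addnC add2n.
by apply: expR_monomial; rewrite invr_ge0 ltW.
Qed.

Lemma dv_bump n (y : R) : dv (bump n) y (bump n.+2 y - n%:R * bump n.+1 y).
Proof.
have [y0|y0|y0] := ltgtP y 0.
- rewrite !bump_npos ?(ltW y0)// mulr0 subr0.
  apply: near_eq_is_derive (dv_cst 0 y); near=> z.
  by rewrite bump_npos//; apply: ltW; near: z; exact: lt_nbhsl.
- have dV : dv (fun z : R => z^-1) y (- (y^-1 ^+ 2)).
    have := is_deriveV (lt0r_neq0 y0) (dv_id y).
    by rewrite /GRing.scale/= mulr1 exprVn.
  have dX : dv (fun z : R => z^-1 ^+ n) y (n%:R * y^-1 ^+ n.-1 * - (y^-1 ^+ 2)).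
    rewrite (_ : (fun z : R => z^-1 ^+ n) = (fun z : R => z^-1) ^+ n); first exact: is_deriveX.
    by apply/funext => z; rewrite exprfctE.
  have dE : dv (fun z : R => expR (- z^-1)) y (expR (- y^-1) * (y^-1 ^+ 2)).
    apply: (dv_comp (f := expR) (g := fun z : R => - z^-1)); first exact: is_derive_expR.
    by have := is_deriveN dV; rewrite opprK.
  apply: near_eq_is_derive; last first.
    apply: (is_derive_eq (dvM dX dE)); rewrite /bump y0.
    case: n {dX} => [|n] /=; rewrite ?expr0 !exprS; ring.
  near=> z; rewrite /bump ifT//; near: z; exact: lt_nbhsr.
- rewrite y0 !bump_npos// mulr0 subr0.
  have cv : (fun h : R => h^-1 *: (bump n (h + 0) - bump n 0)) @ (0 : R)^' --> (0 : R).
    rewrite (bump_npos n (lexx 0)).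
    apply/cvgrPdist_le => e e0; near=> h; rewrite sub0r normrN.
    have h0 : h != 0 by near: h; exact: nbhs_dnbhs_neq.
    have F0 : 0 < (n.+2)`!%:R :> R by rewrite ltr0n fact_gt0.
    have he : `|h| <= e / (n.+2)`!%:R by near: h; apply: dnbhs0_le; exact: divr_gt0.
    rewrite /GRing.scale/= subr0 addr0 normrM normfV ler_pdivrMl ?normr_gt0//.
    apply: le_trans (bump_quadratic n h) _.
    rewrite -real_normK ?num_real// expr2 mulrA mulrC ler_wpM2l//.
    by rewrite mulrC -ler_pdivlMr.
  apply: DeriveDef.
    apply/cvg_ex; exists 0.
    rewrite (_ : (fun _ => _) = (fun h : R => h^-1 *: (bump n (h + 0) - bump n 0)))//.
    by apply/funext => h /=; rewrite /GRing.scale/= mulr1.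
  by rewrite -derive1E; exact: cvg_lim.
Unshelve. all: by end_near.
Qed.

Lemma smooth_bump n : smooth1 (bump n).
Proof.
apply: (@alg_smooth _ (fun h => exists n, h = bump n)); last first.
  by apply: alg_gen; exists n.
move=> h [m ->]; split=> [x|]; first exact: dv_derivable (dv_bump m x).
rewrite (_ : derive1 _ = fun x : R => bump m.+2 x + (- m%:R) * bump m.+1 x).
  apply: alg_add; first by apply: alg_gen; exists m.+2.
  by apply: alg_mul; [exact: alg_cst|apply: alg_gen; exists m.+1].
by apply/funext => x; rewrite (dvE (dv_bump m x)) mulNr.
Qed.

Lemma cvg_inv_nat (f : nat -> R) (l C : R) :
  (forall n, `|f n - l| <= C / n.+1%:R) -> f @ \oo --> l.
Proof.
move=> fC.
have h : (fun n => C * n.+1%:R^-1) @ \oo --> (0 : R).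
  by rewrite -(mulr0 C); apply: cvgM; [exact: cvg_cst|exact: cvg_harmonic].
apply: (@squeeze_cvgr _ _ _ _ (fun n => l - C * n.+1%:R^-1) (fun n => l + C * n.+1%:R^-1)).
- by apply: nearW => n; have := fC n => /=; set z := C / _; rewrite ler_norml => /andP[a b]; apply/andP; split; lra.
- by rewrite -[X in _ --> X]subr0; apply: cvgB; [exact: cvg_cst|exact: h].
- by rewrite -[X in _ --> X]addr0; apply: cvgD; [exact: cvg_cst|exact: h].
Qed.

(** The cases [k = 0] and [k = 1] are those that occur in [cutoff] and its derivative. *)
Lemma bump_cvg (k : nat) (y : R) : (k < 2)%N -> 0 < y ->
  (fun n => bump k (n.+1%:R * y)) @ \oo --> ((k == 0%N)%:R : R).
Proof.
move=> k2 y0; apply: (@cvg_inv_nat _ _ y^-1) => n.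
rewrite -invfM mulrC [y * _]mulrC.
have : 0 < n.+1%:R * y by apply: mulr_gt0.
set z := _ * y => z0.
have zV : 0 < z^-1 by rewrite invr_gt0.
have e1 : expR (- z^-1) <= 1 by rewrite -expR0 ler_expR; lra.
have e2 := expR_ge1Dx (- z^-1); have e0 := expR_ge0 (- z^-1).
case: k k2 => [|[|//]] _; rewrite /bump z0.
  by rewrite expr0 mul1r (_ : (0%N == 0%N)%:R = 1 :> R)// distrC ger0_norm; lra.
by rewrite expr1 subr0 ger0_norm; [nra|apply: mulr_ge0 => //; lra].
Qed.

Lemma bump0_le1 (y : R) : bump 0 y <= 1.
Proof. by have := bump_le 0 y; rewrite fact0. Qed.

Lemma bump1_le1 (y : R) : bump 1 y <= 1.
Proof. by have := bump_le 1 y. Qed.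

(** For [r] and [x] in [[0, 1]] the difference of cosines is positive exactly when [x] lies in []0,
    r[]. Composition with [bump 0], steepened by the factor [n.+1], gives a smooth function of
    period [1] tending to the indicator of that interval. *)
Definition kern (n : nat) (r x : R) : R :=
  bump 0 (n.+1%:R * (cos (2 * pi * (x - r / 2)) - cos (pi * r))).

Lemma smooth_affine (a b : R) : smooth1 (fun x => a * x + b).
Proof.
exact: (smoothD (smoothM (smooth_cst a) smooth_id) (smooth_cst b)).
Qed.

Lemma smooth_kern n r : smooth1 (kern n r).
Proof.
have h : smooth1 (fun x : R => 2 * pi * x + (- (2 * pi * (r / 2)))) by exact: smooth_affine.
have := smooth_comp (smooth_bump 0) (smooth_comp (smooth_affine n.+1%:R (- (n.+1%:R * cos (pi * r))))
   (smooth_comp smooth_cos h)).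
rewrite (_ : (fun _ => _) = kern n r)//.
apply/funext => x; rewrite /kern; congr bump; rewrite mulrBr; congr (_ * cos _ + _); ring.
Qed.

Lemma kern_periodic n r x : kern n r (x + 1) = kern n r x.
Proof.
rewrite /kern -[in RHS]cosD2pi; congr bump; congr (_ * (cos _ - _)).
by rewrite mulr2n; ring.
Qed.

Lemma kern_itv n r x : 0 <= kern n r x <= 1.
Proof. by rewrite bump_ge0 bump0_le1. Qed.

Lemma kern_cvg (r x : R) : 0 <= r <= 1 -> 0 <= x <= 1 ->
  (fun n : nat => kern n r x) @ \oo --> ((0 < x < r)%R%:R : R).
Proof.
move=> /andP[r0 r1] /andP[x0 x1]; rewrite /kern.
have p0 := pi_gt0 R.
have -> : cos (2 * pi * (x - r / 2)) = cos (2 * pi * `|x - r / 2|).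
  by case: ger0P => // _; rewrite mulrN cosN.
set z := `|_|; have z0 : 0 <= z by exact: normr_ge0.
have pr : pi * r \in `[0, pi] by rewrite in_itv/=; apply/andP; split; nra.
have zr : z <= 1 - r / 2 by rewrite /z ler_norml; apply/andP; split; lra.
have [/andP[xp xr]|nx] := boolP (0 < x < r).
  have zr2 : z < r / 2 by rewrite /z ltr_norml; apply/andP; split; lra.
  apply: bump_cvg => //; rewrite subr_gt0 ltr_cos//; first by nra.
  by rewrite in_itv/=; apply/andP; split; nra.
have zr2 : r / 2 <= z.
  rewrite leNgt; apply: contra nx; rewrite /z ltr_norml => /andP[a b].
  by apply/andP; split; lra.
suff le : cos (2 * pi * z) <= cos (pi * r).
  rewrite (_ : (fun _ => _) = fun=> 0); first exact: cvg_cst.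
  by apply/funext => n; rewrite bump_npos//; apply: mulr_ge0_le0 => //; rewrite subr_le0.
have mono w : r / 2 <= w -> w <= 1 / 2 -> cos (2 * pi * w) <= cos (pi * r).
  move=> rw w2; rewrite leNgt ltr_cos//; last by rewrite in_itv/=; apply/andP; split; nra.
  by rewrite -leNgt; nra.
(* The distance [z] may exceed half a period; the cosine then takes the same value at [1 - z], which
   is still at least [r / 2]. *)
case: (leP z (1 / 2)) => z2; first exact: mono.
have -> : cos (2 * pi * z) = cos (2 * pi * (1 - z)).
  rewrite -[RHS]cosN -[RHS]cosD2pi; congr cos; rewrite mulr2n; ring.
by apply: mono; lra.
Qed.

Lemma ae_neq (c : R) : {ae mu, forall x, x != c}.
Proof.
exists [set c]; split; [exact: measurable_set1|exact: lebesgue_measure_set1|].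
by move=> x /= /negP; rewrite negbK => /eqP.
Qed.

Lemma kern_rint_cvg (f : R -> R) (r : R) : ib 0 1 f -> 0 <= r <= 1 ->
  (fun n => rint 0 1 (fun x => f x * kern n r x)) @ \oo --> rint 0 r f.
Proof.
move=> fi r01; have /andP[r0 r1] := r01; have mf := fi.1.
have mi : measurable_fun setT (fun x : R => f x * (0 < x < r)%R%:R).
  apply: measurable_funM => //.
  rewrite (_ : (fun _ => _) = fun x : R => if (0 < x) && (x < r) then 1 else 0); last first.
    by apply/funext => x; case: ifP.
  by apply: measurable_fun_ifT => //; apply: measurable_and; exact: measurable_fun_ltr.
have il : ib 0 1 (fun x : R => f x * (0 < x < r)%R%:R).
  apply: (ib_le mi (ib_norm fi)) => x _; rewrite normrM ler_piMr//.
  by case: (0 < x < r); rewrite ?normr1 ?normr0.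
have -> : rint 0 r f = rint 0 1 (fun x => f x * (0 < x < r)%R%:R).
  rewrite (rint_cat r0 r1 il) [X in _ + X](_ : _ = 0) ?addr0; last first.
    rewrite (_ : rint r 1 _ = rint r 1 (fun=> 0)); last first.
      apply: eq_rint => x /andP[rx _].
      by rewrite [x < r]ltNge rx andbF mulr0.
    by rewrite rint_cst// mul0r.
  apply: eq_rint_ae => //; move: (ae_neq 0) (ae_neq r); apply: ae_imp2 => x x0 xr /andP[x1 x2].
  by rewrite !lt_neqAle eq_sym x0 x1 xr x2 mulr1.
apply: (@rint_dct R 0 1 _ _ (fun x => `|f x|)) => //.
- by move=> n; apply: measurable_funM => //; exact: (smooth_measurable (smooth_kern n r)).
- exact: ib_norm.
- apply: ae_all => x x01; apply: cvgM; [exact: cvg_cst|exact: kern_cvg].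
- apply: ae_all => x x01 n; rewrite normrM ler_piMr//.
  by have /andP[a b] := kern_itv n r x; rewrite ger0_norm.
Qed.

(** In the limit the integrals of [f] over [[0, r]] vanish for rational [r], then for all [r] by
    absolute continuity, and Lebesgue differentiation concludes. A countable family is essential: it
    allows one null set of times for all tests. *)
Lemma kern_separates (f : R -> R) : ib 0 1 f ->
  (forall n (r : rat), rint 0 1 (fun x => f x * kern n (ratr r) x) = 0) ->
  {ae mu, forall x, 0 <= x <= 1 -> f x = 0}.
Proof.
move=> fi f0.
have rat0 (r : rat) : 0 <= (ratr r : R) <= 1 -> rint 0 (ratr r) f = 0.
  move=> r01; have := kern_rint_cvg fi r01.
  rewrite (_ : (fun _ => _) = fun=> 0); last by apply/funext => n; exact: f0.
  move=> h; apply/esym; apply: (cvg_unique _ _ h) => //; exact: cvg_cst.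
apply: rint_ae0 => // x /andP[x0 x1]; apply/eqP; rewrite -normr_le0.
have [->|xn0] := eqVneq x 0; first by rewrite rint_pt// normr0.
apply/ler_addgt0Pr => e e0; rewrite add0r.
have [eta eta0 He] := ib_modulus fi e0.
have xp : 0 < x by rewrite lt_neqAle eq_sym xn0.
have lt : Num.max 0 (x - eta) < x by rewrite gt_max xp; lra.
have [r] := rat_in_itvoo lt.
rewrite in_itv/= gt_max => /andP[/andP[r0 re] rx].
have rr : 0 <= (ratr r : R) <= 1 by rewrite (ltW r0) (le_trans (ltW rx)).
have fx : ib 0 x f by apply: ibS fi.
rewrite (rint_cat (ltW r0) (ltW rx) fx) (rat0 _ rr) add0r.
apply: le_trans (rint_norm (ibS (ltW r0) (lexx x) fx)) _.
by apply: He => //; [exact: ltW|exact: ltW|lra].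
Qed.

Definition cutoff (n : nat) (T t : R) : R := (T - t) * bump 0 (n.+1%:R * (T - t)).

Lemma smooth_cutoff n T : smooth1 (cutoff n T).
Proof.
have h (a : R) : smooth1 (fun t => a * (T - t)).
  have := smooth_affine (- a) (a * T).
  by rewrite (_ : (fun _ => _) = (fun t => a * (T - t)))//; apply/funext => t; ring.
have h1 : smooth1 (fun t => T - t).
  by have := h 1; rewrite (_ : (fun _ => _) = (fun t => T - t))//; apply/funext => t; rewrite mul1r.
exact: (smoothM h1 (smooth_comp (smooth_bump 0) (h n.+1%:R))).
Qed.

Lemma cutoff_ge n T t : T <= t -> cutoff n T t = 0.
Proof. by move=> Tt; rewrite /cutoff bump_npos ?mulr0// mulr_ge0_le0// subr_le0. Qed.

Lemma derive1_cutoff n (T t : R) : derive1 (cutoff n T) t =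
  - (bump 0 (n.+1%:R * (T - t)) + bump 1 (n.+1%:R * (T - t))).
Proof.
have d1 : dv (fun t : R => T - t) t (-1).
  have := dvD (dv_cst T t) (dvM (dv_cst (-1) t) (dv_id t)).
  rewrite mul0r add0r mulr1 add0r (_ : (fun _ => _) = (fun t => T - t))//.
  by apply/funext => y; rewrite mulN1r.
have d2 : dv (fun t : R => n.+1%:R * (T - t)) t (- n.+1%:R).
  have := dvM (dv_cst n.+1%:R t) d1.
  by rewrite mul0r add0r mulrN1.
rewrite (dvE (dvM d1 (dv_comp (dv_bump 0 _) d2))) mul0r subr0 mulN1r opprD.
congr (_ + _).
(* The point is [z * bump 2 z = bump 1 z], which keeps the derivative of the cutoff bounded
   uniformly in [n]. *)
rewrite [in RHS]/bump /bump; case: ifP => [z0|]; last by rewrite !mul0r mulr0 oppr0.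
set z := _ * (T - t) in z0 *.
have z1 : z != 0 by exact: lt0r_neq0.
rewrite mulrN mulrN mulrC -mulrA -mulrA [n.+1%:R * _]mulrC [_ * n.+1%:R]mulrC -/z.
by congr (- _); rewrite expr1 expr2 [_ * z]mulrC; field.
Qed.

(** Cutoffs tending to [(T - t)_+] have uniformly bounded derivatives, so dominated convergence
    applies without any choice of Lebesgue points. The limit, integrated by parts, says that
    [A0 + rint 0 t B - A t] has integral [0] over [[0, T]] for every [T]. *)
Lemma time_evolution (A B : R -> R) (A0 : R) :
  (forall T, 0 <= T -> ib 0 T A /\ ib 0 T B) ->
  (forall th T, 0 <= T -> smooth1 th -> (forall t, T <= t -> th t = 0) ->
     rint 0 T (fun t => derive1 th t * A t + th t * B t) + th 0 * A0 = 0) ->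
  {ae mu, forall t, 0 <= t -> A t = A0 + rint 0 t B}.
Proof.
move=> iAB H.
have mA : measurable_fun setT A by exact: (iAB 0 (lexx 0)).1.1.
have mB : measurable_fun setT B by exact: (iAB 0 (lexx 0)).2.1.
have mb : measurable_fun setT (fun t : R => rint 0 t B).
  apply: (@measurable_rint_param R _ _ (fun=> B) (fun=> 0) id) => //.
  exact: (measurableT_comp mB measurable_snd).
have key T : 0 <= T -> rint 0 T (fun t => rint 0 t B + A0 - A t) = 0.
  move=> T0; have [iA iB] := iAB T T0.
  have mth n : measurable_fun setT (cutoff n T) by exact: smooth_measurable (smooth_cutoff n T).
  have mth' n : measurable_fun setT (derive1 (cutoff n T)).
    exact: smooth_measurable (smooth_der (smooth_cutoff n T)).
  have mT : measurable_fun setT (fun t : R => T - t).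
    by apply: measurable_funB; [exact: measurable_cst|exact: measurable_id].
  have iTB : ib 0 T (fun t => (T - t) * B t).
    rewrite (_ : (fun _ => _) = fun t => B t * (T - t)); last by apply/funext => t; rewrite mulrC.
    apply: (@ibM _ _ _ T) => //; apply: ae_all => t /andP[t0 tT].
    by rewrite ger0_norm; lra.
  have c1 : (fun n => rint 0 T (fun t => derive1 (cutoff n T) t * A t + cutoff n T t * B t))
      @ \oo --> rint 0 T (fun t => (-1) * A t + (T - t) * B t).
    apply: (@rint_dct R 0 T _ _ (fun t => 2 * `|A t| + T * `|B t|)).
    - by move=> n; apply: measurable_funD; exact: measurable_funM.
    - by apply: measurable_funD; apply: measurable_funM => //; exact: measurable_cst.
    - by apply: ibD; apply: ibZ; exact: ib_norm.
    - apply: ae_imp (ae_neq T) => t tT /andP[t0 t1].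
      have tT' : 0 < T - t by rewrite subr_gt0 lt_neqAle tT.
      apply: cvgD; apply: cvgM; try exact: cvg_cst.
        rewrite (_ : (fun _ => _) = fun n => - (bump 0 (n.+1%:R * (T - t)) + bump 1 (n.+1%:R * (T - t)))).
          rewrite -[X in _ --> - X]addr0; apply: cvgN; apply: cvgD.
            exact: (@bump_cvg 0).
          exact: (@bump_cvg 1).
        by apply/funext => n; exact: derive1_cutoff.
      rewrite -[X in _ --> X]mulr1; apply: cvgM; first exact: cvg_cst.
      exact: (@bump_cvg 0).
    - apply: ae_all => t /andP[t0 t1] n; apply: le_trans (ler_normD _ _) _.
      rewrite !normrM; apply: lerD; apply: ler_wpM2r => //.
        rewrite derive1_cutoff normrN ger0_norm ?addr_ge0 ?bump_ge0//.
        by have := bump0_le1 (n.+1%:R * (T - t)); have := bump1_le1 (n.+1%:R * (T - t)); lra.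
      rewrite /cutoff ?normrM [`|bump _ _|]ger0_norm ?bump_ge0// ger0_norm; last by lra.
      apply: le_trans (_ : T * 1 <= _); last by rewrite mulr1.
      by apply: ler_pM; rewrite ?bump_ge0 ?bump0_le1//; lra.
  have c2 : (fun n => cutoff n T 0 * A0) @ \oo --> T * A0.
    have [->|T0'] := eqVneq T 0.
      rewrite mul0r (_ : (fun _ => _) = fun=> 0); first exact: cvg_cst.
      by apply/funext => n; rewrite cutoff_ge// mul0r.
    apply: cvgM; last exact: cvg_cst.
    rewrite -[X in _ --> X]mulr1 /cutoff subr0; apply: cvgM; first exact: cvg_cst.
    by apply: (@bump_cvg 0) => //; rewrite lt_neqAle eq_sym T0'.
  have e1 : rint 0 T (fun t => (-1) * A t + (T - t) * B t) + T * A0 = 0.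
    have h : (fun _ : nat => 0 : R) @ \oo -->
        rint 0 T (fun t => (-1) * A t + (T - t) * B t) + T * A0.
      rewrite (_ : (fun _ => 0) = fun n => rint 0 T (fun t =>
        derive1 (cutoff n T) t * A t + cutoff n T t * B t) + cutoff n T 0 * A0).
        exact: cvgD.
      apply/funext => n; apply/esym; apply: (H _ T) => //; first exact: smooth_cutoff.
      by move=> t; exact: cutoff_ge.
    by apply/esym; apply: (cvg_unique _ _ h) => //; exact: cvg_cst.
  have [ip] := @rint_prod R 0 T (fun t => T - t) (fun t => rint 0 t B) (fun=> -1) B T0
    (ib_cst 0 T (-1)) iB mT mb
    (ltac:(move=> x y _ xy _; rewrite rint_cst//; lra))
    (ltac:(move=> x y x0 xy yT; rewrite /= (rint_cat x0 xy (ibS (lexx 0) yT iB)); lra)).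
  rewrite subrr mul0r [rint 0 0 B]rint_pt// mulr0 subrr /= => e2.
  have ib_ : ib 0 T (fun t => rint 0 t B).
    have := ibB iTB ip; congr ib; apply/funext => t /=; lra.
  move: e1; rewrite (rintD (ibZ (-1) iA) iTB) rintZ// => e1.
  move: e2; rewrite (rintD (ibZ (-1) ib_) iTB) rintZ// => e2.
  have iA0 := ib_cst 0 T A0.
  by rewrite (rintB (ibD ib_ iA0) iA) (rintD ib_ iA0) rint_cst//; lra.
have aeN (N : nat) : {ae mu, forall t, 0 <= t <= N%:R -> rint 0 t B + A0 - A t = 0}.
  apply: rint_ae0 => [|x /andP[x0 _]]; last exact: key.
  have [iA iB] := iAB N%:R (ler0n R N).
  apply: ibB => //; apply: ibD; last exact: ib_cst.
  apply: (@ib_bounded _ _ _ (rint 0 N%:R (fun t => `|B t|))) => //.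
  apply: ae_all => t /andP[t0 tN]; have h := ibS (lexx 0) tN iB.
  apply: le_trans (rint_norm h) _.
  rewrite (rint_cat t0 tN (ib_norm iB)) lerDl; exact: rint_ge0.
apply: ae_imp (ae_foralln aeN) => t Ht t0.
have := Ht (Num.truncn t).+1; rewrite t0 (ltW (truncnS_gt t)) => /(_ isT); lra.
Qed.

End Bump.

(** * From the weak formulation to good solutions *)

Section WeakEvolution.
Context {R : realType}.
Local Notation mu := (@lebesgue_measure R).

Lemma Rintegral_tail (F : R -> R) (T : R) : (forall t, T < t -> F t = 0) ->
  \int[mu]_(t in `[0%R, +oo[) F t = rint 0 T F.
Proof.
move=> FT; rewrite /rint Rintegral_mkcond [RHS]Rintegral_mkcond; congr Rintegral.
apply/funext => t; rewrite !patchE.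
case: (leP t T) => tT.
  rewrite (_ : (t \in `[0%R, +oo[%classic) = (t \in `[0%R, T]%classic))//.
  by apply/idP/idP; rewrite !inE/= !in_itv/= ?tT andbT.
by rewrite FT//; case: ifP => _; case: ifP => _.
Qed.

Lemma jmM (f g : R -> R -> R) : measurable_fun setT (fun p : R * R => f p.1 p.2) ->
  measurable_fun setT (fun p : R * R => g p.1 p.2) ->
  measurable_fun setT (fun p : R * R => f p.1 p.2 * g p.1 p.2).
Proof. by move=> mf mg; exact: measurable_funM. Qed.

Lemma jm1 (f : R -> R) : measurable_fun setT f ->
  measurable_fun setT (fun p : R * R => f p.1).
Proof. by move=> mf; exact: (measurableT_comp mf measurable_fst). Qed.

Lemma jm2 (f : R -> R) : measurable_fun setT f ->
  measurable_fun setT (fun p : R * R => f p.2).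
Proof. by move=> mf; exact: (measurableT_comp mf measurable_snd). Qed.

Lemma measurable_rint01 (f : R -> R -> R) (a b : R) :
  measurable_fun setT (fun p : R * R => f p.1 p.2) ->
  measurable_fun setT (fun t : R => rint a b (f t)).
Proof.
by move=> mf; apply: (@measurable_rint_param R _ _ f (fun=> a) (fun=> b)).
Qed.

Lemma continuous_bounded_itv (f : R -> R) (a b : R) : continuous f -> a <= b ->
  exists C, forall x, a <= x <= b -> `|f x| <= C.
Proof.
move=> cf ab.
have [|c c01 hc] := @EVT_max R (fun x => `|f x|) a b ab.
  apply: continuous_subspaceT => x; apply: continuous_comp; first exact: cf.
  exact: norm_continuous.
by exists `|f c| => x xab; apply: hc; rewrite in_itv.
Qed.

(** The form shared by (ii), where [F1 = u] and [F2 = u^3 / 3], and by (iv), where [F1 = u_x^2] and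
    [F2 = u^2 u_x^2]. The bounds are asked at almost every time, as the slices are controlled only
    there. *)
Lemma weak_evolution (F1 F2 F3 : R -> R -> R) (F0 : R -> R) (C : R) :
  measurable_fun setT (fun p : R * R => F1 p.1 p.2) ->
  measurable_fun setT (fun p : R * R => F2 p.1 p.2) ->
  measurable_fun setT (fun p : R * R => F3 p.1 p.2) ->
  ib 0 1 F0 ->
  {ae mu, forall t, 0 <= t ->
    [/\ ib 0 1 (F1 t) /\ rint 0 1 (fun x => `|F1 t x|) <= C,
        ib 0 1 (F2 t) /\ rint 0 1 (fun x => `|F2 t x|) <= C &
        ib 0 1 (F3 t) /\ rint 0 1 (fun x => `|F3 t x|) <= C]} ->
  (forall psi, test_fun psi ->
    integRS (fun t x => F1 t x * dt psi t x - F2 t x * dx psi t x) =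
    - integRS (fun t x => F3 t x * psi t x) - integS (fun x => F0 x * psi 0 x)) ->
  forall k, smooth1 k -> (forall x, k (x + 1) = k x) ->
  {ae mu, forall t, 0 <= t ->
    rint 0 1 (fun x => F1 t x * k x) = rint 0 1 (fun x => F0 x * k x) +
    rint 0 t (fun s => rint 0 1 (fun x => F3 s x * k x) -
                       rint 0 1 (fun x => F2 s x * derive1 k x))}.
Proof.
move=> m1 m2 m3 i0 good H k sk pk.
have sk' := smooth_der sk.
have mk := smooth_measurable sk; have mk' := smooth_measurable sk'.
have [K kK] := continuous_periodic_bounded (smooth_continuous sk) pk.
have [K' kK'] := continuous_periodic_bounded (smooth_continuous sk') (derive1_periodic sk pk).
have jk (F : R -> R -> R) (g : R -> R) : measurable_fun setT (fun p : R * R => F p.1 p.2) ->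
    measurable_fun setT g -> measurable_fun setT (fun t : R => rint 0 1 (fun x => F t x * g x)).
  move=> mF mg; apply: (@measurable_rint01 (fun t x => F t x * g x)).
  by apply: (@jmM F (fun _ => g)) => //; exact: jm2.
have ik (F g : R -> R) (L : R) : ib 0 1 F -> measurable_fun setT g ->
    (forall x, `|g x| <= L) -> ib 0 1 (fun x => F x * g x).
  by move=> iF mg gL; apply: (ibM iF mg (C := L)); exact: ae_all.
have bk (F g : R -> R) (L : R) : ib 0 1 F -> rint 0 1 (fun x => `|F x|) <= C ->
    measurable_fun setT g ->
    (forall x, `|g x| <= L) -> `|rint 0 1 (fun x => F x * g x)| <= L * C.
  move=> iF FC mg gL; have L0 : 0 <= L := le_trans (normr_ge0 _) (gL 0).
  apply: (@le_trans _ _ (rint 0 1 (fun x => L * `|F x|))).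
    apply: rint_norm_le => [||x _].
    - by apply: measurable_funM => //; exact: iF.1.
    - by apply: ibZ; exact: ib_norm.
    - by rewrite normrM mulrC; apply: ler_wpM2r.
  by rewrite rintZ ?ler_wpM2l//; exact: ib_norm.
apply: time_evolution => [T T0|th T T0 sth thT].
  split; [apply: (@ib_bounded _ _ _ (K * C))|apply: (@ib_bounded _ _ _ (K * C + K' * C))].
  - exact: jk.
  - apply: ae_imp good => t Ht /andP[t0 _]; have [[a b] _ _] := Ht t0; exact: bk.
  - by apply: measurable_funB; exact: jk.
  - apply: ae_imp good => t Ht /andP[t0 _]; have [_ [a b] [c d]] := Ht t0.
    by apply: le_trans (ler_normB _ _) _; apply: lerD; exact: bk.
have sth' := smooth_der sth.
have mth := smooth_measurable sth; have mth' := smooth_measurable sth'.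
have th'T t : T < t -> derive1 th t = 0.
  move=> Tt; apply: dvE; apply: near_eq_is_derive (dv_cst 0 t); near=> s.
  by rewrite thT//; apply: ltW; near: s; exact: lt_nbhsr.
have := H _ (test_fun_tensor sth sk thT pk).
rewrite (_ : (fun t x => F1 t x * dt _ t x - _) =
    (fun t x => F1 t x * (derive1 th t * k x) - F2 t x * (th t * derive1 k x))); last first.
  by apply/funext => t; apply/funext => x; rewrite dt_tensor// dx_tensor.
pose L t := rint 0 1 (fun x => F1 t x * (derive1 th t * k x) - F2 t x * (th t * derive1 k x)).
pose N t := rint 0 1 (fun x => F3 t x * (th t * k x)).
rewrite /integRS -/(L _) -/(N _) (Rintegral_tail (F := L) (T := T)); last first.
  move=> t Tt; rewrite /L th'T// (thT t (ltW Tt)).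
  rewrite (@eq_rint R 0 1 _ (fun=> 0)); last by move=> x _; rewrite !mul0r !mulr0 subrr.
  by rewrite rint_cst ?mul0r.
rewrite (Rintegral_tail (F := N) (T := T)); last first.
  move=> t Tt; rewrite /N (thT t (ltW Tt)).
  rewrite (@eq_rint R 0 1 _ (fun=> 0)); last by move=> x _; rewrite mul0r mulr0.
  by rewrite rint_cst ?mul0r.
rewrite (_ : integS _ = th 0 * rint 0 1 (fun x => F0 x * k x)); last first.
  rewrite -rintZ; last exact: ik kK.
  by apply: eq_rint => x _; rewrite mulrCA.
pose A t := rint 0 1 (fun x => F1 t x * k x).
pose D t := rint 0 1 (fun x => F2 t x * derive1 k x).
pose E t := rint 0 1 (fun x => F3 t x * k x).
have bnd (F : R -> R -> R) (g : R -> R) (l : R) :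
    measurable_fun setT (fun p : R * R => F p.1 p.2) -> measurable_fun setT g ->
    (forall x, `|g x| <= l) ->
    {ae mu, forall t, 0 <= t -> ib 0 1 (F t) /\ rint 0 1 (fun x => `|F t x|) <= C} ->
    ib 0 T (fun t => rint 0 1 (fun x => F t x * g x)).
  move=> mF mg gl gF; apply: (@ib_bounded _ _ _ (l * C)); first exact: jk.
  by apply: ae_imp gF => t Ht /andP[t0 _]; have [a b] := Ht t0; exact: bk.
have iA : ib 0 T A by apply: (bnd F1 k K) => //; apply: ae_imp good => t Ht /Ht[].
have iD : ib 0 T D by apply: (bnd F2 _ K') => //; apply: ae_imp good => t Ht /Ht[].
have iE : ib 0 T E by apply: (bnd F3 k K) => //; apply: ae_imp good => t Ht /Ht[].
have [c1 c1P] := continuous_bounded_itv (smooth_continuous sth) T0.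
have [c2 c2P] := continuous_bounded_itv (smooth_continuous sth') T0.
have iA' := ibM iA mth' (ae_all c2P).
have iD' := ibM iD mth (ae_all c1P).
have iE' := ibM iE mth (ae_all c1P).
have LE : {ae mu, forall t, 0 <= t <= T -> L t = A t * derive1 th t - D t * th t}.
  apply: ae_imp good => t Ht /andP[t0 _]; have [[a1 _] [a2 _] _] := Ht t0.
  have h1 := ik _ _ _ a1 mk kK; have h2 := ik _ _ _ a2 mk' kK'.
  rewrite [A t * _]mulrC [D t * _]mulrC -(rintZ _ h1) -(rintZ _ h2) -(rintB (ibZ _ h1) (ibZ _ h2)).
  by apply: eq_rint => x _; ring.
have NE : {ae mu, forall t, 0 <= t <= T -> N t = E t * th t}.
  apply: ae_imp good => t Ht /andP[t0 _]; have [_ _ [a3 _]] := Ht t0.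
  have h3 := ik _ _ _ a3 mk kK.
  rewrite [E t * _]mulrC -(rintZ _ h3).
  by apply: eq_rint => x _; ring.
have mL : measurable_fun setT L.
  apply: (@measurable_rint01 (fun t x => F1 t x * (derive1 th t * k x) - F2 t x * (th t * derive1 k x))).
  apply: measurable_funB.
    apply: (@jmM F1 (fun t x => derive1 th t * k x)) => //.
    exact: (measurable_funM (jm1 mth') (jm2 mk)).
  apply: (@jmM F2 (fun t x => th t * derive1 k x)) => //.
  exact: (measurable_funM (jm1 mth) (jm2 mk')).
have mN : measurable_fun setT N.
  apply: (@measurable_rint01 (fun t x => F3 t x * (th t * k x))).
  apply: (@jmM F3 (fun t x => th t * k x)) => //.
  exact: (measurable_funM (jm1 mth) (jm2 mk)).
have iL := ib_ae mL (ibB iA' iD') LE.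
have iN := ib_ae mN iE' NE.
move=> e; rewrite (_ : rint 0 T _ = rint 0 T L + rint 0 T N).
  by rewrite e; ring.
rewrite -rintD//; apply: eq_rint_ae.
- apply: measurable_funD; apply: measurable_funM => //; first exact: iA.1.
  apply: measurable_funB; [exact: iE.1|exact: iD.1].
- exact: measurable_funD.
- move: LE NE; apply: ae_imp2 => t Lt Nt tT; rewrite Lt// Nt// /A /D /E; ring.
Unshelve. all: by end_near.
Qed.

End WeakEvolution.

(** * Periodic functions with square integrable derivative *)

Section H1.
Context {R : realType}.
Local Notation mu := (@lebesgue_measure R).

(** Subtracting the mean makes the primitive of a periodic function periodic, hence admissible in
    tests. *)
Definition zprim (k : R -> R) : R -> R := prim (fun x => k x - rint 0 1 k).

Lemma smooth_zprim (k : R -> R) : smooth1 k -> smooth1 (zprim k).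
Proof. by move=> sk; exact: (smooth_prim (smoothD sk (smooth_cst _))). Qed.

Lemma derive1_zprim (k : R -> R) x : smooth1 k -> derive1 (zprim k) x = k x - rint 0 1 k.
Proof.
move=> sk; apply: dvE; apply: dv_prim.
exact: (smooth_continuous (smoothD sk (smooth_cst _))).
Qed.

Lemma smooth_loci (k : R -> R) : smooth1 k -> loci k.
Proof. by move=> sk; exact: loci_continuous (smooth_continuous sk). Qed.

Lemma zprim_periodic (k : R -> R) : smooth1 k -> (forall x, k (x + 1) = k x) ->
  forall x, zprim k (x + 1) = zprim k x.
Proof.
move=> sk pk; have ik := smooth_loci sk.
apply: prim_mean_periodic => [x|a b|].
- by rewrite pk.
- by apply: ibB; [exact: ik|exact: ib_cst].
- by rewrite (rintB (ik 0 1) (ib_cst 0 1 _)) rint_cst//; lra.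
Qed.

Lemma zprim0 (k : R -> R) : zprim k 0 = 0.
Proof. exact: prim0. Qed.

Lemma zprim1 (k : R -> R) : smooth1 k -> (forall x, k (x + 1) = k x) -> zprim k 1 = 0.
Proof. by move=> sk pk; rewrite -[1]add0r zprim_periodic// zprim0. Qed.

Lemma ib_smoothM (f k : R -> R) a b : a <= b -> ib a b f -> smooth1 k ->
  ib a b (fun x => f x * k x).
Proof.
move=> ab fi sk; have [C hC] := continuous_bounded_itv (smooth_continuous sk) ab.
exact: (ibM fi (smooth_measurable sk) (ae_all hC)).
Qed.

Lemma rint_ibp (U f k : R -> R) : ib 0 1 f -> smooth1 k ->
  (forall x, k (x + 1) = k x) -> measurable_fun setT U ->
  (forall a b, 0 <= a -> a <= b -> b <= 1 -> U b - U a = rint a b f) -> U 1 = U 0 ->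
  (forall x, 0 <= x <= 1 -> `|U x| <= rint 0 1 (fun x => `|f x|) + `|U 0|) /\
  rint 0 1 (fun x => U x * derive1 k x) = - rint 0 1 (fun x => f x * k x).
Proof.
move=> fi sk pk mU HU U10.
have UB x : 0 <= x <= 1 -> `|U x| <= rint 0 1 (fun x => `|f x|) + `|U 0|.
  move=> /andP[x0 x1]; have fx := ibS (lexx 0) x1 fi.
  rewrite (_ : U x = rint 0 x f + U 0); last by rewrite -HU// subrK.
  apply: le_trans (ler_normD _ _) _; apply: lerD => //.
  apply: le_trans (rint_norm fx) _.
  rewrite (rint_cat x0 x1 (ib_norm fi)) lerDl; exact: rint_ge0.
split=> //.
have sk' := smooth_der sk.
have [] := @rint_prod R 0 1 U k f (derive1 k) ler01 fi (smooth_loci sk' 0 1) mU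
  (smooth_measurable sk) HU (fun a b _ ab _ => smooth_ftc sk ab).
move=> ip; rewrite U10 -[X in k X]add0r pk subrr.
have ifk := ib_smoothM ler01 fi sk.
have iU : ib 0 1 (fun x => U x * derive1 k x).
  by have := ibB ip ifk; congr ib; apply/funext => x /=; ring.
by rewrite (rintD ifk iU) => /eqP; rewrite eq_sym addrC addr_eq0 => /eqP.
Qed.

(** A quantitative form of [H1S], with real integrals and an explicit energy bound. *)
Definition H1b (E : R) (g gx : R -> R) : Prop :=
  [/\ (forall x, g (x + 1) = g x) /\ (forall x, gx (x + 1) = gx x),
      measurable_fun setT g, measurable_fun setT gx,
      ib 0 1 (fun x => g x ^+ 2 + gx x ^+ 2) /\
        rint 0 1 (fun x => g x ^+ 2 + gx x ^+ 2) <= E &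
      forall k, smooth1 k -> (forall x, k (x + 1) = k x) ->
        rint 0 1 (fun x => g x * derive1 k x) = - rint 0 1 (fun x => gx x * k x)].

(** The absolutely continuous representative of [g]: a primitive of [gx], with the additive constant
    fixed by the mean of [g]. *)
Definition rep (g gx : R -> R) (x : R) : R :=
  prim gx x + (rint 0 1 g - rint 0 1 (prim gx)).

Section Rep.
Context {E : R} {g gx : R -> R}.
Context (S : H1b E g gx).

Let pg x : g (x + 1) = g x. Proof. by have [[p _] _ _ _ _] := S. Qed.
Let pgx x : gx (x + 1) = gx x. Proof. by have [[_ p] _ _ _ _] := S. Qed.
Let mg : measurable_fun setT g. Proof. by have [] := S. Qed.
Let mgx : measurable_fun setT gx. Proof. by have [] := S. Qed.

Lemma H1_sq : [/\ ib 0 1 (fun x => g x ^+ 2), rint 0 1 (fun x => g x ^+ 2) <= E,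
  ib 0 1 (fun x => gx x ^+ 2) & rint 0 1 (fun x => gx x ^+ 2) <= E].
Proof.
have [_ _ _ [i l] _] := S.
have i1 : ib 0 1 (fun x => g x ^+ 2).
  apply: (ib_le _ i) => [|x _]; first exact: measurable_funX.
  by rewrite ger0_norm ?sqr_ge0// lerDl sqr_ge0.
have i2 : ib 0 1 (fun x => gx x ^+ 2).
  apply: (ib_le _ i) => [|x _]; first exact: measurable_funX.
  by rewrite ger0_norm ?sqr_ge0// lerDr sqr_ge0.
split=> //; apply: le_trans l; apply: le_rint => // x _.
  by rewrite lerDl sqr_ge0.
by rewrite lerDr sqr_ge0.
Qed.

Let ib_sq (f : R -> R) : measurable_fun setT f -> ib 0 1 (fun x => f x ^+ 2) ->
  rint 0 1 (fun x => f x ^+ 2) <= E -> ib 0 1 f /\ rint 0 1 (fun x => `|f x|) <= 1 + E.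
Proof.
move=> mf i l; have i1 := ibD (ib_cst 0 1 1) i.
have le x : `|f x| <= 1 + f x ^+ 2.
  by rewrite ler_norml; apply/andP; split; nra.
have fi := ib_le mf i1 (fun x _ => le x).
split=> //; apply: (@le_trans _ _ (rint 0 1 (fun x => 1 + f x ^+ 2))).
  by apply: le_rint => //; exact: ib_norm.
by rewrite (rintD (ib_cst 0 1 1) i) rint_cst//; lra.
Qed.

Lemma H1_g : ib 0 1 g /\ rint 0 1 (fun x => `|g x|) <= 1 + E.
Proof. by have [a b _ _] := H1_sq; exact: ib_sq. Qed.

Lemma H1_gx : ib 0 1 gx /\ rint 0 1 (fun x => `|gx x|) <= 1 + E.
Proof. by have [_ _ a b] := H1_sq; exact: ib_sq. Qed.

Lemma H1_loci : loci gx.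
Proof. exact: (loci_periodic pgx H1_gx.1). Qed.

Lemma H1_mean0 : rint 0 1 gx = 0.
Proof.
have [_ _ _ _ /(_ _ (smooth_cst 1) (fun=> erefl))] := S.
rewrite (@eq_rint R 0 1 (fun x => g x * _) (fun=> 0)); last first.
  by move=> x _; rewrite (dvE (dv_cst 1 x)) mulr0.
rewrite rint_cst// mul0r (@eq_rint R 0 1 _ gx) => [/eqP|x _]; last by rewrite mulr1.
by rewrite eq_sym oppr_eq0 => /eqP.
Qed.

Lemma rep_periodic x : rep g gx (x + 1) = rep g gx x.
Proof.
by rewrite /rep prim_mean_periodic//; [exact: H1_loci|exact: H1_mean0].
Qed.

Lemma repB a b : a <= b -> rep g gx b - rep g gx a = rint a b gx.
Proof. by move=> ab; rewrite -(primB H1_loci ab) /rep; ring. Qed.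

Lemma measurable_rep : measurable_fun setT (rep g gx).
Proof.
apply: measurable_funD; last exact: measurable_cst.
by apply: (@measurable_prim R _ _ (fun=> gx) id) => //; exact: jm2.
Qed.

Let prim_le x : 0 <= x <= 1 -> `|prim gx x| <= 1 + E.
Proof.
move=> /andP[x0 x1]; have [i l] := H1_gx.
rewrite prim_ge0E//; apply: le_trans (rint_norm (ibS (lexx 0) x1 i)) _.
apply: le_trans l; rewrite (rint_cat x0 x1 (ib_norm i)) lerDl; exact: rint_ge0.
Qed.

Let mprim : measurable_fun setT (prim gx).
Proof. by apply: (@measurable_prim R _ _ (fun=> gx) id) => //; exact: jm2. Qed.

Lemma rep_bound x : `|rep g gx x| <= 3 * (1 + E).
Proof.
have [y y01 ->] := periodic_reduce rep_periodic x.
have h1 := prim_le y01.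
have h2 : `|rint 0 1 g| <= 1 + E := le_trans (rint_norm H1_g.1) H1_g.2.
have h3 : `|rint 0 1 (prim gx)| <= 1 + E.
  by have := rint_bound ler01 mprim prim_le; rewrite subr0 mulr1.
rewrite /rep; apply: le_trans (ler_normD _ _) _.
by have := ler_normB (rint 0 1 g) (rint 0 1 (prim gx)); lra.
Qed.

Lemma rep_mean : rint 0 1 (rep g gx) = rint 0 1 g.
Proof.
have ip : ib 0 1 (prim gx).
  by apply: (ib_bounded (C := 1 + E)) => //; apply: ae_all; exact: prim_le.
rewrite /rep (rintD ip (ib_cst 0 1 _)) rint_cst//; lra.
Qed.

Lemma rep_ae : {ae mu, forall x, 0 <= x <= 1 -> g x = rep g gx x}.
Proof.
have irep : ib 0 1 (rep g gx).
  by apply: (ib_bounded (C := 3 * (1 + E))); [exact: measurable_rep|apply: ae_all => x _; exact: rep_bound].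
have ig := H1_g.1.
have ifd := ibB ig irep.
have := kern_separates ifd.
move=> H; suff /H : forall n (r : rat), rint 0 1 (fun x => (g x - rep g gx x) * kern n (ratr r) x) = 0.
  by apply: ae_imp => x h /h /eqP; rewrite subr_eq0 => /eqP.
move=> n r {H}; set k := kern n (ratr r).
have sk : smooth1 k := smooth_kern n (ratr r).
have pk : forall x, k (x + 1) = k x := kern_periodic n (ratr r).
have [_ _ _ _ /(_ _ (smooth_zprim sk) (zprim_periodic sk pk)) e1] := S.
have [_ e2] := rint_ibp H1_gx.1 (smooth_zprim sk) (zprim_periodic sk pk) measurable_rep
  (fun a b _ ab _ => repB ab) (ltac:(by rewrite -[1]add0r rep_periodic)).
have j1 := ib_smoothM ler01 ig (smooth_der (smooth_zprim sk)).
have j2 := ib_smoothM ler01 irep (smooth_der (smooth_zprim sk)).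
(* The kernel is the derivative of its periodic primitive plus its mean: the first part sees equal
   weak derivatives, the second equal means. *)
rewrite (@eq_rint R 0 1 _ (fun x => (g x * derive1 (zprim k) x - rep g gx x * derive1 (zprim k) x)
    + rint 0 1 k * (g x - rep g gx x))); last first.
  by move=> x _; rewrite derive1_zprim//; ring.
rewrite (rintD (ibB j1 j2) (ibZ _ ifd)) (rintB j1 j2) (rintZ _ ifd) (rintB ig irep).
by rewrite rep_mean e1 e2; ring.
Qed.

End Rep.
End H1.

(** * The source term at a fixed time *)

Section Source.
Context {R : realType}.
Local Notation mu := (@lebesgue_measure R).

Lemma ae_periodic (P : R -> Prop) : (forall x, P (x + 1) <-> P x) ->
  {ae mu, forall x, 0 <= x <= 1 -> P x} -> {ae mu, forall x, P x}.
Proof.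
move=> pP aeP.
have PN (n : nat) : forall x, (P (x + n%:R) <-> P x) /\ (P (x - n%:R) <-> P x).
  elim: n => [|n IH] x; first by rewrite addr0 subr0.
  split; first by rewrite -natr1 addrA pP; exact: (IH x).1.
  by rewrite -(IH x).2 -pP (_ : x - n.+1%:R + 1 = x - n%:R)// -natr1; ring.
have h (n : nat) : {ae mu, forall x, (0 <= x + n%:R <= 1 -> P (x + n%:R)) /\
                                   (0 <= x - n%:R <= 1 -> P (x - n%:R))}.
  move: (ae_shift n%:R aeP) (ae_shift (- n%:R) aeP).
  by apply: ae_imp2 => x a b; split.
apply: ae_imp (ae_foralln h) => x H; pose n := Num.truncn `|x|.
have [n1 n2] : n%:R <= `|x| /\ `|x| < n.+1%:R.
  by have /andP[] := Num.Theory.truncn_itv (normr_ge0 x).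
case: (leP 0 x) => x0.
  have [_] := H n; rewrite (PN n x).2; apply.
  by move: n1 n2; rewrite -natr1 ger0_norm// => n1 n2; apply/andP; split; lra.
have [+ _] := H n.+1; rewrite (PN n.+1 x).1; apply.
by move: n1 n2; rewrite -natr1 ltr0_norm// => n1 n2; apply/andP; split; lra.
Qed.

(** Fubini moves the kernel outside the time integral, so the tested equations say that
    [f t x - f 0 x - rint 0 t (g^~ x)] is orthogonal to all kernels. Periodicity extends the result
    from one period to the line. *)
Lemma evolution_ae (f g : R -> R -> R) (t C : R) : 0 <= t ->
  ib 0 1 (f t) -> ib 0 1 (f 0) ->
  measurable_fun setT (fun p : R * R => g p.1 p.2) ->
  (forall s, ib 0 1 (g s) /\ rint 0 1 (fun x => `|g s x|) <= C) ->
  (forall x, f t (x + 1) - f 0 (x + 1) = f t x - f 0 x) ->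
  (forall s x, g s (x + 1) = g s x) ->
  (forall n (r : rat), rint 0 1 (fun x => f t x * kern n (ratr r) x) =
     rint 0 1 (fun x => f 0 x * kern n (ratr r) x) +
     rint 0 t (fun s => rint 0 1 (fun x => g s x * kern n (ratr r) x))) ->
  {ae mu, forall x, f t x = f 0 x + rint 0 t (g^~ x)}.
Proof.
move=> t0 it i0 mg gC pf pg H.
apply: ae_periodic => [x|].
  rewrite (_ : (fun s => g s (x + 1)) = (fun s => g s x)); last exact/funext.
  by have := pf x; split=> [h|h]; lra.
have [_ _ ig] := rint_fubini mg (ae_all (fun s (_ : 0 <= s <= t) => gC s)).
have id_ : ib 0 1 (fun x => f t x - f 0 x - rint 0 t (g^~ x)) by exact: ibB (ibB it i0) ig.
suff h : {ae mu, forall x, 0 <= x <= 1 -> f t x - f 0 x - rint 0 t (g^~ x) = 0}.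
  by apply: ae_imp h => x Hx /Hx; lra.
apply: kern_separates => // n r.
suff key (k : R -> R) : smooth1 k -> (forall x, `|k x| <= 1) ->
    rint 0 1 (fun x => f t x * k x) = rint 0 1 (fun x => f 0 x * k x) +
      rint 0 t (fun s => rint 0 1 (fun x => g s x * k x)) ->
    rint 0 1 (fun x => (f t x - f 0 x - rint 0 t (g^~ x)) * k x) = 0.
  apply: key (H n r); first exact: smooth_kern.
  by move=> x; have /andP[a b] := kern_itv n (ratr r) x; rewrite ger0_norm.
move=> sk kb {}H.
have mk := smooth_measurable sk.
have mgk : measurable_fun setT (fun p : R * R => g p.1 p.2 * k p.2).
  by apply: (@jmM R g (fun _ => k)) => //; exact: jm2.
have gkC s : ib 0 1 (fun x => g s x * k x) /\ rint 0 1 (fun x => `|g s x * k x|) <= C.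
  have [i l] := gC s; have ik := ib_smoothM ler01 i sk; split=> //.
  apply: le_trans l; apply: le_rint; [exact: ib_norm|exact: ib_norm|move=> x _].
  by rewrite normrM; apply: ler_piMr; [exact: normr_ge0|exact: kb].
have [e1 _ _] := @rint_fubini R 0 t 0 1 C (fun s x => g s x * k x) mgk
  (ae_all (fun s (_ : 0 <= s <= t) => gkC s)).
have [_ aeg _] := rint_fubini mg (ae_all (fun s (_ : 0 <= s <= t) => gC s)).
have e2 : rint 0 1 (fun x => rint 0 t (fun s => g s x * k x)) =
    rint 0 1 (fun x => rint 0 t (g^~ x) * k x).
  apply: eq_rint_ae.
  - apply: (@measurable_rint_param R _ _ (fun x s => g s x * k x) (fun=> 0) (fun=> t)); [|exact: measurable_cst|exact: measurable_cst].
    apply: measurable_funM; last exact: jm1.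
    exact: (measurableT_comp mg (measurable_fun_pair measurable_snd measurable_fst)).
  - by apply: measurable_funM; [exact: ig.1|exact: mk].
  - apply: ae_imp aeg => x Hx /Hx ix; rewrite mulrC -(rintZ _ ix).
    by congr rint; apply/funext => s; rewrite mulrC.
have j1 := ib_smoothM ler01 it sk; have j2 := ib_smoothM ler01 i0 sk.
have j3 := ib_smoothM ler01 ig sk.
rewrite (_ : rint 0 1 _ = rint 0 1 (fun x => f t x * k x - f 0 x * k x - rint 0 t (g^~ x) * k x)).
  by rewrite (rintB (ibB j1 j2) j3) (rintB j1 j2) H e1 e2; ring.
by congr rint; apply/funext => x; ring.
Qed.

Definition dens (g gx : R -> R) (x : R) : R := rep g gx x - rep g gx x * gx x ^+ 2.

(** Continues [dinv] periodically from [[0, 1]] to the line, whereas [dinv] itself is [0] for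
    negative [x]. *)
Definition zdens (g gx : R -> R) : R -> R := zprim (dens g gx).

Definition src (h : R) (g gx : R -> R) (x : R) : R :=
  zdens g gx x - (1 - h)^-1 * rint 0 1 (fun y => (1 - gx y ^+ 2) * zdens g gx y).

Definition src_bound (h E : R) : R :=
  (6 * (1 + E) ^+ 2) * (1 + `|(1 - h)^-1| * (1 + E)).

Section GoodTime.
Context {E h : R} {g gx : R -> R}.
Context (S : H1b E g gx).

Let pgx x : gx (x + 1) = gx x. Proof. by have [[_ p] _ _ _ _] := S. Qed.
Let mg : measurable_fun setT g. Proof. by have [] := S. Qed.
Let mgx : measurable_fun setT gx. Proof. by have [] := S. Qed.
Let iq2 : ib 0 1 (fun x => gx x ^+ 2). Proof. by have [] := H1_sq S. Qed.
Let q2E : rint 0 1 (fun x => gx x ^+ 2) <= E. Proof. by have [] := H1_sq S. Qed.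
Let mu_ := measurable_rep S.

Lemma H1_E : 0 <= E.
Proof. by apply: le_trans q2E; apply: rint_ge0 => x _; exact: sqr_ge0. Qed.

Lemma loci_q2 : loci (fun x => gx x ^+ 2).
Proof. by apply: loci_periodic => // x; rewrite pgx. Qed.

Lemma dens_periodic x : dens g gx (x + 1) = dens g gx x.
Proof. by rewrite /dens (rep_periodic S) pgx. Qed.

Let dens_le x : `|dens g gx x| <= 3 * (1 + E) * (1 + gx x ^+ 2).
Proof.
rewrite /dens; apply: le_trans (ler_normB _ _) _.
rewrite normrM [`|gx x ^+ 2|]ger0_norm ?sqr_ge0//.
by have := rep_bound S x; have := sqr_ge0 (gx x); nra.
Qed.

Let i1q : ib 0 1 (fun x => 1 + gx x ^+ 2).
Proof. by apply: ibD => //; exact: ib_cst. Qed.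

Let r1q : rint 0 1 (fun x => 1 + gx x ^+ 2) <= 1 + E.
Proof. by rewrite (rintD (ib_cst 0 1 1) iq2) rint_cst//; move: q2E; lra. Qed.

Lemma ib_sdens : ib 0 1 (dens g gx).
Proof.
apply: (ib_le _ (ibZ (3 * (1 + E)) i1q)) => [|x _]; last exact: dens_le.
by apply: measurable_funB => //; apply: measurable_funM => //; exact: measurable_funX.
Qed.

Lemma loci_dens : loci (dens g gx).
Proof. by apply: loci_periodic; [exact: dens_periodic|exact: ib_sdens]. Qed.

Let dens_norm : rint 0 1 (fun x => `|dens g gx x|) <= 3 * (1 + E) ^+ 2.
Proof.
apply: (@le_trans _ _ (3 * (1 + E) * rint 0 1 (fun x => 1 + gx x ^+ 2))).
  rewrite -(rintZ _ i1q); apply: le_rint => [||x _]; last exact: dens_le.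
    by apply: ib_norm; exact: ib_sdens.
  exact: ibZ.
by have := H1_E; move: r1q; nra.
Qed.

Let loci_zd : loci (fun x => dens g gx x - rint 0 1 (dens g gx)).
Proof. by move=> a b; apply: ibB; [exact: loci_dens|exact: ib_cst]. Qed.

Lemma zdens_periodic x : zdens g gx (x + 1) = zdens g gx x.
Proof.
apply: prim_mean_periodic => [y||] //; first by rewrite dens_periodic.
by rewrite (rintB ib_sdens (ib_cst 0 1 _)) rint_cst//; lra.
Qed.

Lemma measurable_zdens : measurable_fun setT (zdens g gx).
Proof.
apply: (@measurable_prim R _ _ (fun=> (fun x => dens g gx x - rint 0 1 (dens g gx))) id) => //.
exact: (jm2 (loci_zd 0 1).1).
Qed.

Lemma zdens_bound x : `|zdens g gx x| <= 6 * (1 + E) ^+ 2.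
Proof.
have [y /andP[y0 y1] ->] := periodic_reduce zdens_periodic x.
rewrite /zdens /zprim prim_ge0E//.
have iy := ibS (lexx 0) y1 (loci_zd 0 1).
apply: le_trans (rint_norm iy) _.
apply: (@le_trans _ _ (rint 0 1 (fun x => `|dens g gx x - rint 0 1 (dens g gx)|))).
  by rewrite (rint_cat y0 y1 (ib_norm (loci_zd 0 1))) lerDl; exact: rint_ge0.
apply: (@le_trans _ _ (rint 0 1 (fun x => `|dens g gx x| + `|rint 0 1 (dens g gx)|))).
  apply: le_rint => [||z _]; last exact: ler_normB.
    by apply: ib_norm; exact: loci_zd.
  by apply: ibD; [apply: ib_norm; exact: ib_sdens|exact: ib_cst].
rewrite (rintD (ib_norm ib_sdens) (ib_cst 0 1 _)) rint_cst//.
by have := rint_norm ib_sdens; move: dens_norm; lra.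
Qed.

Let ib_1qz : ib 0 1 (fun y => (1 - gx y ^+ 2) * zdens g gx y).
Proof.
apply: (@ibM R 0 1 (6 * (1 + E) ^+ 2)).
- by apply: ibB => //; exact: ib_cst.
- exact: measurable_zdens.
- by apply: ae_all => x _; exact: zdens_bound.
Qed.

Lemma src_periodic x : src h g gx (x + 1) = src h g gx x.
Proof. by rewrite /src zdens_periodic. Qed.

Lemma srcB a b : a <= b ->
  src h g gx b - src h g gx a = rint a b (dens g gx) - rint 0 1 (dens g gx) * (b - a).
Proof.
move=> ab; rewrite -(rint_cst _ ab) -(rintB (loci_dens a b) (ib_cst a b _)).
by rewrite -(primB loci_zd ab) /src /zdens /zprim; ring.
Qed.

Lemma src_boundP x : `|src h g gx x| <= src_bound h E.
Proof.
rewrite /src /src_bound; set D := 6 * _.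
apply: le_trans (ler_normB _ _) _; rewrite mulrDr mulr1.
apply: lerD; first exact: zdens_bound.
rewrite normrM mulrCA; apply: ler_wpM2l => //.
apply: (@le_trans _ _ (rint 0 1 (fun x => D * (1 + gx x ^+ 2)))).
  apply: rint_norm_le_ae => //; first exact: ibZ.
  apply: ae_all => y _; rewrite normrM mulrC.
  apply: ler_pM => //; first exact: zdens_bound.
  by have := sqr_ge0 (gx y); rewrite ler_norml => ?; apply/andP; split; lra.
rewrite (rintZ _ i1q); apply: ler_wpM2l => //.
by rewrite /D; apply: mulr_ge0 => //; exact: sqr_ge0.
Qed.

(** The normalisation of [f] by [(1 - h)^-1] is made for this identity, the integral of [1 - gx^2]
    being [1 - h]. *)
Lemma src_mean : rint 0 1 (fun x => gx x ^+ 2) = h -> h != 1 ->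
  rint 0 1 (fun y => (1 - gx y ^+ 2) * src h g gx y) = 0.
Proof.
move=> hE h1; rewrite /src; set c := _^-1 * _.
have i2 : ib 0 1 (fun x => 1 - gx x ^+ 2) by apply: ibB => //; exact: ib_cst.
rewrite (_ : rint 0 1 _ = rint 0 1 (fun y => (1 - gx y ^+ 2) * zdens g gx y - c * (1 - gx y ^+ 2))).
  rewrite (rintB ib_1qz (ibZ _ i2)) (rintZ _ i2) (rintB (ib_cst 0 1 1) iq2) rint_cst// hE.
  by rewrite /c subr0 mul1r; field; rewrite subr_eq0 eq_sym.
by congr rint; apply/funext => y; ring.
Qed.

Lemma rep2B a b : a <= b ->
  ib a b (fun x => 2 * rep g gx x * gx x) /\
  rep g gx b ^+ 2 - rep g gx a ^+ 2 = rint a b (fun x => 2 * rep g gx x * gx x).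
Proof.
move=> ab; have igx := H1_loci S a b.
have [] := @rint_prod R a b _ _ gx gx ab igx igx mu_ mu_
  (fun x y _ xy _ => repB S xy) (fun x y _ xy _ => repB S xy).
rewrite (_ : (fun x => _ + _) = (fun x => 2 * rep g gx x * gx x)); last first.
  by apply/funext => x; ring.
by rewrite -!expr2.
Qed.

Lemma rep3B a b : a <= b ->
  ib a b (fun x => 3 * rep g gx x ^+ 2 * gx x) /\
  rep g gx b ^+ 3 - rep g gx a ^+ 3 = rint a b (fun x => 3 * rep g gx x ^+ 2 * gx x).
Proof.
move=> ab; have igx := H1_loci S a b; have [i2 _] := rep2B ab.
have m2 : measurable_fun setT (fun x => rep g gx x ^+ 2) by exact: measurable_funX.
have [] := @rint_prod R a b (fun x => rep g gx x ^+ 2) _ _ gx ab i2 igx m2 mu_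
  (fun x y _ xy _ => (rep2B xy).2) (fun x y _ xy _ => repB S xy).
rewrite (_ : (fun x => _ + _) = (fun x => 3 * rep g gx x ^+ 2 * gx x)); last first.
  by apply/funext => x; ring.
by rewrite -!exprSr.
Qed.

End GoodTime.
End Source.

Lemma jm_prim (R : realType) (f : R -> R -> R) :
  measurable_fun setT (fun p : R * R => f p.1 p.2) ->
  measurable_fun setT (fun p : R * R => prim (f p.1) p.2).
Proof.
move=> mf; apply: (@measurable_prim R _ _ (fun p : R * R => f p.1) snd).
  apply: (@mfun_comp2 R _ _ f (fun z : (R * R) * R => z.1.1) (fun z => z.2)).
  - exact: mf.
  - exact: (measurableT_comp measurable_fst measurable_fst).
  - exact: measurable_snd.
exact: measurable_snd.
Qed.

Lemma jm_rep (R : realType) (r q : R -> R -> R) :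
  measurable_fun setT (fun p : R * R => r p.1 p.2) ->
  measurable_fun setT (fun p : R * R => q p.1 p.2) ->
  measurable_fun setT (fun p : R * R => rep (r p.1) (q p.1) p.2).
Proof.
move=> mr mq; apply: measurable_funD; first exact: jm_prim.
apply: measurable_funB; first exact: (jm1 (measurable_rint01 0 1 mr)).
exact: (jm1 (@measurable_rint01 R (fun t => prim (q t)) 0 1 (jm_prim mq))).
Qed.

Lemma jm_src (R : realType) (h : R) (r q : R -> R -> R) :
  measurable_fun setT (fun p : R * R => r p.1 p.2) ->
  measurable_fun setT (fun p : R * R => q p.1 p.2) ->
  measurable_fun setT (fun p : R * R => src h (r p.1) (q p.1) p.2).
Proof.
move=> mr mq; have mu_ := jm_rep mr mq.
have mq2 : measurable_fun setT (fun p : R * R => q p.1 p.2 ^+ 2) by exact: measurable_funX.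
have md : measurable_fun setT (fun p : R * R => dens (r p.1) (q p.1) p.2).
  by apply: measurable_funB => //; exact: measurable_funM.
have mz : measurable_fun setT (fun p : R * R => zdens (r p.1) (q p.1) p.2).
  apply: (@jm_prim R (fun t x => dens (r t) (q t) x - rint 0 1 (dens (r t) (q t)))).
  apply: measurable_funB => //.
  exact: (jm1 (@measurable_rint01 R (fun t => dens (r t) (q t)) 0 1 md)).
apply: measurable_funB => //; apply: measurable_funM; first exact: measurable_cst.
apply: (jm1 (@measurable_rint01 R (fun t y => (1 - q t y ^+ 2) * zdens (r t) (q t) y) 0 1 _)).
apply: measurable_funM => //; apply: measurable_funB => //; exact: measurable_cst.
Qed.

Definition ev_u (R : realType) (r q : R -> R -> R) (h : R) (k : R -> R) (t : R) : Prop :=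
  rint 0 1 (fun x => rep (r t) (q t) x * k x) =
  rint 0 1 (fun x => rep (r 0) (q 0) x * k x) +
  rint 0 t (fun s => rint 0 1 (fun x => src h (r s) (q s) x * k x) -
    rint 0 1 (fun x => 3^-1 * rep (r s) (q s) x ^+ 3 * derive1 k x)).

Definition ev_q (R : realType) (r q : R -> R -> R) (wb : R) (m : R -> R) (t : R) : Prop :=
  rint 0 1 (fun x => q t x ^+ 2 * m x) =
  rint 0 1 (fun x => q 0 x ^+ 2 * m x) +
  rint 0 t (fun s =>
    rint 0 1 (fun x => (2 * rep (r s) (q s) x * q s x - 2 * q s x * wb) * m x) -
    rint 0 1 (fun x => rep (r s) (q s) x ^+ 2 * q s x ^+ 2 * derive1 m x)).

(* [r] and [q] are a solution and its [x]-derivative modified on a null set of times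
    and at [t = 0]; the last two fields are the weak formulation tested against the
    kernels [kern] (and their primitives), at the good times [G]. *)
Record raw_solution (R : realType) (r q : R -> R -> R) (E h wb : R) (G : R -> Prop)
    : Prop := RawSolution {
  rs_H1 : forall t, H1b E (r t) (q t);
  rs_mr : measurable_fun setT (fun p : R * R => r p.1 p.2);
  rs_mq : measurable_fun setT (fun p : R * R => q p.1 p.2);
  rs_G0 : G 0;
  rs_Gge : forall t, G t -> 0 <= t;
  rs_Gae : {ae (@lebesgue_measure R), forall t, 0 <= t -> G t};
  rs_hle : forall t, rint 0 1 (fun x => q t x ^+ 2) <= h;
  rs_h : forall t, G t -> rint 0 1 (fun x => q t x ^+ 2) = h;
  rs_w : forall t, G t -> 0 < t -> rint 0 1 (dens (r t) (q t)) = wb;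
  rs_u : forall n (c : rat) t, G t -> ev_u r q h (kern n (ratr c)) t;
  rs_q : forall n (c : rat) t, G t -> ev_q r q wb (zprim (kern n (ratr c))) t
}.

(** * Good solutions from tested equations *)

Section Assembly.
Context {R : realType} {r q : R -> R -> R} {E h wb : R} {G : R -> Prop}.
Context (S : raw_solution r q E h wb G) (h1 : h != 1).
Local Notation mu := (@lebesgue_measure R).

Definition ru (t : R) : R -> R := rep (r t) (q t).

Definition rH (t : R) : R -> R := src h (r t) (q t).

Definition rg (s x : R) : R := ru s x ^+ 2 * (1 + q s x ^+ 2) - 2 * wb * ru s x.

Definition rK (t : R) : R := rint 0 1 (prim (fun x => q t x ^+ 2)).

(* The constant is chosen so that the mean of [rY] evolves according to [rg]. *)
Definition rY (t x : R) : R :=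
  x + prim (fun x => q t x ^+ 2) x + (rK 0 - rK t + rint 0 t (fun s => rint 0 1 (rg s))).

Lemma rY0 x : rY 0 x = x + prim (fun x => q 0 x ^+ 2) x.
Proof. by rewrite /rY subrr add0r [rint 0 0 _]rint_pt ?lexx// addr0. Qed.

Let mru : measurable_fun setT (fun p : R * R => ru p.1 p.2).
Proof. exact: jm_rep (rs_mr S) (rs_mq S). Qed.

Let mrH : measurable_fun setT (fun p : R * R => rH p.1 p.2).
Proof. exact: jm_src (rs_mr S) (rs_mq S). Qed.

Let mq2 : measurable_fun setT (fun p : R * R => q p.1 p.2 ^+ 2).
Proof. by apply: measurable_funX; exact: rs_mq S. Qed.

Let mrg : measurable_fun setT (fun p : R * R => rg p.1 p.2).
Proof.
apply: measurable_funB.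
  apply: measurable_funM; first exact: measurable_funX.
  by apply: measurable_funD => //; exact: measurable_cst.
by apply: measurable_funM => //; exact: measurable_cst.
Qed.

Let mrY : measurable_fun setT (fun p : R * R => rY p.1 p.2).
Proof.
have mp := @jm_prim R (fun t x => q t x ^+ 2) mq2.
have mK : measurable_fun setT rK by exact: (measurable_rint01 0 1 mp).
apply: measurable_funD; first by apply: measurable_funD => //; exact: measurable_snd.
apply: measurable_funD.
  by apply: measurable_funB; [exact: measurable_cst|exact: jm1].
have mI : measurable_fun setT (fun t : R => rint 0 t (fun s => rint 0 1 (rg s))).
  apply: (@measurable_rint_param R _ _ (fun _ s => rint 0 1 (rg s)) (fun=> 0) id).
  - exact: (jm2 (measurable_rint01 0 1 mrg)).
  - exact: measurable_cst.
  - exact: measurable_id.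
exact: (jm1 mI).
Qed.

Let iq2 t : ib 0 1 (fun x => q t x ^+ 2).
Proof. by have [] := H1_sq (rs_H1 S t). Qed.

Let lq2 t : loci (fun x => q t x ^+ 2).
Proof. exact: loci_q2 (rs_H1 S t). Qed.

Let qper t x : q t (x + 1) = q t x.
Proof. by have [[_ p] _ _ _ _] := rs_H1 S t. Qed.

Let B : R := 3 * (1 + E).

Let ruB t x : `|ru t x| <= B.
Proof. exact: rep_bound (rs_H1 S t) x. Qed.

Let E0 : 0 <= E. Proof. exact: H1_E (rs_H1 S 0). Qed.

Let mrus t : measurable_fun setT (ru t). Proof. exact: mfun_sec1 mru. Qed.

Let iru t : ib 0 1 (ru t).
Proof. exact: (ib_bounded (mrus t) (ae_all (fun x (_ : 0 <= x <= 1) => ruB t x))). Qed.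

Let rYB t a b : a <= b -> rY t b - rY t a = (b - a) + rint a b (fun x => q t x ^+ 2).
Proof.
move=> ab; rewrite -(primB (lq2 t) ab) /rY.
by move: (prim _ b) (prim _ a) (rK 0 - _ + _) => A D c; ring.
Qed.

Let ru2 t x : ru t x ^+ 2 <= B ^+ 2.
Proof. by rewrite -[_ ^+ 2]real_normK ?num_real// ler_pXn2r ?nnegrE//; apply: le_trans (ruB t x). Qed.

Let iH s : ib 0 1 (rH s).
Proof.
apply: (ib_bounded (C := src_bound h E)); first exact: mfun_sec1 mrH.
by apply: ae_all => x _; exact: src_boundP (rs_H1 S s) x.
Qed.

Let iuq s : ib 0 1 (fun x => ru s x ^+ 2 * q s x).
Proof.
rewrite (_ : (fun _ => _) = fun x => q s x * ru s x ^+ 2); last by apply/funext => x; rewrite mulrC.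
have mu2 : measurable_fun setT (fun x => ru s x ^+ 2) by apply: measurable_funX; exact: mrus.
apply: (ibM (H1_gx (rs_H1 S s)).1 mu2 (C := B ^+ 2)).
by apply: ae_all => x _; rewrite ger0_norm ?sqr_ge0.
Qed.

(** [u^3 / 3] is absolutely continuous in [x] with derivative [u^2 q], so the flux term of (ii) can
    be integrated by parts. *)
Let ut_key (k : R -> R) t : ev_u r q h k t -> smooth1 k -> (forall x, k (x + 1) = k x) ->
  rint 0 1 (fun x => ru t x * k x) = rint 0 1 (fun x => ru 0 x * k x) +
    rint 0 t (fun s => rint 0 1 (fun x => (ru s x ^+ 2 * q s x + rH s x) * k x)).
Proof.
move=> ek sk pk.
apply: (etrans ek); apply: (congr1 (fun F => _ + rint 0 t F)); apply/funext => s.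
have [i3 _] := rep3B (rs_H1 S s) ler01.
have m3 : measurable_fun setT (fun x => ru s x ^+ 3) by apply: measurable_funX; exact: mrus.
have [_ e] := rint_ibp i3 sk pk m3 (fun a b _ ab _ => (rep3B (rs_H1 S s) ab).2)
  (ltac:(by rewrite -[1]add0r /ru (rep_periodic (rs_H1 S s)))).
have j1 := ib_smoothM ler01 (iH s) sk.
have j2 := ib_smoothM ler01 (iuq s) sk.
have j3 : ib 0 1 (fun x => ru s x ^+ 3 * derive1 k x).
  apply: ib_smoothM => //; last exact: smooth_der.
  apply: (ib_bounded (C := B ^+ 3)) => //; apply: ae_all => x _.
  by rewrite normrX; apply: lerXn2r; rewrite ?nnegrE//; apply: le_trans (ruB s x).
have E3 : rint 0 1 (fun x => 3^-1 * ru s x ^+ 3 * derive1 k x) =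
    - rint 0 1 (fun x => ru s x ^+ 2 * q s x * k x).
  transitivity (3^-1 * rint 0 1 (fun x => ru s x ^+ 3 * derive1 k x)).
    by rewrite -(rintZ _ j3); congr rint; apply/funext => x; rewrite mulrA.
  have e3 : rint 0 1 (fun x => 3 * rep (r s) (q s) x ^+ 2 * q s x * k x) =
      3 * rint 0 1 (fun x => ru s x ^+ 2 * q s x * k x).
    by rewrite -(rintZ _ j2); congr rint; apply/funext => x; rewrite /ru !mulrA.
  by rewrite e e3 mulrN mulrA mulVf// mul1r.
rewrite /ru in E3; rewrite E3 opprK -(rintD j1 j2).
by congr rint; apply/funext => x; rewrite -mulrDl addrC.
Qed.

Let ut t : G t -> {ae mu, forall x,
  ru t x = ru 0 x + rint 0 t (fun s => ru s x ^+ 2 * q s x + rH s x)}.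
Proof.
move=> Gt; have t0 := rs_Gge S Gt.
pose C := B ^+ 2 * (1 + E) + src_bound h E.
have ig s := ibD (iuq s) (iH s).
apply: (@evolution_ae R ru (fun s x => ru s x ^+ 2 * q s x + rH s x) t C t0 (iru t) (iru 0)).
- apply: measurable_funD => //; apply: measurable_funM; last exact: rs_mq S.
  exact: measurable_funX.
- move=> s; split=> //.
  have iq := H1_gx (rs_H1 S s).
  apply: (@le_trans _ _ (rint 0 1 (fun x => B ^+ 2 * `|q s x| + src_bound h E))).
    apply: le_rint => [||x _]; first exact: ib_norm.
      by apply: ibD; [apply: ibZ; apply: ib_norm; exact: iq.1|exact: ib_cst].
    apply: le_trans (ler_normD _ _) _; apply: lerD; last exact: src_boundP (rs_H1 S s) x.
    by rewrite normrM ger0_norm ?sqr_ge0// ler_wpM2r.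
  rewrite (rintD (ibZ _ (ib_norm iq.1)) (ib_cst 0 1 _)) (rintZ _ (ib_norm iq.1)) rint_cst//.
  by rewrite subr0 mulr1 lerD2r; apply: ler_wpM2l; [exact: sqr_ge0|exact: iq.2].
- by move=> x; rewrite /ru (rep_periodic (rs_H1 S t)) (rep_periodic (rs_H1 S 0)).
- by move=> s x; rewrite /ru /rH (rep_periodic (rs_H1 S s)) (src_periodic (rs_H1 S s)) qper.
- by move=> n c; exact: (ut_key (rs_u S n c Gt) (smooth_kern n _) (kern_periodic n _)).
Qed.

(** The source in (iv) is the derivative in [x] of [u^2 - 2 wb u]. *)
Let iuu s : ib 0 1 (fun x => 2 * ru s x * q s x) /\
  forall a b, 0 <= a -> a <= b -> b <= 1 ->
    (ru s b ^+ 2 - 2 * wb * ru s b) - (ru s a ^+ 2 - 2 * wb * ru s a) =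
    rint a b (fun x => 2 * ru s x * q s x - 2 * q s x * wb).
Proof.
have [i2 _] := rep2B (rs_H1 S s) ler01; split=> // a b a0 ab b1.
have [i2' e2] := rep2B (rs_H1 S s) ab; have e1 := repB (rs_H1 S s) ab.
have iq := H1_loci (rs_H1 S s) a b.
have -> : rint a b (fun x => 2 * ru s x * q s x - 2 * q s x * wb) =
    rint a b (fun x => 2 * rep (r s) (q s) x * q s x) - 2 * wb * rint a b (q s).
  rewrite -(rintZ (2 * wb) iq) -(rintB i2' (ibZ _ iq)); congr rint; apply/funext => x.
  by rewrite /ru; congr (_ - _); ring.
by rewrite -e1 -e2 /ru; ring.
Qed.

Let irg s : ib 0 1 (rg s) /\
  rint 0 1 (fun x => `|rg s x|) <= B ^+ 2 * (1 + E) + 2 * `|wb| * B.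
Proof.
have i1 : ib 0 1 (fun x => 1 + q s x ^+ 2) by apply: ibD (iq2 s); exact: ib_cst.
have iM : ib 0 1 (fun x => B ^+ 2 * (1 + q s x ^+ 2) + 2 * `|wb| * B).
  by apply: ibD; [exact: ibZ|exact: ib_cst].
have le x : `|rg s x| <= B ^+ 2 * (1 + q s x ^+ 2) + 2 * `|wb| * B.
  rewrite /rg; apply: le_trans (ler_normB _ _) _; apply: lerD; rewrite normrM.
    have p1 : 0 <= 1 + q s x ^+ 2 by apply: addr_ge0 => //; exact: sqr_ge0.
    by rewrite (ger0_norm p1) ger0_norm ?sqr_ge0//; apply: ler_wpM2r => //; exact: ru2.
  rewrite normrM [`|2|]ger0_norm//; apply: ler_wpM2l; last exact: ruB.
  by apply: mulr_ge0.
have ig : ib 0 1 (rg s) by apply: (ib_le (mfun_sec1 s mrg) iM) => x _; exact: le.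
split=> //; apply: le_trans (le_rint (ib_norm ig) iM (fun x _ => le x)) _.
rewrite (rintD (ibZ _ i1) (ib_cst 0 1 _)) (rintZ _ i1) (rintD (ib_cst 0 1 1) (iq2 s)) !rint_cst//.
rewrite subr0 !mulr1 lerD2r; apply: ler_wpM2l; first exact: sqr_ge0.
by rewrite lerD2l; have [_ _ _] := H1_sq (rs_H1 S s).
Qed.

Let ip s : ib 0 1 (prim (fun x => q s x ^+ 2)).
Proof.
have mp : measurable_fun setT (prim (fun x => q s x ^+ 2)).
  exact: (@mfun_sec1 R (fun t x => prim (fun y => q t y ^+ 2) x) s (@jm_prim R (fun t x => q t x ^+ 2) mq2)).
apply: (ib_bounded mp (C := E)); apply: ae_all => x /andP[x0 x1].
rewrite prim_ge0E// ger0_norm; last by apply: rint_ge0 => y _; exact: sqr_ge0.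
apply: le_trans (_ : rint 0 1 (fun x => q s x ^+ 2) <= _).
  by rewrite (rint_cat x0 x1 (iq2 s)) lerDl; apply: rint_ge0 => y _; exact: sqr_ge0.
by have [_ _ _] := H1_sq (rs_H1 S s).
Qed.

Let iY s : ib 0 1 (rY s).
Proof.
apply: ibD; last exact: ib_cst.
by apply: ibD (ip s); exact: (smooth_loci smooth_id).
Qed.

(** Testing the energy equation against the periodic primitive of [k] minus its mean amounts, by
    parts, to testing the primitive of [q^2] against [k] minus its mean. The mean of [k] is
    invisible to (iv); its contribution is supplied by the additive constant in [rY]. *)
Let Yt_key (k : R -> R) t : 0 <= t -> ev_q r q wb (zprim k) t -> smooth1 k ->
  (forall x, k (x + 1) = k x) ->
  rint 0 1 (fun x => rY t x * k x) = rint 0 1 (fun x => rY 0 x * k x) +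
    rint 0 t (fun s => rint 0 1 (fun x => rg s x * k x)).
Proof.
move=> t0 em sk pk; pose m := zprim k; pose kb := rint 0 1 k.
have sm : smooth1 m := smooth_zprim sk.
have pm : forall x, m (x + 1) = m x := zprim_periodic sk pk.
have dm x : derive1 m x = k x - kb by exact: derive1_zprim.
have ik : ib 0 1 k := smooth_loci sk 0 1.
have pk_ s : rint 0 1 (fun x => prim (fun x => q s x ^+ 2) x * k x) =
    kb * rK s - rint 0 1 (fun x => q s x ^+ 2 * m x).
  have j1 := ib_smoothM ler01 (ip s) (smooth_der sm).
  have j2 := ib_smoothM ler01 (iq2 s) sm.
  have [_] := @rint_prod R 0 1 _ m _ (derive1 m) ler01 (iq2 s) (smooth_loci (smooth_der sm) 0 1)
    (ip s).1 (smooth_measurable sm) (fun x y _ xy _ => primB (lq2 s) xy)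
    (fun x y _ xy _ => smooth_ftc sm xy).
  rewrite (zprim1 sk pk : m 1 = 0) mulr0 prim0 mul0r subrr (rintD j2 j1) => e.
  have -> : rint 0 1 (fun x => prim (fun x => q s x ^+ 2) x * k x) =
      rint 0 1 (fun x => prim (fun x => q s x ^+ 2) x * derive1 m x) + kb * rK s.
    rewrite -(rintZ kb (ip s)) -(rintD j1 (ibZ kb (ip s))).
    by congr rint; apply/funext => x; rewrite dm; ring.
  lra.
have ev s : rint 0 1 (fun x => (2 * ru s x * q s x - 2 * q s x * wb) * m x) -
    rint 0 1 (fun x => ru s x ^+ 2 * q s x ^+ 2 * derive1 m x) =
    kb * rint 0 1 (rg s) - rint 0 1 (fun x => rg s x * k x).
  have [i2 e2] := iuu s; have [ig _] := irg s.
  have iq := (H1_gx (rs_H1 S s)).1.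
  have i2' : ib 0 1 (fun x => 2 * ru s x * q s x - 2 * q s x * wb).
    apply: ibB => //; have := ibZ (2 * wb) iq; congr ib; apply/funext => x; ring.
  have mu2 : measurable_fun setT (fun x => ru s x ^+ 2) by apply: measurable_funX; exact: mrus.
  have mU : measurable_fun setT (fun x => ru s x ^+ 2 - 2 * wb * ru s x).
    by apply: measurable_funB => //; apply: measurable_funM; [exact: measurable_cst|exact: mrus].
  have [UB e] := rint_ibp i2' sm pm mU e2 (ltac:(by rewrite -[1]add0r /ru (rep_periodic (rs_H1 S s)))).
  have iU : ib 0 1 (fun x => ru s x ^+ 2 - 2 * wb * ru s x).
    exact: (ib_bounded mU (ae_all UB)).
  have iu2q2 : ib 0 1 (fun x => ru s x ^+ 2 * q s x ^+ 2).
    have := ibB ig iU; congr ib; apply/funext => x; rewrite /rg; ring.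
  have j1 := ib_smoothM ler01 iU (smooth_der sm).
  have j2 := ib_smoothM ler01 iu2q2 (smooth_der sm).
  have j3 := ib_smoothM ler01 ig sk.
  rewrite -[X in X - _]opprK -e -opprD -(rintD j1 j2) -(rintZ kb ig) -(rintB (ibZ kb ig) j3).
  rewrite -[LHS]mulN1r -(rintZ _ (ibD j1 j2)).
  by congr rint; apply/funext => x; rewrite dm /rg; ring.
have Ek s : rint 0 1 (fun x => rY s x * k x) = rint 0 1 (fun x => x * k x) +
   (kb * rK s - rint 0 1 (fun x => q s x ^+ 2 * m x)) +
   (rK 0 - rK s + rint 0 s (fun s => rint 0 1 (rg s))) * kb.
  have j0 := ib_smoothM ler01 (smooth_loci smooth_id 0 1) sk.
  have j1 := ib_smoothM ler01 (ip s) sk.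
  rewrite -pk_ -(rintD j0 j1) -(rintZ _ ik) -(rintD (ibD j0 j1) (ibZ _ ik)).
  congr rint; apply/funext => x; rewrite /rY.
  by move: (prim _ x) (rK 0 - _ + _) => A D; rewrite /kb; ring.
rewrite !Ek [rint 0 0 _]rint_pt//.
move: em; rewrite /ev_q -/m.
have -> : (fun s => rint 0 1 (fun x => (2 * rep (r s) (q s) x * q s x - 2 * q s x * wb) * m x) -
      rint 0 1 (fun x => rep (r s) (q s) x ^+ 2 * q s x ^+ 2 * derive1 m x)) =
    (fun s => kb * rint 0 1 (rg s) - rint 0 1 (fun x => rg s x * k x)).
  by apply/funext => s; exact: ev.
have [K kK] := continuous_periodic_bounded (smooth_continuous sk) pk.
have K0 : 0 <= K := le_trans (normr_ge0 _) (kK 0).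
have I1 : ib 0 t (fun s => rint 0 1 (rg s)).
  apply: (ib_bounded (measurable_rint01 0 1 mrg)); apply: ae_all => s _.
  by have [a b] := irg s; exact: le_trans (rint_norm a) b.
have I2 : ib 0 t (fun s => rint 0 1 (fun x => rg s x * k x)).
  apply: (ib_bounded (C := K * (B ^+ 2 * (1 + E) + 2 * `|wb| * B))).
    apply: (@measurable_rint01 R (fun s x => rg s x * k x)).
    by apply: (jmM mrg (g := fun _ => k)); exact: (jm2 (smooth_measurable sk)).
  apply: ae_all => s _; have [a b] := irg s.
  apply: (@le_trans _ _ (rint 0 1 (fun x => K * `|rg s x|))).
    apply: rint_norm_le_ae; first exact: (ib_smoothM ler01 a sk).
      by apply: ibZ; exact: ib_norm.
    by apply: ae_all => x _; rewrite normrM mulrC ler_wpM2r.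
  by rewrite (rintZ _ (ib_norm a)) ler_wpM2l.
rewrite (rintB (ibZ kb I1) I2) (rintZ _ I1) => em.
move: em; clear; move: (rK 0) (rK t) (rint 0 t _) (rint 0 t _) (rint 0 1 (fun x => q t x ^+ 2 * m x)) => a b c d e.
by move=> ->; ring.
Qed.

Let rY1 t x : rY t (x + 1) - rY t x = 1 + rint 0 1 (fun x => q t x ^+ 2).
Proof.
rewrite rYB; last by rewrite lerDl.
rewrite (rint_periodic x _ (iq2 t)); last by move=> y; rewrite qper.
by congr (_ + _); ring.
Qed.

Let Yt t : G t -> {ae mu, forall x, rY t x = rY 0 x + rint 0 t (fun s => rg s x)}.
Proof.
move=> Gt; have t0 := rs_Gge S Gt.
apply: (@evolution_ae R rY rg t _ t0 (iY t) (iY 0) mrg irg).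
- move=> x; have := rY1 t x; have := rY1 0 x.
  by rewrite (rs_h S Gt) (rs_h S (rs_G0 S)); lra.
- by move=> s x; rewrite /rg /ru (rep_periodic (rs_H1 S s)) qper.
- move=> n c; exact: (Yt_key t0 (rs_q S n c Gt) (smooth_kern n _) (kern_periodic n _)).
Qed.

Definition raw_bound : R := 1 + (1 + h) + 3 * (1 + E) + src_bound h E + `|wb|.

Lemma raw_good (M : R) : raw_bound <= M -> good_solution ru q rH rY wb (1 + h) M G.
Proof.
move=> bM.
have h0 : 0 <= h by apply: le_trans (rs_hle S 0); apply: rint_ge0 => x _; exact: sqr_ge0.
have s0 : 0 <= src_bound h E := le_trans (normr_ge0 _) (src_boundP (rs_H1 S 0) 0).
have w0 := normr_ge0 wb; move: bM; rewrite /raw_bound => bM; have e0 := E0.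
have imz t : ib 0 1 (fun y => (1 - q t y ^+ 2) * rH t y).
  have i1 : ib 0 1 (fun y => 1 - q t y ^+ 2) by apply: ibB (iq2 t); exact: ib_cst.
  apply: (ibM i1 (mfun_sec1 t mrH) (C := src_bound h E)).
  by apply: ae_all => x _; exact: src_boundP (rs_H1 S t) x.
split.
- exact: rs_G0 S.
- exact: rs_Gge S.
- exact: rs_Gae S.
- exact: mru.
- exact: rs_mq S.
- exact: mrH.
- exact: mrY.
- exact: lq2.
- by move=> t a b ab; rewrite /ru (repB (rs_H1 S t) ab).
- exact: rYB.
- by move=> t Gt t0 a b ab; have := srcB (h := h) (rs_H1 S t) ab; rewrite (rs_w S Gt t0).
- by move=> t x; rewrite rY1 lerD2l; exact: rs_hle S t.
- by move=> t Gt x; have := rY1 t x; rewrite (rs_h S Gt); lra.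
- by move=> t Gt x; rewrite /ru (rep_periodic (rs_H1 S t)).
- move=> t Gt t0 x; have := rs_w S Gt t0.
  by rewrite -(rint_periodic x (dens_periodic (rs_H1 S t)) (ib_sdens (rs_H1 S t))).
- move=> t Gt t0 x; rewrite (rint_periodic x _ (imz t)).
    by exact: (src_mean (rs_H1 S t) (rs_h S Gt) h1).
  by move=> y; rewrite /rH (src_periodic (rs_H1 S t)) qper.
- by move=> t x; apply: le_trans (ruB t x) _; rewrite /B; lra.
- by move=> t x; apply: le_trans (src_boundP (rs_H1 S t) x) _; lra.
- by lra.
- by lra.
- by lra.
- by apply: contra h1 => /eqP e; apply/eqP; lra.
- exact: ut.
- exact: Yt.
Qed.

End Assembly.

(** * Time slices of a weak solution *)

Section RawSlices.
Context {R : realType}.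
Local Notation mu := (@lebesgue_measure R).

Lemma ae_foralln_rat (P : nat -> rat -> R -> Prop) :
  (forall n c, {ae mu, forall t, P n c t}) -> {ae mu, forall t, forall n c, P n c t}.
Proof.
move=> aeP; apply: ae_foralln => n.
have h (i : nat) : {ae mu, forall t, if @unpickle rat i is Some c then P n c t else True}.
  by case: (unpickle i) => [c|]; [exact: aeP|exact: ae_all].
by apply: ae_imp (ae_foralln h) => t H c; have := H (pickle c); rewrite pickleK.
Qed.

Lemma ib_le_ae (f g : R -> R) (C : R) : measurable_fun setT f -> ib 0 1 g ->
  {ae mu, forall x, 0 <= x <= 1 -> `|f x| <= g x} -> rint 0 1 g <= C ->
  ib 0 1 f /\ rint 0 1 (fun x => `|f x|) <= C.
Proof.
move=> mf ig fg gC; have [mg _] := ig.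
have fi : ib 0 1 f.
  apply: (@ib_ae _ _ _ _ (fun x => Num.max (- `|g x|) (Num.min `|g x| (f x)))) => //.
    apply: (ib_le _ (ib_norm ig)) => [|x _].
      apply: measurable_maxr; last first.
        by apply: measurable_minr => //; exact: measurableT_comp.
      by apply: measurableT_comp => //; exact: measurableT_comp.
    rewrite ler_norml le_max lexx /= ge_max ge_min lexx andbT /=.
    by have := normr_ge0 (g x); lra.
  apply: ae_imp fg => x h /h fx.
  have {}fx : `|f x| <= `|g x| := le_trans fx (ler_norm _).
  move: fx; rewrite ler_norml => /andP[a b].
  by rewrite min_r// max_r.
by split=> //; apply: le_trans gC; apply: le_rint_ae => //; exact: ib_norm.
Qed.

Lemma nonneg_ib (f : R -> R) : measurable_fun setT f -> (forall x, 0 <= f x) ->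
  (\int[mu]_(x in `[0%R, 1%R]) (f x)%:E < +oo)%E -> ib 0 1 f.
Proof.
move=> mf f0 fi; split=> //; apply/integrableP; split.
  by apply/measurable_EFinP; exact: measurable_funTS.
rewrite (_ : (\int[mu]_(x in _) _)%E = (\int[mu]_(x in `[0%R, 1%R]) (f x)%:E)%E)//.
by apply: eq_integral => x _ /=; rewrite ger0_norm.
Qed.

Lemma nonneg_rint_le (f : R -> R) (M : R) : (forall x, 0 <= f x) -> ib 0 1 f ->
  (\int[mu]_(x in `[0%R, 1%R]) (f x)%:E <= M%:E)%E -> rint 0 1 f <= M.
Proof.
move=> f0 [mf fi] le; rewrite -lee_fin; apply: le_trans le.
rewrite /rint /Rintegral fineK//; exact: integrable_fin_num.
Qed.

Lemma H1b_intro (E : R) (g gx : R -> R) :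
  (forall x, g (x + 1) = g x) -> (forall x, gx (x + 1) = gx x) ->
  measurable_fun setT g -> measurable_fun setT gx ->
  (\int[mu]_(x in `[0%R, 1%R]) ((g x) ^+ 2 + (gx x) ^+ 2)%:E <= E%:E)%E ->
  (forall phi, test_funS phi ->
    integS (fun x => g x * derive1 phi x) = - integS (fun x => gx x * phi x)) ->
  H1b E g gx.
Proof.
move=> pg pgx mg mgx le W.
have f0 x : 0 <= g x ^+ 2 + gx x ^+ 2 by rewrite addr_ge0 ?sqr_ge0.
have i : ib 0 1 (fun x => g x ^+ 2 + gx x ^+ 2).
  apply: nonneg_ib => //; last exact: le_lt_trans le (ltry _).
  by apply: measurable_funD; exact: measurable_funX.
split=> //; first by split=> //; exact: nonneg_rint_le.
by move=> k sk pk; apply: W; split=> // n x; exact: (smooth1P sk).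
Qed.

Lemma H1b_le (E E' : R) (g gx : R -> R) : E <= E' -> H1b E g gx -> H1b E' g gx.
Proof. by move=> EE [p a b [i l] w]; split=> //; split=> //; exact: le_trans EE. Qed.

Lemma H1b_0 (E : R) : 0 <= E -> H1b E (fun=> 0) (fun=> 0).
Proof.
move=> E0; split=> //.
  rewrite (_ : (fun _ => _) = fun=> 0); last by apply/funext => x; rewrite expr0n addr0.
  by split; [exact: ib_cst|rewrite rint_cst// mul0r].
move=> k _ _; rewrite (@eq_rint R 0 1 _ (fun=> 0)); last by move=> x _; rewrite mul0r.
rewrite (@eq_rint R 0 1 (fun x => 0 * k x) (fun=> 0)); last by move=> x _; rewrite mul0r.
by rewrite rint_cst// mul0r oppr0.
Qed.

Section Slice.
Context {E h : R} {g gx : R -> R}.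
Context (S : H1b E g gx).
Let w (x : R) : R := g x - g x * gx x ^+ 2.
Let U := rep g gx.
Let B : R := 3 * (1 + E).

Let mg : measurable_fun setT g. Proof. by have [] := S. Qed.
Let mgx : measurable_fun setT gx. Proof. by have [] := S. Qed.
Let mU : measurable_fun setT U := measurable_rep S.

Let E0 : 0 <= E. Proof. exact: H1_E S. Qed.

Let gB : {ae mu, forall x, 0 <= x <= 1 -> `|g x| <= B}.
Proof. by apply: ae_imp (rep_ae S) => x h' /h' ->; exact: rep_bound S x. Qed.

Let mw : measurable_fun setT w.
Proof. by apply: measurable_funB => //; apply: measurable_funM => //; exact: measurable_funX. Qed.

Let w_ae : {ae mu, forall x, 0 <= x <= 1 -> w x = dens g gx x}.
Proof. by apply: ae_imp (rep_ae S) => x h' /h' e; rewrite /w /dens e. Qed.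

Lemma slice_w : rint 0 1 w = rint 0 1 (dens g gx).
Proof. by apply: eq_rint_ae => //; exact: (ib_sdens S).1. Qed.

Lemma slice_dinv x : 0 <= x <= 1 -> Defs.dinv w x = zdens g gx x.
Proof.
move=> /andP[x0 x1]; rewrite /zdens /zprim (prim_ge0E _ x0).
apply: eq_rint_ae.
- by apply: measurable_funB => //; exact: measurable_cst.
- by apply: measurable_funB; [exact: (ib_sdens S).1|exact: measurable_cst].
- apply: ae_imp w_ae => y hy /andP[y0 yx].
  by rewrite /PS /meanS /integS -/(rint 0 1 w) slice_w hy// y0 (le_trans yx).
Qed.

Lemma slice_src x : 0 <= x <= 1 ->
  Defs.dinv w x - (1 - h)^-1 * integS (fun y => (1 - gx y ^+ 2) * Defs.dinv w y) = src h g gx x.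
Proof.
move=> x01; rewrite slice_dinv// /src; congr (_ - _ * _).
by apply: eq_rint => y y01; rewrite slice_dinv.
Qed.

Lemma slice_rep (k : R -> R) : measurable_fun setT k ->
  rint 0 1 (fun x => g x * k x) = rint 0 1 (fun x => U x * k x).
Proof.
move=> mk; apply: eq_rint_ae; [exact: measurable_funM|exact: measurable_funM|].
by apply: ae_imp (rep_ae S) => x h' /h' ->.
Qed.

Lemma slice_cube (k : R -> R) : measurable_fun setT k ->
  rint 0 1 (fun x => 3^-1 * g x ^+ 3 * k x) = rint 0 1 (fun x => 3^-1 * U x ^+ 3 * k x).
Proof.
move=> mk; apply: eq_rint_ae.
- by apply: measurable_funM => //; apply: measurable_funM; [exact: measurable_cst|exact: measurable_funX].
- by apply: measurable_funM => //; apply: measurable_funM; [exact: measurable_cst|exact: measurable_funX].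
- by apply: ae_imp (rep_ae S) => x h' /h' ->.
Qed.

Lemma slice_uq (c : R) (k : R -> R) : measurable_fun setT k ->
  rint 0 1 (fun x => (2 * g x * gx x - 2 * gx x * c) * k x) =
  rint 0 1 (fun x => (2 * U x * gx x - 2 * gx x * c) * k x).
Proof.
have m2 (f : R -> R) : measurable_fun setT f -> measurable_fun setT (fun x => 2 * f x).
  by move=> mf; apply: measurable_funM; [exact: measurable_cst|exact: mf].
have mc : measurable_fun setT (fun x => 2 * gx x * c).
  by apply: measurable_funM; [exact: m2|exact: measurable_cst].
move=> mk; apply: eq_rint_ae.
- by apply: measurable_funM => //; apply: measurable_funB => //; apply: measurable_funM => //; exact: m2.
- by apply: measurable_funM => //; apply: measurable_funB => //; apply: measurable_funM => //; exact: m2.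
- by apply: ae_imp (rep_ae S) => x h' /h' ->.
Qed.

Lemma slice_u2q2 (k : R -> R) : measurable_fun setT k ->
  rint 0 1 (fun x => g x ^+ 2 * gx x ^+ 2 * k x) =
  rint 0 1 (fun x => U x ^+ 2 * gx x ^+ 2 * k x).
Proof.
move=> mk; apply: eq_rint_ae.
- by do 2 (apply: measurable_funM; last by [exact: mk|exact: measurable_funX]); exact: measurable_funX.
- by do 2 (apply: measurable_funM; last by [exact: mk|exact: measurable_funX]); exact: measurable_funX.
- by apply: ae_imp (rep_ae S) => x h' /h' ->.
Qed.

(* The mean of the source of (iv) vanishes, which is why the energy keeps its
   initial value. *)
Lemma slice_uq0 (c : R) : rint 0 1 (fun x => (2 * g x * gx x - 2 * gx x * c) * 1) = 0.
Proof.
rewrite (slice_uq c (k := fun=> 1)); last exact: measurable_cst.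
have [i2 e2] := rep2B S ler01; have iq := (H1_gx S).1.
rewrite -[X in rep _ _ X]add0r (rep_periodic S) subrr in e2.
rewrite (_ : rint 0 1 _ = rint 0 1 (fun x => 2 * rep g gx x * gx x - 2 * c * gx x)).
  by rewrite (rintB i2 (ibZ _ iq)) (rintZ _ iq) -e2 (H1_mean0 S) mulr0 subrr.
by congr rint; apply/funext => x; rewrite /U; ring.
Qed.

(** A common bound for the norms of all the integrands in (ii) and (iv), since [weak_evolution]
    takes a single constant. *)
Definition slice_bound (c : R) : R :=
  (1 + E) + B ^+ 2 * E + (2 * B + 2 * `|c|) * (1 + E) + B ^+ 3 + src_bound h E.

Let iq2 : ib 0 1 (fun x => gx x ^+ 2). Proof. by have [] := H1_sq S. Qed.
Let q2E : rint 0 1 (fun x => gx x ^+ 2) <= E. Proof. by have [] := H1_sq S. Qed.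

Let bnds (c : R) : [/\ 0 <= B ^+ 2 * E, 0 <= (2 * B + 2 * `|c|) * (1 + E), 0 <= B ^+ 3 &
  0 <= src_bound h E].
Proof.
have B0 : 0 <= B by rewrite /B; move: E0; lra.
split.
- by rewrite mulr_ge0 ?sqr_ge0.
- by apply: mulr_ge0; [apply: addr_ge0; exact: mulr_ge0|move: E0; lra].
- exact: exprn_ge0.
- exact: le_trans (normr_ge0 _) (src_boundP S 0).
Qed.

Let rint_n (f : R -> R) (C c : R) : ib 0 1 f /\ rint 0 1 (fun x => `|f x|) <= C ->
  C <= slice_bound c -> ib 0 1 f /\ rint 0 1 (fun x => `|f x|) <= slice_bound c.
Proof. by move=> [a b] l; split=> //; exact: le_trans l. Qed.

Lemma slice_bounds_iv (c : R) :
  [/\ ib 0 1 (fun x => gx x ^+ 2) /\ rint 0 1 (fun x => `|gx x ^+ 2|) <= slice_bound c,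
    ib 0 1 (fun x => g x ^+ 2 * gx x ^+ 2) /\
      rint 0 1 (fun x => `|g x ^+ 2 * gx x ^+ 2|) <= slice_bound c &
    ib 0 1 (fun x => 2 * g x * gx x - 2 * gx x * c) /\
      rint 0 1 (fun x => `|2 * g x * gx x - 2 * gx x * c|) <= slice_bound c].
Proof.
have [b1 b2 b3 b4] := bnds c; have e0 := E0; rewrite /slice_bound.
split.
- apply: (rint_n (C := E)); last by rewrite /slice_bound; lra.
  apply: (ib_le_ae _ iq2) => //; first exact: measurable_funX.
  by apply: ae_all => x _; rewrite ger0_norm ?sqr_ge0.
- apply: (rint_n (C := B ^+ 2 * E)); last by rewrite /slice_bound; lra.
  apply: (ib_le_ae _ (ibZ (B ^+ 2) iq2)).
  + by apply: measurable_funM; exact: measurable_funX.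
  + apply: ae_imp gB => x hx /hx gx_.
    rewrite normrM !ger0_norm ?sqr_ge0//; apply: ler_wpM2r; first exact: sqr_ge0.
    by rewrite -[_ ^+ 2]real_normK ?num_real// lerXn2r ?nnegrE//; exact: le_trans gx_.
  + by rewrite (rintZ _ iq2); apply: ler_wpM2l => //; exact: sqr_ge0.
- have [iq lq] := H1_gx S.
  apply: (rint_n (C := (2 * B + 2 * `|c|) * (1 + E))); last by rewrite /slice_bound; lra.
  apply: (ib_le_ae _ (ibZ (2 * B + 2 * `|c|) (ib_norm iq))).
  + apply: measurable_funB; apply: measurable_funM => //; try exact: measurable_cst.
      by apply: measurable_funM => //; exact: measurable_cst.
    by apply: measurable_funM => //; exact: measurable_cst.
  + apply: ae_imp gB => x hx /hx gx_.
    rewrite (_ : _ - _ = 2 * (g x - c) * gx x); last by ring.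
    rewrite normrM; apply: ler_wpM2r => //; rewrite normrM [`|2|]ger0_norm// -mulrDr.
    by apply: ler_wpM2l => //; apply: le_trans (ler_normB _ _) _; rewrite lerD2r.
  + rewrite (rintZ _ (ib_norm iq)); apply: ler_wpM2l => //.
    by apply: addr_ge0; rewrite mulr_ge0// /B; lra.
Qed.

Lemma slice_bounds_ii (c : R) (F : R -> R) : measurable_fun setT F ->
  (forall x, 0 <= x <= 1 -> F x = src h g gx x) ->
  [/\ ib 0 1 g /\ rint 0 1 (fun x => `|g x|) <= slice_bound c,
    ib 0 1 (fun x => 3^-1 * g x ^+ 3) /\
      rint 0 1 (fun x => `|3^-1 * g x ^+ 3|) <= slice_bound c &
    ib 0 1 F /\ rint 0 1 (fun x => `|F x|) <= slice_bound c].
Proof.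
move=> mF FE; have [b1 b2 b3 b4] := bnds c; have e0 := E0; have [ig lg] := H1_g S.
split.
- by apply: (rint_n (C := 1 + E)) => //; rewrite /slice_bound; lra.
- apply: (rint_n (C := B ^+ 3)); last by rewrite /slice_bound; lra.
  apply: (ib_le_ae _ (ib_cst 0 1 (B ^+ 3))).
  + by apply: measurable_funM; [exact: measurable_cst|exact: measurable_funX].
  + apply: ae_imp gB => x hx /hx gx_; rewrite normrM normrX ger0_norm ?invr_ge0//.
    have : `|g x| ^+ 3 <= B ^+ 3 by rewrite lerXn2r ?nnegrE//; exact: le_trans gx_.
    have : 0 <= `|g x| ^+ 3 by exact: exprn_ge0.
    lra.
  + by rewrite rint_cst//; lra.
- apply: (rint_n (C := src_bound h E)); last by rewrite /slice_bound; lra.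
  apply: (ib_le_ae _ (ib_cst 0 1 (src_bound h E))) => //.
  + by apply: ae_all => x x01; rewrite FE//; exact: src_boundP S x.
  + by rewrite rint_cst//; lra.
Qed.

End Slice.
End RawSlices.

(** The weak formulation does not prescribe the slice at time [0], which is set to the initial
    datum, and slices at discarded times are set to [0]. Multiplication by indicators of measurable
    sets of times keeps joint measurability. *)
Lemma select_times (R : realType) (A : set R) (f : R -> R -> R) (f0 : R -> R) :
  measurable A -> ~ A 0 -> measurable_fun setT (fun p : R * R => f p.1 p.2) ->
  measurable_fun setT f0 ->
  exists r : R -> R -> R, [/\ measurable_fun setT (fun p : R * R => r p.1 p.2),
    forall t, A t -> r t = f t, r 0 = f0 & forall t, ~ A t -> t != 0 -> r t = fun=> 0].
Proof.
move=> mA nA0 mf mf0.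
exists (fun t x => \1_A t * f t x + \1_[set 0] t * f0 x); split.
- apply: measurable_funD; apply: measurable_funM => //.
  + exact: (jm1 (measurable_indic mA)).
  + exact: (jm1 (measurable_indic (measurable_set1 0))).
  + exact: jm2.
- move=> t At; apply/funext => x; rewrite !indicE mem_set// memNset ?mul1r ?mul0r ?addr0//.
  by move=> /= t0; rewrite t0 in At.
- by apply/funext => x; rewrite !indicE memNset// mem_set// mul1r mul0r add0r.
- move=> t nA t0; apply/funext => x; rewrite !indicE memNset// memNset ?mul0r ?addr0//.
  by move=> /= t1; rewrite t1 eqxx in t0.
Qed.

(** * Admissible solutions at good times *)

Section Admissible.
Context {R : realType} {u0 u0x : R -> R} {u ux : R -> R -> R}.
Context (H0 : H1S u0 u0x) (Hu : admissible_sol u0 u0x u ux).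
Local Notation mu := (@lebesgue_measure R).
Let h : R := rint 0 1 (fun x => u0x x ^+ 2).

Let jmu : measurable_fun setT (fun p : R * R => u p.1 p.2).
Proof. by have [[]] := Hu. Qed.

Let jmux : measurable_fun setT (fun p : R * R => ux p.1 p.2).
Proof. by have [[]] := Hu. Qed.

Let jw : measurable_fun setT (fun p : R * R => wfun u ux p.1 p.2).
Proof. by apply: measurable_funB => //; apply: measurable_funM => //; exact: measurable_funX. Qed.

Let mmean : measurable_fun setT (fun t : R => meanS (wfun u ux t)).
Proof. exact: (measurable_rint01 0 1 jw). Qed.

Definition src_raw (t x : R) : R := Defs.dinv (wfun u ux t) x - fterm h u ux t.

Definition fl_raw (t x : R) : R :=
  2 * u t x * ux t x - 2 * ux t x * meanS (wfun u ux t).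

Let jfl : measurable_fun setT (fun p : R * R => fl_raw p.1 p.2).
Proof.
apply: measurable_funB; apply: measurable_funM => //.
- by apply: measurable_funM => //; exact: measurable_cst.
- by apply: measurable_funM => //; exact: measurable_cst.
- exact: (jm1 mmean).
Qed.

Let jdinv : measurable_fun setT (fun p : R * R => Defs.dinv (wfun u ux p.1) p.2).
Proof.
apply: (@measurable_rint_param R _ _ (fun p : R * R => PS (wfun u ux p.1)) (fun=> 0) snd).
- apply: measurable_funB.
    apply: (@mfun_comp2 R _ _ (wfun u ux) (fun z : (R * R) * R => z.1.1) (fun z => z.2)).
    + exact: jw.
    + exact: (measurableT_comp measurable_fst measurable_fst).
    + exact: measurable_snd.
  exact: (measurableT_comp mmean (measurableT_comp measurable_fst measurable_fst)).
- exact: measurable_cst.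
- exact: measurable_snd.
Qed.

Let jsrc : measurable_fun setT (fun p : R * R => src_raw p.1 p.2).
Proof.
apply: measurable_funB => //.
have jf : measurable_fun setT (fun p : R * R => (1 - ux p.1 p.2 ^+ 2) * Defs.dinv (wfun u ux p.1) p.2).
  apply: measurable_funM => //; apply: measurable_funB; first exact: measurable_cst.
  exact: measurable_funX.
have mf : measurable_fun setT (fun t : R => fterm h u ux t).
  apply: measurable_funM; first exact: measurable_cst.
  exact: (@measurable_rint01 R (fun t y => (1 - ux t y ^+ 2) * Defs.dinv (wfun u ux t) y) 0 1 jf).
exact: (jm1 mf).
Qed.

Let jux2 : measurable_fun setT (fun p : R * R => ux p.1 p.2 ^+ 2).
Proof. exact: measurable_funX. Qed.

Let ju2ux2 : measurable_fun setT (fun p : R * R => u p.1 p.2 ^+ 2 * ux p.1 p.2 ^+ 2).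
Proof. by apply: measurable_funM => //; exact: measurable_funX. Qed.

Let ju3 : measurable_fun setT (fun p : R * R => 3^-1 * u p.1 p.2 ^+ 3).
Proof. by apply: measurable_funM; [exact: measurable_cst|exact: measurable_funX]. Qed.

Let u0_H1b : exists E, H1b E u0 u0x.
Proof.
have [[pg pgx] mg mgx lt W] := H0.
exists (rint 0 1 (fun x => u0 x ^+ 2 + u0x x ^+ 2)).
apply: H1b_intro => //; rewrite /rint /Rintegral fineK//.
rewrite ge0_fin_numE//; apply: integral_ge0 => x _.
by rewrite lee_fin addr_ge0 ?sqr_ge0.
Qed.

Let slices : exists E C1 C2 : R, H1b E u0 u0x /\ {ae mu, forall t, 0 <= t ->
  [/\ H1b E (u t) (ux t), rint 0 1 (fun x => ux t x ^+ 2) = C1 &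
    meanS (wfun u ux t) = C2]}.
Proof.
have [E1 H01] := u0_H1b.
have [[_ _ [pu pux] [M HM] W] _ _ [C1 [C2 HC]] _] := Hu.
exists (Num.max E1 M), C1, C2; split.
  by apply: H1b_le H01; rewrite le_max lexx.
have ae1 : {ae mu, forall t, 0 <= t -> H1b (Num.max E1 M) (u t) (ux t)}.
  move: HM W; apply: ae_imp2 => t h1 h2 t0.
  apply: (@H1b_le _ M); first by rewrite le_max lexx orbT.
  apply: (H1b_intro (pu t) (pux t) (mfun_sec1 t jmu) (mfun_sec1 t jmux) (h1 t0)).
  exact: h2.
move: ae1 HC; apply: ae_imp2 => t h1 h2 t0; have [a b] := h2 t0.
by split; [exact: h1|exact: a|exact: b].
Qed.

Let iu0x2 : ib 0 1 (fun x => u0x x ^+ 2).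
Proof. by have [E /H1_sq[]] := u0_H1b. Qed.

Let evol_iv (E C2 : R) (k : R -> R) :
  {ae mu, forall t, 0 <= t -> H1b E (u t) (ux t) /\ meanS (wfun u ux t) = C2} ->
  smooth1 k -> (forall x, k (x + 1) = k x) ->
  {ae mu, forall t, 0 <= t ->
    rint 0 1 (fun x => ux t x ^+ 2 * k x) = rint 0 1 (fun x => u0x x ^+ 2 * k x) +
    rint 0 t (fun s => rint 0 1 (fun x => fl_raw s x * k x) -
                       rint 0 1 (fun x => u s x ^+ 2 * ux s x ^+ 2 * derive1 k x))}.
Proof.
move=> good; have [_ _ _ _ H] := Hu.
apply: (@weak_evolution R (fun t x => ux t x ^+ 2) (fun t x => u t x ^+ 2 * ux t x ^+ 2)
  fl_raw (fun x => u0x x ^+ 2) (slice_bound (h := h) (E := E) C2) jux2 ju2ux2 jfl iu0x2 _ H).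
apply: ae_imp good => t Ht /Ht [S m].
by have := slice_bounds_iv (h := h) S C2; rewrite /fl_raw m.
Qed.

Let evol_ii (E C2 : R) (k : R -> R) :
  {ae mu, forall t, 0 <= t -> H1b E (u t) (ux t) /\ meanS (wfun u ux t) = C2} ->
  smooth1 k -> (forall x, k (x + 1) = k x) ->
  {ae mu, forall t, 0 <= t ->
    rint 0 1 (fun x => u t x * k x) = rint 0 1 (fun x => u0 x * k x) +
    rint 0 t (fun s => rint 0 1 (fun x => src_raw s x * k x) -
                       rint 0 1 (fun x => 3^-1 * u s x ^+ 3 * derive1 k x))}.
Proof.
move=> good; have [_ _ H _ _] := Hu; have [E1 H01] := u0_H1b.
apply: (@weak_evolution R u (fun t x => 3^-1 * u t x ^+ 3)
  src_raw u0 (slice_bound (h := h) (E := E) C2) jmu ju3 jsrc (H1_g H01).1 _ H).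
apply: ae_imp good => t Ht /Ht [S m].
apply: (slice_bounds_ii S C2 (mfun_sec1 t jsrc)) => x x01.
exact: (slice_src S x01).
Qed.

Let energy (E C1 C2 : R) :
  {ae mu, forall t, 0 <= t -> [/\ H1b E (u t) (ux t), rint 0 1 (fun x => ux t x ^+ 2) = C1 &
    meanS (wfun u ux t) = C2]} -> C1 = h.
Proof.
move=> good.
have good2 : {ae mu, forall t, 0 <= t -> H1b E (u t) (ux t) /\ meanS (wfun u ux t) = C2}.
  by apply: ae_imp good => t Ht /Ht[].
have h1 := evol_iv good2 (smooth_cst 1) (fun=> erefl).
have ae1 : {ae mu, forall t, 0 <= t <= 1 -> [/\ 0 <= t,
    rint 0 1 (fun x => ux t x ^+ 2 * 1) = rint 0 1 (fun x => u0x x ^+ 2 * 1) +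
    rint 0 t (fun s => rint 0 1 (fun x => fl_raw s x * 1) -
      rint 0 1 (fun x => u s x ^+ 2 * ux s x ^+ 2 * derive1 (fun _ : R => 1 : R) x)) &
    rint 0 1 (fun x => ux t x ^+ 2) = C1]}.
  move: good h1; apply: ae_imp2 => t g1 g2 /andP[t0 _].
  by split=> //; [exact: g2|have [] := g1 t0].
(* The energy being a constant [C1] almost everywhere in time, one time at which the tested equation
   holds identifies it. *)
have [t [t0 e1 e2] _] := @ae_dense R _ 0 1 0 1 ae1 (lexx _) ltr01 (lexx _).
move: e1; rewrite (_ : rint 0 t _ = 0); last first.
  rewrite (_ : rint 0 t _ = rint 0 t (fun=> 0)); first by rewrite rint_cst// mul0r.
  apply: eq_rint_ae.
  - apply: measurable_funB.
      apply: (@measurable_rint01 R (fun s x => fl_raw s x * 1)).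
      by apply: (@jmM R fl_raw (fun _ _ => 1) jfl); exact: measurable_cst.
    apply: (@measurable_rint01 R (fun s x => u s x ^+ 2 * ux s x ^+ 2 * derive1 (fun _ : R => 1 : R) x)).
    apply: (@jmM R (fun s x => u s x ^+ 2 * ux s x ^+ 2) (fun _ => derive1 (fun _ : R => 1 : R)) ju2ux2).
    exact: (jm2 (smooth_measurable (smooth_der (smooth_cst 1)))).
  - exact: measurable_cst.
  - apply: ae_imp good2 => s Hs /andP[s0 _]; have [S m] := Hs s0.
    rewrite /fl_raw m (slice_uq0 S C2) (@eq_rint R 0 1 _ (fun=> 0)).
      by rewrite rint_cst// mul0r subrr.
    by move=> x _; rewrite (dvE (dv_cst 1 x)) mulr0.
rewrite addr0 /h -e2 => e; transitivity (rint 0 1 (fun x => ux t x ^+ 2 * 1)).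
  by congr rint; apply/funext => x; rewrite mulr1.
by rewrite e; congr rint; apply/funext => x; rewrite mulr1.
Qed.

Let eq_ii (k : R -> R) (t : R) : Prop :=
  rint 0 1 (fun x => u t x * k x) = rint 0 1 (fun x => u0 x * k x) +
    rint 0 t (fun s => rint 0 1 (fun x => src_raw s x * k x) -
                       rint 0 1 (fun x => 3^-1 * u s x ^+ 3 * derive1 k x)).

Let eq_iv (k : R -> R) (t : R) : Prop :=
  rint 0 1 (fun x => ux t x ^+ 2 * k x) = rint 0 1 (fun x => u0x x ^+ 2 * k x) +
    rint 0 t (fun s => rint 0 1 (fun x => fl_raw s x * k x) -
                       rint 0 1 (fun x => u s x ^+ 2 * ux s x ^+ 2 * derive1 k x)).

Let good_times : exists (E C2 : R) (A : set R), [/\ H1b E u0 u0x, measurable A,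
  {ae mu, forall t, 0 <= t -> t = 0 \/ A t} &
  forall t, A t -> 0 < t /\ [/\ H1b E (u t) (ux t),
    rint 0 1 (fun x => ux t x ^+ 2) = h, meanS (wfun u ux t) = C2 &
    forall n (c : rat), eq_ii (kern n (ratr c)) t /\ eq_iv (zprim (kern n (ratr c))) t]].
Proof.
have [E [C1 [C2 [H01 good]]]] := slices.
have Ch := energy good; rewrite {}Ch in good.
have good2 : {ae mu, forall t, 0 <= t -> H1b E (u t) (ux t) /\ meanS (wfun u ux t) = C2}.
  by apply: ae_imp good => t Ht /Ht[].
have aek : {ae mu, forall t, forall n (c : rat), 0 <= t ->
    eq_ii (kern n (ratr c)) t /\ eq_iv (zprim (kern n (ratr c))) t}.
  apply: (@ae_foralln_rat R (fun n c t => 0 <= t ->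
    eq_ii (kern n (ratr c)) t /\ eq_iv (zprim (kern n (ratr c))) t)) => n c.
  have sk : smooth1 (kern n (ratr c : R)) := smooth_kern n (ratr c).
  have pk : forall x : R, kern n (ratr c) (x + 1) = kern n (ratr c) x := kern_periodic n (ratr c).
  move: (evol_ii good2 sk pk) (evol_iv good2 (smooth_zprim sk) (zprim_periodic sk pk)).
  apply: ae_imp2 => t a b t0; split; [exact: (a t0)|exact: (b t0)].
have all : {ae mu, forall t, 0 <= t -> [/\ H1b E (u t) (ux t),
    rint 0 1 (fun x => ux t x ^+ 2) = h, meanS (wfun u ux t) = C2 &
    forall n (c : rat), eq_ii (kern n (ratr c)) t /\ eq_iv (zprim (kern n (ratr c))) t]}.
  by move: good aek; apply: ae_imp2 => t a b t0; have [x y z] := a t0; split=> // n c; exact: b.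
have [N [mN N0 NG]] := all.
(* Good times are taken as the complement of a measurable null set that covers the bad ones, which
   makes the selection of slices measurable. *)
have mA : measurable (`]0%R, +oo[%classic `\` N : set R) by apply: measurableD.
exists E, C2, (`]0%R, +oo[%classic `\` N); split=> //.
  exists N; split=> // t /= nt; apply: contrapT => Nt; apply: nt => t0.
  have [->|tn0] := eqVneq t 0; [by left|right].
  by split=> //=; rewrite in_itv/= andbT lt_neqAle eq_sym tn0.
move=> t [/=]; rewrite in_itv/= andbT => t0 Nt; split=> //.
by apply: contrapT => h'; apply: Nt; apply: NG => /= H; apply: h'; apply: H; exact: ltW.
Qed.

Lemma admissible_raw : exists (r q : R -> R -> R) (E wb : R) (G : R -> Prop),
  [/\ raw_solution r q E h wb G, r 0 = u0, q 0 = u0x &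
    forall t, G t -> 0 < t -> r t = u t /\ q t = ux t].
Proof.
have [E [C2 [A [H01 mA aeA HA]]]] := good_times.
have [_ mu0 mu0x _ _] := H01.
have nA0 : ~ A 0 by move=> /HA[]; rewrite ltxx.
have [r [jr rA r0 rN]] := select_times mA nA0 jmu mu0.
have [q [jq qA q0 qN]] := select_times mA nA0 jmux mu0x.
pose G t := t = 0 \/ A t.
have E0 : 0 <= E := H1_E H01.
have h0 : 0 <= h by apply: rint_ge0 => x _; exact: sqr_ge0.
(* Bounds required at every time are checked on the three kinds of slices: good times, the initial
   datum, and the zero function. *)
have cases (P : (R -> R) -> (R -> R) -> Prop) t : (A t -> P (u t) (ux t)) ->
    P u0 u0x -> P (fun=> 0) (fun=> 0) -> P (r t) (q t).
  move=> pA p0 pN; have [At|nA] := pselect (A t).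
    by rewrite (rA _ At) (qA _ At); exact: pA.
  have [t0|tn0] := eqVneq t 0; first by rewrite t0 r0 q0.
  by rewrite (rN _ nA tn0) (qN _ nA tn0).
have aeA' (t : R) : {ae mu, forall s, 0 <= s <= t -> A s}.
  have n0 := ae_neq (0 : R); move: aeA n0; apply: ae_imp2 => s a sn0 /andP[s0 _].
  by have [s1|//] := a s0; rewrite s1 eqxx in sn0.
have key_u (k : R -> R) t : smooth1 k -> A t -> eq_ii k t -> ev_u r q h k t.
  move=> sk At eii; have mk := smooth_measurable sk.
  have mk' := smooth_measurable (smooth_der sk).
  have [_ [S _ _ _]] := HA t At.
  have {}eii : rint 0 1 (fun x => rep (u t) (ux t) x * k x) =
      rint 0 1 (fun x => rep u0 u0x x * k x) + rint 0 t (fun s =>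
        rint 0 1 (fun x => src_raw s x * k x) -
        rint 0 1 (fun x => 3^-1 * u s x ^+ 3 * derive1 k x)).
    apply: (etrans (esym (slice_rep S mk))); apply: (etrans eii).
    by apply: (congr1 (fun z => z + _)); exact: (slice_rep H01 mk).
  rewrite /ev_u (rA _ At) (qA _ At) r0 q0.
  apply: (etrans eii); apply: (congr1 (fun z => _ + z)); apply: eq_rint_ae.
  + apply: measurable_funB.
      apply: (@measurable_rint01 R (fun s x => src_raw s x * k x)).
      by apply: (@jmM R src_raw (fun _ => k) jsrc); exact: jm2.
    apply: (@measurable_rint01 R (fun s x => 3^-1 * u s x ^+ 3 * derive1 k x)).
    by apply: (@jmM R (fun s x => 3^-1 * u s x ^+ 3) (fun _ => derive1 k) ju3); exact: jm2.
  + apply: measurable_funB.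
      apply: (@measurable_rint01 R (fun s x => src h (r s) (q s) x * k x)).
      by apply: (@jmM R (fun s => src h (r s) (q s)) (fun _ => k) (jm_src h jr jq)); exact: jm2.
    apply: (@measurable_rint01 R (fun s x => 3^-1 * rep (r s) (q s) x ^+ 3 * derive1 k x)).
    apply: (@jmM R (fun s x => 3^-1 * rep (r s) (q s) x ^+ 3) (fun _ => derive1 k)); last exact: jm2.
    apply: measurable_funM; first exact: measurable_cst.
    by apply: measurable_funX; exact: jm_rep.
  + apply: ae_imp (aeA' t) => s Hs /Hs As; have [_ [Ss _ _ _]] := HA s As.
    rewrite (rA _ As) (qA _ As) (slice_cube Ss mk').
    apply: (congr1 (fun z => z - _)); apply: eq_rint => x x01.
    by rewrite -(slice_src Ss x01).
have key_q (m : R -> R) t : smooth1 m -> A t -> eq_iv m t -> ev_q r q C2 m t.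
  move=> sm At eiv; have mm := smooth_measurable sm.
  have mm' := smooth_measurable (smooth_der sm).
  rewrite /ev_q (qA _ At) q0.
  apply: (etrans eiv); apply: (congr1 (fun z => _ + z)); apply: eq_rint_ae.
  + apply: measurable_funB.
      apply: (@measurable_rint01 R (fun s x => fl_raw s x * m x)).
      by apply: (@jmM R fl_raw (fun _ => m) jfl); exact: jm2.
    apply: (@measurable_rint01 R (fun s x => u s x ^+ 2 * ux s x ^+ 2 * derive1 m x)).
    by apply: (@jmM R (fun s x => u s x ^+ 2 * ux s x ^+ 2) (fun _ => derive1 m) ju2ux2); exact: jm2.
  + have jre := jm_rep jr jq.
    have j2 (f : R * R -> R) : measurable_fun setT f -> measurable_fun setT (fun p => 2 * f p).
      by move=> mf; apply: measurable_funM; [exact: measurable_cst|exact: mf].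
    apply: measurable_funB.
      apply: (@measurable_rint01 R (fun s x => (2 * rep (r s) (q s) x * q s x - 2 * q s x * C2) * m x)).
      apply: (@jmM R (fun s x => 2 * rep (r s) (q s) x * q s x - 2 * q s x * C2) (fun _ => m)); last exact: jm2.
      apply: measurable_funB; apply: measurable_funM; [exact: j2|exact: jq|exact: j2|exact: measurable_cst].
    apply: (@measurable_rint01 R (fun s x => rep (r s) (q s) x ^+ 2 * q s x ^+ 2 * derive1 m x)).
    apply: (@jmM R (fun s x => rep (r s) (q s) x ^+ 2 * q s x ^+ 2) (fun _ => derive1 m)); last exact: jm2.
    by apply: measurable_funM; exact: measurable_funX.
  + apply: ae_imp (aeA' t) => s Hs /Hs As; have [_ [Ss _ e _]] := HA s As.
    by rewrite (rA _ As) (qA _ As) /fl_raw e (slice_uq Ss C2 mm) (slice_u2q2 Ss mm').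
exists r, q, E, C2, G; split; [split|exact: r0|exact: q0|].
- by move=> t; apply: (cases (H1b E)) => //; [move=> /HA[_ []]|exact: H1b_0].
- exact: jr.
- exact: jq.
- by left.
- by move=> t [->//|/HA[/ltW]].
- exact: aeA.
- move=> t; apply: (cases (fun _ f => rint 0 1 (fun x => f x ^+ 2) <= h)) => //.
    by move=> /HA[_ [_ -> _ _]].
  by rewrite (@eq_rint R 0 1 _ (fun=> 0)) ?rint_cst ?mul0r// => x _; rewrite expr0n.
- move=> t [->|At]; first by rewrite q0.
  by rewrite (qA _ At); have [_ []] := HA t At.
- move=> t [->|At] t0; first by rewrite ltxx in t0.
  rewrite (rA _ At) (qA _ At); have [_ [S _ <- _]] := HA t At; exact/esym/(slice_w S).
- move=> n c t [->|At]; first by rewrite /ev_u [rint 0 0 _]rint_pt// addr0.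
  have [_ [_ _ _ /(_ n c)[eii _]]] := HA t At.
  exact: (key_u _ _ (smooth_kern n _) At eii).
- move=> n c t [->|At]; first by rewrite /ev_q [rint 0 0 _]rint_pt// addr0.
  have [_ [_ _ _ /(_ n c)[_ eiv]]] := HA t At.
  exact: (key_q _ _ (smooth_zprim (smooth_kern n _)) At eiv).
- by move=> t [->|At] t0; [rewrite ltxx in t0|split; [exact: rA|exact: qA]].
Qed.

End Admissible.

Theorem theorem5p1 (R : realType) (u0 u0x : R -> R)
  (Hu0 : H1S u0 u0x)
  (Hh : integS (fun x => ((u0x x) ^+ 2)%R) != 1)
  (u ux v vx : R -> R -> R)
  (Hu : admissible_sol u0 u0x u ux)
  (Hv : admissible_sol u0 u0x v vx) :
  {ae (@lebesgue_measure R), forall t, 0 <= t ->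
     {ae (@lebesgue_measure R), forall x, u t x = v t x}}.
Proof.
have [r1 [q1 [E1 [w1 [G1 [S1 r10 q10 G1u]]]]]] := admissible_raw Hu0 Hu.
have [r2 [q2 [E2 [w2 [G2 [S2 r20 q20 G2v]]]]]] := admissible_raw Hu0 Hv.
set h := rint 0 1 _ in S1 S2.
(* The comparison needs one constant for both solutions; the means [w1] and [w2] are not yet known
   to agree. *)
pose M := Num.max (raw_bound (E := E1) (h := h) (wb := w1)) (raw_bound (E := E2) (h := h) (wb := w2)).
have gs1 := raw_good S1 Hh (M := M) (ltac:(by rewrite le_max lexx)).
have gs2 := raw_good S2 Hh (M := M) (ltac:(by rewrite le_max lexx orbT)).
have u12 : ru (r := r1) (q := q1) 0 = ru (r := r2) (q := q2) 0.
  by rewrite /ru r10 q10 r20 q20.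
(* The additive constant in [rY] vanishes at time [0], so the possibly different means do not
   enter. *)
have Y12 : rY (r := r1) (q := q1) (wb := w1) 0 = rY (r := r2) (q := q2) (wb := w2) 0.
  by apply/funext => x; rewrite !rY0 q10 q20.
have key := good_solution_unique gs1 gs2 u12 Y12.
have pu : (forall t x, u t (x + 1) = u t x) by have [[_ _ []]] := Hu.
have pv : (forall t x, v t (x + 1) = v t x) by have [[_ _ []]] := Hv.
move: (rs_Gae S1) (rs_Gae S2) (ae_neq (0 : R)).
move=> a1 a2 a3; move: (ae_imp2 (fun t p p' => conj p p') a1 a2) a3.
apply: ae_imp2 => t [g1 g2] tn0 t0.
have tp : 0 < t by rewrite lt_neqAle eq_sym tn0.
have [e1 _] := G1u t (g1 t0) tp; have [e2 _] := G2v t (g2 t0) tp.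
have pP x : u t (x + 1) = v t (x + 1) <-> u t x = v t x by rewrite pu pv; split.
apply: (ae_periodic pP).
(* The continuous representatives agree everywhere at good times; [u] and [v] equal them for almost
   every [x]. *)
have e12 : rep (u t) (q1 t) = rep (v t) (q2 t).
  by rewrite -e1 -e2; exact: (key t (g1 t0) (g2 t0)).
have := rep_ae (rs_H1 S1 t); have := rep_ae (rs_H1 S2 t); rewrite e1 e2 e12.
by apply: ae_imp2 => x h2 h1 x01; exact: (etrans (h1 x01) (esym (h2 x01))).
Qed.
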